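(* Let ND be a class of network design problems in the sense described in the context. If there exists a deterministic (respectively randomized) $\gamma$-approximation algorithm for the offline problem ND which runs in polynomial time, then there exists an $O(\gamma\log|\mathcal{E}|)$-competitive deterministic (respectively randomized) online algorithm for ND with deadlines, which also runs in polynomial time. Here $\mathcal{E}$ is the set of elements of the instance.
   Context: An instance of an (abstract) network design problem consists of a finite set $\mathcal{E}$ of elements with costs $c:\mathcal{E}\to\mathbb{R}^+$, together with a description of requests: each request $q$ is associated with an upward-closed family $X_q\subseteq 2^{\mathcal{E}}$ (if $E_1\subseteq E_2\subseteq\mathcal{E}$ and $E_1\in X_q$ then $E_2\in X_q$); a set $E\subseteq\mathcal{E}$ satisfies $q$ if $E\in X_q$. The offline problem: given a finite set $Q$ of requests, find $E\subseteq\mathcal{E}$ with $E\in X_q$ for all $q\in Q$ minimizing $c(E)=\sum_{e\in E}c(e)$. ND denotes a class of such problems (e.g. Steiner forest: elements are edges of a graph, a request is a pair of vertices, satisfied by edge sets connecting them). A $\gamma$-approximation algorithm returns, for every input, a feasible solution of cost at most $\gamma$ times the optimum; for randomized algorithms the approximation guarantee holds deterministically and the running-time bound holds in expectation. ND with deadlines (online): the elements and costs are known in advance; requests arrive over time, request $q$ being released at time $r_q$ with a deadline $d_q$ revealed upon release. At any time the algorithm may transmit a set $E\subseteq\mathcal{E}$ at cost $c(E)$; every pending (released, not yet served) request $q$ with $E\in X_q$ is served. Every request must be served by a transmission at a time in $[r_q,d_q]$. The cost of an algorithm is its total transmission cost. An online algorithm is $\alpha$-competitive if on every input its (expected, if randomized)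 cost is at most $\alpha$ times the cost of the optimal offline solution. *)

(* Defs.v *)
From HB Require Import structures.
From mathcomp Require Import all_boot all_order all_algebra.
From mathcomp Require Import all_classical all_reals all_analysis.

Set Implicit Arguments.
Unset Strict Implicit.
Unset Printing Implicit Defensive.

Import Order.TTheory GRing.Theory Num.Theory.

Local Open Scope ring_scope.

(* Model of computation: WHILE programs over binary trees with integer leaves,*)
(* with a coin-flip instruction, under the logarithmic cost criterion: each   *)
(* evaluated subexpression costs the bit size of the value it produces.       *)

Inductive data : Type := Int of int | Pair of data & data.

Fixpoint eq_data (d e : data) : bool :=
  match d, e with
  | Int x, Int y => x == y
  | Pair d1 d2, Pair e1 e2 => eq_data d1 e1 && eq_data d2 e2
  | _, _ => false
  end.

Lemma eq_dataP : Equality.axiom eq_data.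
Proof.
elim=> [x|d1 IH1 d2 IH2] [y|e1 e2] /=; try by constructor.
  by apply: (iffP eqP) => [->|[]].
by apply: (iffP andP) => [[/IH1-> /IH2->]|[<- <-]] //; split; [apply/IH1|apply/IH2].
Qed.

HB.instance Definition _ := hasDecEq.Build data eq_dataP.

Fixpoint dsize (d : data) : nat :=
  match d with
  | Int z => (trunc_log 2 `|z|%N).+1
  | Pair d1 d2 => (dsize d1 + dsize d2).+1
  end.

Definition dfst (d : data) : data := if d is Pair d1 _ then d1 else Int 0.
Definition dsnd (d : data) : data := if d is Pair _ d2 then d2 else Int 0.
Definition dint (d : data) : int := if d is Int z then z else 0.
Definition dbool (b : bool) : data := Int (Posz b).

Inductive binop : Type := OpPair | OpAdd | OpSub | OpMul | OpLeq | OpEq.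

Definition binop_sem (o : binop) (d e : data) : data :=
  match o with
  | OpPair => Pair d e
  | OpAdd => Int (dint d + dint e)
  | OpSub => Int (dint d - dint e)
  | OpMul => Int (dint d * dint e)
  | OpLeq => dbool (dint d <= dint e)
  | OpEq => dbool (d == e)
  end.

Inductive expr : Type :=
| Var of nat
| Const of data
| Fst of expr
| Snd of expr
| Bin of binop & expr & expr.

Inductive cmd : Type :=
| Skip
| Assign of nat & expr
| Flip of nat
| Seq of cmd & cmd
| If of expr & cmd & cmd
| While of expr & cmd.

Definition store : Type := nat -> data.

Definition upd (s : store) (x : nat) (d : data) : store :=
  fun y => if y == x then d else s y.

Fixpoint eval (s : store) (e : expr) : data :=
  match e with
  | Var x => s x
  | Const d => d
  | Fst e1 => dfst (eval s e1)
  | Snd e1 => dsnd (eval s e1)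
  | Bin o e1 e2 => binop_sem o (eval s e1) (eval s e2)
  end.

Fixpoint ecost (s : store) (e : expr) : nat :=
  (dsize (eval s e) +
   match e with
   | Var _ | Const _ => 0
   | Fst e1 | Snd e1 => ecost s e1
   | Bin _ e1 e2 => ecost s e1 + ecost s e2
   end)%N.

(* [exec c s w t s']: started in store [s], the command [c] halts in store    *)
(* [s'] after time [t], having drawn exactly the coins [w]. *)
Inductive exec : cmd -> store -> seq bool -> nat -> store -> Prop :=
| exec_skip s : exec Skip s [::] 1 s
| exec_assign s x e :
    exec (Assign x e) s [::] (ecost s e).+1 (upd s x (eval s e))
| exec_flip s x b : exec (Flip x) s [:: b] 1 (upd s x (dbool b))
| exec_seq s c1 c2 w1 t1 s1 w2 t2 s2 :
    exec c1 s w1 t1 s1 -> exec c2 s1 w2 t2 s2 ->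
    exec (Seq c1 c2) s (w1 ++ w2) (t1 + t2).+1 s2
| exec_if_true s e c1 c2 w t s' :
    eval s e != Int 0 -> exec c1 s w t s' ->
    exec (If e c1 c2) s w (ecost s e + t).+1 s'
| exec_if_false s e c1 c2 w t s' :
    eval s e = Int 0 -> exec c2 s w t s' ->
    exec (If e c1 c2) s w (ecost s e + t).+1 s'
| exec_while_true s e c w1 t1 s1 w2 t2 s2 :
    eval s e != Int 0 -> exec c s w1 t1 s1 -> exec (While e c) s1 w2 t2 s2 ->
    exec (While e c) s (w1 ++ w2) (ecost s e + t1 + t2).+1 s2
| exec_while_false s e c :
    eval s e = Int 0 -> exec (While e c) s [::] (ecost s e).+1 s.

Fixpoint coin_free (c : cmd) : bool :=
  match c with
  | Skip | Assign _ _ => true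
  | Flip _ => false
  | Seq c1 c2 | If _ c1 c2 => coin_free c1 && coin_free c2
  | While _ c1 => coin_free c1
  end.

Definition init_store (d : data) : store := upd (fun=> Int 0) 0%N d.

Definition poly_bound (k x : nat) : nat := (k * x ^ k + k)%N.

(* Randomized computations: [run w t x] says that with coins [w] the          *)
(* computation halts after time [t] with result [x]. The coin words [w] of    *)
(* halting runs form a prefix-free set, so each has probability 2^-|w|.       *)

Definition expectation (R : realType) (T : choiceType)
    (run : seq bool -> nat -> T -> Prop) (f : nat -> T -> R) : \bar R :=
  esum [set o : seq bool * nat * T | run o.1.1 o.1.2 o.2]%classic
       (fun o => (2 ^- size o.1.1 * f o.1.2 o.2)%:E).

Definition halts_almost_surely (R : realType) (T : choiceType)
    (run : seq bool -> nat -> T -> Prop) : Prop :=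
  expectation run (fun _ _ => 1 : R) = 1%:E.

Definition expected_time (R : realType) (T : choiceType)
    (run : seq bool -> nat -> T -> Prop) : \bar R :=
  expectation run (fun t _ => t%:R : R).

(* A network (for Steiner forest, a graph) fixes everything but the costs; an *)
(* instance is a network together with arbitrary nonnegative costs. *)
Record nd_class : Type := NDClass {
  net : Type;
  nelem : net -> nat;
  req : net -> Type;
  sat : forall G : net, req G -> {set {set 'I_(nelem G)}};
  sat_upward : forall (G : net) (q : req G) (E1 E2 : {set 'I_(nelem G)}),
    E1 \subset E2 -> E1 \in sat q -> E2 \in sat q;
  net_code : net -> data;
  net_code_inj : injective net_code;
  req_code : forall G : net, req G -> data;
  req_code_inj : forall G : net, injective (@req_code G)
}.

Definition cost (n : nat) (c : 'I_n -> rat) (E : {set 'I_n}) : rat :=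
  \sum_(i in E) c i.

Definition nonneg_costs (n : nat) (c : 'I_n -> rat) : Prop :=
  forall i, 0 <= c i.

(* Upward closure makes this the nonemptiness of the family [sat q]. *)
Definition satisfiable (ND : nd_class) (G : net ND) (q : req G) : bool :=
  [set: 'I_(nelem G)] \in sat q.

Definition feasible (ND : nd_class) (G : net ND) (Q : seq (req G))
    (E : {set 'I_(nelem G)}) : bool :=
  all (fun q => E \in sat q) Q.

Definition opt (ND : nd_class) (G : net ND) (c : 'I_(nelem G) -> rat)
    (Q : seq (req G)) : rat :=
  cost c [arg min_(E < [set: 'I_(nelem G)] | feasible Q E) cost c E]%O.

Definition code_rat (x : rat) : data := Pair (Int (numq x)) (Int (denq x)).

Definition code_seq (s : seq data) : data := foldr Pair (Int 0) s.

Definition code_set (n : nat) (E : {set 'I_n}) : data :=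
  code_seq [seq dbool (i \in E) | i <- enum 'I_n].

Definition code_instance (ND : nd_class) (G : net ND)
    (c : 'I_(nelem G) -> rat) : data :=
  Pair (net_code G) (code_seq [seq code_rat (c i) | i <- enum 'I_(nelem G)]).

Definition code_offline (ND : nd_class) (G : net ND)
    (c : 'I_(nelem G) -> rat) (Q : seq (req G)) : data :=
  Pair (code_instance c) (code_seq [seq req_code q | q <- Q]).

(* Input in register 0, solution in register 1. *)
Definition offline_run (ND : nd_class) (P : cmd) (G : net ND)
    (c : 'I_(nelem G) -> rat) (Q : seq (req G))
    (w : seq bool) (t : nat) (E : {set 'I_(nelem G)}) : Prop :=
  exists2 s : store, exec P (init_store (code_offline c Q)) w t s
                   & s 1%N = code_set E.

Definition offline_input (ND : nd_class) (G : net ND)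
    (c : 'I_(nelem G) -> rat) (Q : seq (req G)) : Prop :=
  nonneg_costs c /\ all (@satisfiable ND G) Q.

Definition approx_solution (R : realType) (ND : nd_class) (g : R)
    (G : net ND) (c : 'I_(nelem G) -> rat) (Q : seq (req G))
    (E : {set 'I_(nelem G)}) : Prop :=
  feasible Q E /\ ratr (cost c E) <= g * ratr (opt c Q).

Definition deterministic_polytime_approx (R : realType) (ND : nd_class)
    (gamma : net ND -> R) (P : cmd) : Prop :=
  coin_free P /\
  exists k : nat, forall (G : net ND) (c : 'I_(nelem G) -> rat)
      (Q : seq (req G)), offline_input c Q ->
    exists (t : nat) (E : {set 'I_(nelem G)}),
      [/\ offline_run P c Q [::] t E,
          approx_solution (gamma G) c Q E
        & (t <= poly_bound k (dsize (code_offline c Q)))%N].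

Definition randomized_polytime_approx (R : realType) (ND : nd_class)
    (gamma : net ND -> R) (P : cmd) : Prop :=
  exists k : nat, forall (G : net ND) (c : 'I_(nelem G) -> rat)
      (Q : seq (req G)), offline_input c Q ->
    [/\ halts_almost_surely R (offline_run P c Q),
        (forall w t E, offline_run P c Q w t E ->
           approx_solution (gamma G) c Q E)
      & (expected_time R (offline_run P c Q) <=
           (poly_bound k (dsize (code_offline c Q)))%:R%:E)%E].

Record job (ND : nd_class) (G : net ND) : Type := Job {
  jreq : req G;
  release : rat;
  deadline : rat
}.

Definition schedule (n : nat) : Type := seq (rat * {set 'I_n}).

Definition schedule_cost (n : nat) (c : 'I_n -> rat) (S : schedule n) : rat :=
  \sum_(x <- S) cost c x.2.

Definition served (ND : nd_class) (G : net ND) (S : schedule (nelem G))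
    (j : job G) : bool :=
  has (fun x => (release j <= x.1 <= deadline j) && (x.2 \in sat (jreq j))) S.

Definition serves_all (ND : nd_class) (G : net ND) (J : seq (job G))
    (S : schedule (nelem G)) : bool :=
  all (served S) J.

Definition online_opt (R : realType) (ND : nd_class) (G : net ND)
    (c : 'I_(nelem G) -> rat) (J : seq (job G)) : R :=
  inf [set ratr (schedule_cost c S) | S in [set S | serves_all J S]]%classic.

Definition online_input (ND : nd_class) (G : net ND)
    (c : 'I_(nelem G) -> rat) (J : seq (job G)) : Prop :=
  [/\ nonneg_costs c,
      sorted (fun j1 j2 : job G => release j1 <= release j2) J
    & all (fun j => satisfiable (jreq j) && (release j <= deadline j)) J].

Definition code_arrival (ND : nd_class) (G : net ND) (j : job G) : data :=
  Pair (Int 1) (Pair (code_rat (release j))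
                     (Pair (req_code (jreq j)) (code_rat (deadline j)))).

Definition code_alarm (a : rat) : data := Pair (Int 2) (code_rat a).

Definition code_response (n : nat) (Es : seq {set 'I_n}) (al : option rat) :
    data :=
  Pair (code_seq [seq code_set E | E <- Es])
       (if al is Some a then code_rat a else Int 0).

Definition code_online (ND : nd_class) (G : net ND)
    (c : 'I_(nelem G) -> rat) (J : seq (job G)) : data :=
  Pair (code_instance c) (code_seq [seq code_arrival j | j <- J]).

(* An online algorithm is a program executed once per event on a persistent   *)
(* store. Register 0 initially holds the network and the costs. An event (the *)
(* arrival of a request, or the ringing of the alarm) is written to register  *)
(* 1, and the program answers in register 2 with the sets to transmit         *)
(* immediately and the time of the next alarm, if any. Setting an alarm       *)
(* cancels the previous one; one set in the past rings at once. At any time,  *)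
(* requests released at that time arrive before an alarm rings.               *)
(* [online_from A s al J w t S]: from store [s] with alarm [al] and remaining *)
(* arrivals [J], the whole remaining execution draws the coins [w], takes     *)
(* time [t], and performs the transmissions [S]. *)
Inductive online_from (ND : nd_class) (G : net ND) (A : cmd) :
    store -> option rat -> seq (job G) ->
    seq bool -> nat -> schedule (nelem G) -> Prop :=
| online_done s : online_from A s None [::] [::] 0 [::]
| online_arrival s al j J w1 t1 s1 Es al1 w2 t2 S :
    (forall a, al = Some a -> release j <= a) ->
    exec A (upd s 1%N (code_arrival j)) w1 t1 s1 ->
    s1 2%N = code_response Es al1 ->
    online_from A s1 (omap (Num.max (release j)) al1) J w2 t2 S ->
    online_from A s al (j :: J) (w1 ++ w2) (t1 + t2)
                ([seq (release j, E) | E <- Es] ++ S)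
| online_alarm s a J w1 t1 s1 Es al1 w2 t2 S :
    (forall j J', J = j :: J' -> a < release j) ->
    exec A (upd s 1%N (code_alarm a)) w1 t1 s1 ->
    s1 2%N = code_response Es al1 ->
    online_from A s1 (omap (Num.max a) al1) J w2 t2 S ->
    online_from A s (Some a) J (w1 ++ w2) (t1 + t2)
                ([seq (a, E) | E <- Es] ++ S).

Definition online_run (ND : nd_class) (A : cmd) (G : net ND)
    (c : 'I_(nelem G) -> rat) (J : seq (job G)) :
    seq bool -> nat -> schedule (nelem G) -> Prop :=
  online_from A (init_store (code_instance c)) None J.

Definition deterministic_polytime_competitive (R : realType) (ND : nd_class)
    (alpha : net ND -> R) (A : cmd) : Prop :=
  coin_free A /\
  exists k : nat, forall (G : net ND) (c : 'I_(nelem G) -> rat)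
      (J : seq (job G)), online_input c J ->
    exists (t : nat) (S : schedule (nelem G)),
      [/\ online_run A c J [::] t S,
          serves_all J S,
          ratr (schedule_cost c S) <= alpha G * online_opt R c J
        & (t <= poly_bound k (dsize (code_online c J)))%N].

Definition randomized_polytime_competitive (R : realType) (ND : nd_class)
    (alpha : net ND -> R) (A : cmd) : Prop :=
  exists k : nat, forall (G : net ND) (c : 'I_(nelem G) -> rat)
      (J : seq (job G)), online_input c J ->
    [/\ halts_almost_surely R (online_run A c J),
        (forall w t S, online_run A c J w t S -> serves_all J S),
        (expectation (online_run A c J)
           (fun _ S => ratr (schedule_cost c S) : R) <=
             (alpha G * online_opt R c J)%:E)%E
      & (expected_time R (online_run A c J) <=
           (poly_bound k (dsize (code_online c J)))%:R%:E)%E].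

(* Main.v *)
Require Import Defs.
From HB Require Import structures.
From mathcomp Require Import all_boot all_order all_algebra.
From mathcomp Require Import finmap.
From mathcomp Require Import all_classical all_reals all_analysis.
From mathcomp Require Import zify ring lra.

(** The algorithm keeps the pending requests with a level, a power of two or
    undefined.  When the deadline of a pending request [q] expires, it computes an
    approximate solution for [q] alone, and serves at the level [B] which is the
    maximum of twice the level of [q] and the rounded cost of that solution.  All
    pending requests of level at most [B] are eligible; they are added by increasing
    deadline as long as the approximate solution of the chosen ones costs at most
    [B], and those left over get level [B].  Budgets are compared with the cost of
    the computed solutions, so the algorithm does not need to know [gamma].

    Each service of level [B] is charged to a set [F] of requests with
    [B <= 4 gamma OPT(F)], all released after the previous service of level [B] and
    with deadlines before the current one: either [F] is [q] alone, or [F] is the set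
    on which an earlier service of level [B / 2] failed.  Hence the optimal schedule
    serves [F] between two consecutive services of level [B].  Dropping the elements
    cheaper than [B / (8 gamma n)] and truncating the others at [B / (8 gamma)], an
    element of cost [x] is charged [O(x log n)] in total over all the levels.

    A handler of an event is a loop around the offline program whose other parts are
    polynomial-time functions on data; expectations are bounded one call at a time. *)

Set Implicit Arguments.
Unset Strict Implicit.
Unset Printing Implicit Defensive.

Import Order.TTheory GRing.Theory Num.Theory.

Local Open Scope ring_scope.

(** * Polynomial bounds *)

(** The offline guarantee holds on every halting run, so the cost analysis is made run by run,
    against an arbitrary offline schedule; only the running time needs a genuine expectation. The
    deterministic statement is then the same program with a coin-free subroutine, whose only run
    draws no coin.

    Levels may be powers of two of either sign and their number is not bounded by a function of [n],
    so an offline element cannot simply pay its cost once per level: ignoring it at high levels and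
    truncating it at low ones leaves geometric sums at about [log n] scales.

    The 4 in [4 gamma] is the loss of rounding numerator and denominator separately; dropping the
    cheap elements costs a further factor 2, whence the threshold at [1 / (8 gamma)].

    Levels double over time, which threatens the polynomial bound on sizes. A doubling adds at most
    one bit while each service removes at least one request, so the size of a level plus that of all
    the unserved requests stays below a bound fixed in advance. *)

Definition polyb (T : nat -> nat) : Prop :=
  exists k, forall x, (T x <= poly_bound k x)%N.


Lemma expn_mono k x y : (x <= y)%N -> (x ^ k <= y ^ k)%N.
Proof. by case: k => [|k] xy //; rewrite leq_exp2r. Qed.

Lemma poly_bound_mono k x y : (x <= y)%N -> (poly_bound k x <= poly_bound k y)%N.
Proof. by move=> xy; rewrite /poly_bound leq_add2r leq_mul2l expn_mono ?orbT. Qed.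

Lemma expn_le_exp m k x : (m <= k)%N -> (x ^ m <= x ^ k + 1)%N.
Proof.
move=> mk; case: x => [|x]; first by case: m mk => [|m] _; rewrite ?(@exp0n m.+1) // expn0 addn1.
by rewrite (leq_trans (leq_pexp2l _ mk)) // leq_addr.
Qed.

Lemma polyb_monomial a m b T : (forall x, T x <= a * x ^ m + b)%N -> polyb T.
Proof.
move=> H; exists (a + b + m)%N => x; apply: leq_trans (H x) _.
rewrite /poly_bound.
have := @expn_le_exp m (a + b + m) x (leq_addl _ _).
set u := (x ^ m)%N; set v := (x ^ _)%N => h; nia.
Qed.

Lemma polyb_monomialP T : polyb T ->
  exists a m, forall x, (T x <= a * (x ^ m + 1))%N.
Proof.
by case=> k H; exists k, k => x; apply: leq_trans (H x) _; rewrite /poly_bound; lia.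
Qed.

Lemma polyb_le T1 T2 : (forall x, T1 x <= T2 x)%N -> polyb T2 -> polyb T1.
Proof. by move=> H [k Hk]; exists k => x; apply: leq_trans (H x) _. Qed.

Lemma polyb_const a : polyb (fun=> a).
Proof. by apply: (@polyb_monomial 0 0 a) => x. Qed.

Lemma polyb_id : polyb id.
Proof. by apply: (@polyb_monomial 1 1 0) => x; rewrite mul1n expn1 addn0. Qed.

Lemma polyb_pb k : polyb (poly_bound k).
Proof. by exists k. Qed.

Lemma polyb_add T1 T2 : polyb T1 -> polyb T2 -> polyb (fun x => T1 x + T2 x)%N.
Proof.
move=> /polyb_monomialP[a1 [m1 H1]] /polyb_monomialP[a2 [m2 H2]].
apply: (@polyb_monomial (a1 + a2) (m1 + m2) (2 * (a1 + a2))) => x.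
have := expn_le_exp x (leq_addr m2 m1); have := expn_le_exp x (leq_addl m1 m2).
move: (H1 x) (H2 x); set u := (x ^ m1)%N; set v := (x ^ m2)%N; set w := (x ^ _)%N.
move=> *; nia.
Qed.

Lemma polyb_mul T1 T2 : polyb T1 -> polyb T2 -> polyb (fun x => T1 x * T2 x)%N.
Proof.
move=> /polyb_monomialP[a1 [m1 H1]] /polyb_monomialP[a2 [m2 H2]].
apply: (@polyb_monomial (4 * a1 * a2) (m1 + m2) (4 * a1 * a2)) => x.
apply: leq_trans (leq_mul (H1 x) (H2 x)) _.
have h : ((x ^ m1 + 1) * (x ^ m2 + 1) <= 4 * (x ^ (m1 + m2) + 1))%N.
  rewrite expnD; case: x => [|x].
    by case: m1 {H1} => [|m1]; case: m2 {H2} => [|m2]; rewrite ?expn0 ?exp0n.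
  have : (0 < x.+1 ^ m1)%N by rewrite expn_gt0.
  have : (0 < x.+1 ^ m2)%N by rewrite expn_gt0.
  by set u := (_ ^ m1)%N; set v := (_ ^ m2)%N => *; nia.
apply: (@leq_trans (a1 * a2 * (4 * (x ^ (m1 + m2) + 1)))).
  by rewrite mulnACA leq_mul2l h orbT.
by set w := (x ^ _)%N; nia.
Qed.

Lemma polyb_exp T m : polyb T -> polyb (fun x => T x ^ m)%N.
Proof.
move=> H; elim: m => [|m IH].
  by apply: polyb_le (polyb_const 1) => x; rewrite expn0.
by apply: polyb_le (polyb_mul H IH) => x; rewrite expnS.
Qed.

Lemma polyb_comp T1 T2 : polyb T1 -> polyb T2 -> polyb (fun x => T1 (T2 x)).
Proof.
move=> [k H1] H2; apply: (@polyb_le _ (fun x => k * T2 x ^ k + k)%N) => [x|].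
  exact: H1.
by apply: polyb_add (polyb_const _); apply: polyb_mul (polyb_const _) (polyb_exp _ H2).
Qed.

Ltac solve_polyb := repeat first
  [ exact: polyb_pb | exact: polyb_id | exact: polyb_const | assumption
  | apply: polyb_add | apply: polyb_mul | apply: polyb_exp
  | (apply: (polyb_comp (T1 := poly_bound _)); first exact: polyb_pb) ].

(** * Sizes of data *)

Lemma dsize_gt0 d : (0 < dsize d)%N. Proof. by case: d. Qed.

Lemma dsize_Pair d e : dsize (Pair d e) = (dsize d + dsize e).+1. Proof. by []. Qed.

Lemma dsize_code_cons d s :
  dsize (code_seq (d :: s)) = (dsize d + dsize (code_seq s)).+1.
Proof. by []. Qed.

Lemma dsize_Int_le z b : (absz z < 2 ^ b.+1)%N -> (dsize (Int z) <= b.+1)%N.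
Proof.
move=> h /=; rewrite ltnS; case: (posnP (absz z)) => [->|z0]; first by rewrite trunc_log0.
by rewrite -ltnS -(ltn_exp2l _ _ (ltnSn 1)); apply: leq_ltn_trans h; apply: trunc_logP.
Qed.

Lemma dsize_IntP z : (absz z < 2 ^ dsize (Int z))%N.
Proof. exact: trunc_log_ltn. Qed.

Lemma dsize_dbool b : dsize (dbool b) = 1%N.
Proof. by case: b. Qed.

Lemma dsize_dint d : (dsize (Int (dint d)) <= dsize d)%N.
Proof. by case: d => // d1 d2. Qed.

Lemma dsize_dfst d : (dsize (dfst d) <= dsize d)%N.
Proof. by case: d => //= d1 d2; rewrite -addnS leq_addr. Qed.

Lemma dsize_dsnd d : (dsize (dsnd d) <= dsize d)%N.
Proof. by case: d => //= d1 d2; rewrite -addSn leq_addl. Qed.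

Lemma dsize_add x y : (dsize (Int (x + y)) <= maxn (dsize (Int x)) (dsize (Int y)) + 1)%N.
Proof.
rewrite addn1; apply: dsize_Int_le.
have h : (absz (x + y)%R <= absz x + absz y)%N by lia.
apply: leq_ltn_trans h _; rewrite expnS mul2n -addnn.
have hx := dsize_IntP x; have hy := dsize_IntP y.
have ax : (2 ^ dsize (Int x) <= 2 ^ maxn (dsize (Int x)) (dsize (Int y)))%N.
  by rewrite leq_exp2l // leq_maxl.
have ay : (2 ^ dsize (Int y) <= 2 ^ maxn (dsize (Int x)) (dsize (Int y)))%N.
  by rewrite leq_exp2l // leq_maxr.
lia.
Qed.

Lemma dsize_mul x y : (dsize (Int (x * y)) <= dsize (Int x) + dsize (Int y))%N.
Proof.
have [b eb] : exists b, (dsize (Int x) + dsize (Int y) = b.+1)%N.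
  by exists (dsize (Int x) + dsize (Int y)).-1; rewrite prednK // addn_gt0 dsize_gt0.
rewrite eb; apply: dsize_Int_le; rewrite -eb abszM expnD.
have hx := dsize_IntP x; have hy := dsize_IntP y.
by apply: leq_ltn_trans (leq_mul (leqnn _) (ltnW hy)) _; rewrite ltn_mul2r expn_gt0 /=.
Qed.

Lemma dsizeN x : dsize (Int (- x)) = dsize (Int x).
Proof. by rewrite /= abszN. Qed.

Lemma dsize_binop o d e : (dsize (binop_sem o d e) <= (dsize d + dsize e).+1)%N.
Proof.
have hd := dsize_dint d; have he := dsize_dint e.
have g1 := dsize_gt0 (Int (dint d)); have g2 := dsize_gt0 (Int (dint e)).
case: o; rewrite /binop_sem ?dsize_dbool //.
- by have := dsize_add (dint d) (dint e); lia.
- by have := dsize_add (dint d) (- dint e); rewrite dsizeN; lia.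
- by have := dsize_mul (dint d) (dint e); lia.
Qed.

(** * Execution of commands *)

(** Coins are the only source of nondeterminism, so runs whose coin words extend to a common word
    coincide. The free suffixes [u] and [u2] let the induction pass through sequencing, where the
    coins of the second command are a suffix for the first. *)
Lemma exec_prefix_free c s w t s' : exec c s w t s' ->
  forall w2 t2 s2 u u2, exec c s w2 t2 s2 -> w ++ u = w2 ++ u2 ->
  [/\ w = w2, t = t2 & s' = s2].
Proof.
elim=> {c s w t s'}.
- by move=> s w2 t2 s2 u u2 H; inversion H; subst.
- by move=> s x e w2 t2 s2 u u2 H; inversion H; subst.
- by move=> s x b w2 t2 s2 u u2 H; inversion H; subst => /= -[->].
- move=> s c1 c2 w1 t1 s1 w2 t2 s2 _ IH1 _ IH2 w3 t3 s3 u u3 H.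
  inversion H as [| | |? ? ? w1' t1' s1' w2' t2' s2' E1 E2| | | |]; subst.
  rewrite -!catA => E.
  have [e1 ? ?] := IH1 _ _ _ _ _ E1 E; subst.
  move/eqP: E; rewrite eqseq_cat // eqxx /= => /eqP E.
  by have [-> -> ->] := IH2 _ _ _ _ _ E2 E.
- move=> s e c1 c2 w t s' ne _ IH w2 t2 s2 u u2 H.
  inversion H as [| | | |? ? ? ? ? ? ? ne' E|? ? ? ? ? ? ? ee E| |]; subst.
    by move=> E'; have [-> -> ->] := IH _ _ _ _ _ E E'.
  by rewrite ee eqxx in ne.
- move=> s e c1 c2 w t s' ee _ IH w2 t2 s2 u u2 H.
  inversion H as [| | | |? ? ? ? ? ? ? ne' E|? ? ? ? ? ? ? ? E| |]; subst.
    by rewrite ee eqxx in ne'.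
  by move=> E'; have [-> -> ->] := IH _ _ _ _ _ E E'.
- move=> s e c w1 t1 s1 w2 t2 s2 ne _ IH1 _ IH2 w3 t3 s3 u u3 H.
  inversion H as [| | | | | |? ? ? w1' t1' s1' w2' t2' s2' ? E1 E2|? ? ? ee]; subst.
    rewrite -!catA => E.
    have [e1 ? ?] := IH1 _ _ _ _ _ E1 E; subst.
    move/eqP: E; rewrite eqseq_cat // eqxx /= => /eqP E.
    by have [-> -> ->] := IH2 _ _ _ _ _ E2 E.
  by rewrite ee eqxx in ne.
- move=> s e c ee w3 t3 s3 u u3 H.
  inversion H as [| | | | | |? ? ? w1' t1' s1' w2' t2' s2' ne E1 E2|]; subst => //.
  by rewrite ee eqxx in ne.
Qed.

Lemma exec_coin_free c s w t s' : exec c s w t s' -> coin_free c -> w = [::].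
Proof.
elim=> {c s w t s'} //=.
- by move=> s c1 c2 w1 t1 s1 w2 t2 s2 _ IH1 _ IH2 /andP[/IH1 -> /IH2 ->].
- by move=> s e c1 c2 w t s' _ _ IH /andP[/IH].
- by move=> s e c1 c2 w t s' _ _ IH /andP[_ /IH].
- by move=> s e c w1 t1 s1 w2 t2 s2 _ _ IH1 _ IH2 h; rewrite (IH1 h) (IH2 h).
Qed.

Fixpoint expr_below (m : nat) (e : expr) : bool :=
  match e with
  | Var x => (x < m)%N
  | Const _ => true
  | Fst e1 | Snd e1 => expr_below m e1
  | Bin _ e1 e2 => expr_below m e1 && expr_below m e2
  end.

Fixpoint cmd_below (m : nat) (c : cmd) : bool :=
  match c with
  | Skip => true
  | Assign x e => (x < m)%N && expr_below m e
  | Flip x => (x < m)%N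
  | Seq c1 c2 => cmd_below m c1 && cmd_below m c2
  | If e c1 c2 => [&& expr_below m e, cmd_below m c1 & cmd_below m c2]
  | While e c1 => expr_below m e && cmd_below m c1
  end.

Lemma expr_below_mono m n e : (m <= n)%N -> expr_below m e -> expr_below n e.
Proof.
move=> mn; elim: e => //= [x /leq_trans|o e1 IH1 e2 IH2 /andP[/IH1 -> /IH2 ->]] //.
exact.
Qed.

Lemma cmd_below_mono m n c : (m <= n)%N -> cmd_below m c -> cmd_below n c.
Proof.
move=> mn; have H := expr_below_mono mn.
elim: c => //= [x e /andP[h /H ->]|x h|c1 IH1 c2 IH2 /andP[/IH1 -> /IH2 ->]|
  e c1 IH1 c2 IH2 /and3P[/H -> /IH1 -> /IH2 ->]|e c IH /andP[/H -> /IH ->]] //.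
- by rewrite (leq_trans h).
- exact: leq_trans h _.
Qed.

Lemma expr_below_ex e : exists m, expr_below m e.
Proof.
elim: e => [x|d|e [m]|e [m]|o e1 [m1 h1] e2 [m2 h2]] /=; try by exists m.
- by exists x.+1.
- by exists 0%N.
exists (maxn m1 m2); rewrite (expr_below_mono (leq_maxl _ _) h1).
by rewrite (expr_below_mono (leq_maxr _ _) h2).
Qed.

Lemma cmd_below_ex c : exists m, cmd_below m c.
Proof.
elim: c => [|x e|x|c1 [m1 h1] c2 [m2 h2]|e c1 [m1 h1] c2 [m2 h2]|e c [m1 h1]] /=.
- by exists 0%N.
- have [m h] := expr_below_ex e; exists (maxn x.+1 m).
  by rewrite (expr_below_mono (leq_maxr _ _) h) leq_maxl.
- by exists x.+1.
- exists (maxn m1 m2); rewrite (cmd_below_mono (leq_maxl _ _) h1).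
  by rewrite (cmd_below_mono (leq_maxr _ _) h2).
- have [m h] := expr_below_ex e; exists (maxn m (maxn m1 m2)).
  rewrite (expr_below_mono (leq_maxl _ _) h).
  rewrite (cmd_below_mono _ h1) ?(cmd_below_mono _ h2) //; lia.
- have [m h] := expr_below_ex e; exists (maxn m m1).
  by rewrite (expr_below_mono (leq_maxl _ _) h) (cmd_below_mono (leq_maxr _ _) h1).
Qed.

Lemma eval_agree m e s s2 : expr_below m e -> (forall x, (x < m)%N -> s x = s2 x) ->
  Defs.eval s e = Defs.eval s2 e.
Proof.
move=> h H; elim: e h => /= [x /H|//|e IH /IH ->|e IH /IH ->|o e1 IH1 e2 IH2] //.
by case/andP=> /IH1 -> /IH2 ->.
Qed.

Lemma ecost_agree m e s s2 : expr_below m e -> (forall x, (x < m)%N -> s x = s2 x) ->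
  ecost s e = ecost s2 e.
Proof.
move=> h H; elim: e h => //=.
- by move=> x /H ->.
- by move=> e IH h; rewrite IH // (eval_agree h H).
- by move=> e IH h; rewrite IH // (eval_agree h H).
move=> o e1 IH1 e2 IH2 /andP[h1 h2].
by rewrite IH1 // IH2 // (eval_agree h1 H) (eval_agree h2 H).
Qed.

(** This allows the offline program to be called from a larger one: it expects a store that is zero
    except for its input, while the caller keeps its own data in the registers from [m] on. *)
Lemma exec_frame m c s w t s' : exec c s w t s' -> cmd_below m c ->
  forall s2, (forall x, (x < m)%N -> s x = s2 x) ->
  exists s2', [/\ exec c s2 w t s2', forall x, (x < m)%N -> s' x = s2' x
                & forall x, (m <= x)%N -> s2' x = s2 x].
Proof.
elim=> {c s w t s'} /=.
- by move=> s _ s2 H; exists s2; split=> //; constructor.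
- move=> s x e /andP[xm em] s2 H; exists (upd s2 x (Defs.eval s2 e)); split.
  + by rewrite (ecost_agree em H); constructor.
  + by move=> y ym; rewrite /upd (eval_agree em H); case: eqP => // _; apply: H.
  + by move=> y ym; rewrite /upd; case: eqP => // yx; move: ym; rewrite yx leqNgt xm.
- move=> s x b xm s2 H; exists (upd s2 x (dbool b)); split.
  + by constructor.
  + by move=> y ym; rewrite /upd; case: eqP => // _; apply: H.
  + by move=> y ym; rewrite /upd; case: eqP => // yx; move: ym; rewrite yx leqNgt xm.
- move=> s c1 c2 w1 t1 s1 w2 t2 s2 _ IH1 _ IH2 /andP[b1 b2] r H.
  have [r1 [e1 a1 f1]] := IH1 b1 _ H; have [r2 [e2 a2 f2]] := IH2 b2 _ a1.
  exists r2; split=> //; first by econstructor; eauto.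
  by move=> x xm; rewrite f2 ?f1.
- move=> s e c1 c2 w t s' ne _ IH /and3P[be b1 b2] r H.
  have [r1 [e1 a1 f1]] := IH b1 _ H; exists r1; split=> //.
  rewrite (ecost_agree be H); apply: exec_if_true => //.
  by rewrite -(eval_agree be H).
- move=> s e c1 c2 w t s' ne _ IH /and3P[be b1 b2] r H.
  have [r1 [e1 a1 f1]] := IH b2 _ H; exists r1; split=> //.
  rewrite (ecost_agree be H); apply: exec_if_false => //.
  by rewrite -(eval_agree be H).
- move=> s e c w1 t1 s1 w2 t2 s2 ne _ IH1 _ IH2 /[dup] b /andP[be b1] r H.
  have [r1 [e1 a1 f1]] := IH1 b1 _ H; have [r2 [e2 a2 f2]] := IH2 b _ a1.
  exists r2; split=> //.
    rewrite (ecost_agree be H); apply: (exec_while_true _ e1 e2).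
    by rewrite -(eval_agree be H).
  by move=> x xm; rewrite f2 ?f1.
- move=> s e c ee /andP[be b1] r H; exists r; split=> //.
  rewrite (ecost_agree be H); apply: exec_while_false.
  by rewrite -(eval_agree be H).
Qed.

(** * Polynomial-time functions on data *)

(* [c b] applies [f] to register [b], using the registers above [b] as scratch
   space and leaving those below [b] untouched. *)
Definition computes (c : nat -> cmd) (f : data -> data) (T : nat -> nat) : Prop :=
  forall b, coin_free (c b) /\ forall s, exists t s',
    [/\ exec (c b) s [::] t s', s' b = f (s b),
        forall r, (r < b)%N -> s' r = s r & (t <= T (dsize (s b)))%N].

(** The output size is part of the notion because, in a composition, the second function is timed in
    the size of what the first one returns. *)
Definition polytime (f : data -> data) : Prop :=
  exists c k, computes c f (poly_bound k) /\
              forall d, (dsize (f d) <= poly_bound k (dsize d))%N.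

Lemma polytime_intro f c T1 T2 : polyb T1 -> polyb T2 -> computes c f T1 ->
  (forall d, (dsize (f d) <= T2 (dsize d))%N) -> polytime f.
Proof.
move=> p1 p2 H1 H2; have [k Hk] := polyb_add p1 p2.
exists c, k; split=> [b|d]; last first.
  by apply: leq_trans (H2 d) (leq_trans (leq_addl _ _) (Hk _)).
have [cf H] := H1 b; split=> // s; have [t [s' [e1 e2 e3 e4]]] := H s.
exists t, s'; split=> //.
by apply: leq_trans e4 (leq_trans (leq_addr _ _) (Hk _)).
Qed.

Lemma eq_polytime f g : f =1 g -> polytime f -> polytime g.
Proof. by move=> /funext ->. Qed.

Lemma updE s x d : upd s x d x = d. Proof. by rewrite /upd eqxx. Qed.
Lemma upd_neq s x d y : y != x -> upd s x d y = s y.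
Proof. by rewrite /upd => /negbTE ->. Qed.

Lemma polytime_id : polytime id.
Proof.
apply: (@polytime_intro _ (fun=> Skip) (fun=> 1%N) id); [exact: polyb_const|exact: polyb_id| |].
- by move=> b; split=> // s; exists 1%N, s; split=> //; constructor.
- by move=> d.
Qed.

Lemma polytime_const a : polytime (fun=> a).
Proof.
apply: (@polytime_intro _ (fun b => Assign b (Const a)) (fun=> (dsize a).+1) (fun=> dsize a)) => //.
- exact: polyb_const.
- exact: polyb_const.
- move=> b; split=> // s; exists (ecost s (Const a)).+1, (upd s b a); split=> //.
  + exact: exec_assign.
  + by rewrite updE.
  + by move=> r rb; rewrite upd_neq // ltn_eqF.
  + by rewrite /= addn0.
Qed.

Lemma polytime_comp f g : polytime f -> polytime g -> polytime (fun d => g (f d)).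
Proof.
move=> [c1 [k1 [H1 S1]]] [c2 [k2 [H2 S2]]].
pose T x := (poly_bound k1 x + poly_bound k2 (poly_bound k1 x)).+1.
apply: (@polytime_intro _ (fun b => Seq (c1 b) (c2 b)) T (fun x => poly_bound k2 (poly_bound k1 x))).
- apply: polyb_le (polyb_add (polyb_const 1) (polyb_add (polyb_pb k1) (polyb_comp (polyb_pb k2) (polyb_pb k1)))) => x.
  by rewrite /T add1n.
- exact: polyb_comp (polyb_pb k2) (polyb_pb k1).
- move=> b; have [f1 h1] := H1 b; have [f2 h2] := H2 b; split=> /= [|s]; first by rewrite f1.
  have [t1 [s1 [e1 v1 r1 b1]]] := h1 s; have [t2 [s2 [e2 v2 r2 b2]]] := h2 s1.
  exists (t1 + t2).+1, s2; split.
  + by rewrite -[[::]]/([::] ++ [::]); econstructor; eauto.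
  + by rewrite v2 v1.
  + by move=> r rb; rewrite r2 ?r1.
  + rewrite ltnS leq_add //; apply: leq_trans b2 _; rewrite v1.
    exact: poly_bound_mono.
- by move=> d; apply: leq_trans (S2 _) _; apply: poly_bound_mono.
Qed.

Lemma polytime_fst f : polytime f -> polytime (fun d => dfst (f d)).
Proof.
move=> Hf; apply: (@polytime_comp f dfst) => //.
apply: (@polytime_intro _ (fun b => Assign b (Fst (Var b))) (fun x => (x + x).+1) id).
- apply: polyb_le (polyb_add (polyb_const 1) (polyb_add polyb_id polyb_id)) => x.
  by rewrite add1n.
- exact: polyb_id.
- move=> b; split=> // s; exists (ecost s (Fst (Var b))).+1, (upd s b (dfst (s b))); split=> //.
  + exact: exec_assign.
  + by rewrite updE.
  + by move=> r rb; rewrite upd_neq // ltn_eqF.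
  + by rewrite /= addn0 ltnS leq_add2r dsize_dfst.
- exact: dsize_dfst.
Qed.

Lemma polytime_snd f : polytime f -> polytime (fun d => dsnd (f d)).
Proof.
move=> Hf; apply: (@polytime_comp f dsnd) => //.
apply: (@polytime_intro _ (fun b => Assign b (Snd (Var b))) (fun x => (x + x).+1) id).
- apply: polyb_le (polyb_add (polyb_const 1) (polyb_add polyb_id polyb_id)) => x.
  by rewrite add1n.
- exact: polyb_id.
- move=> b; split=> // s; exists (ecost s (Snd (Var b))).+1, (upd s b (dsnd (s b))); split=> //.
  + exact: exec_assign.
  + by rewrite updE.
  + by move=> r rb; rewrite upd_neq // ltn_eqF.
  + by rewrite /= addn0 ltnS leq_add2r dsize_dsnd.
- exact: dsize_dsnd.
Qed.

Lemma exec_seq0 s c1 c2 t1 s1 w t2 s2 : exec c1 s [::] t1 s1 -> exec c2 s1 w t2 s2 ->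
  exec (Seq c1 c2) s w (t1 + t2).+1 s2.
Proof. by move=> e1 e2; rewrite -[w]/([::] ++ w); apply: exec_seq e1 e2. Qed.

Lemma polytime_bin o f g : polytime f -> polytime g ->
  polytime (fun d => binop_sem o (f d) (g d)).
Proof.
move=> [c1 [k1 [H1 S1]]] [c2 [k2 [H2 S2]]].
pose c b := Seq (Assign b.+1 (Var b)) (Seq (c1 b.+1) (Seq (Assign b.+2 (Var b))
   (Seq (c2 b.+2) (Assign b (Bin o (Var b.+1) (Var b.+2)))))).
pose T x := (x + poly_bound k1 x + x + poly_bound k2 x + 2 * (poly_bound k1 x + poly_bound k2 x) + 9)%N.
apply: (@polytime_intro _ c T (fun x => poly_bound k1 x + poly_bound k2 x + 1)%N).
- have p1 := polyb_pb k1; have p2 := polyb_pb k2.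
  apply: polyb_add (polyb_const _); apply: polyb_add (polyb_mul (polyb_const _) _); last exact: polyb_add.
  apply: polyb_add => //; apply: polyb_add polyb_id; apply: polyb_add => //; exact: polyb_id.
- apply: polyb_add (polyb_const _); exact: polyb_add (polyb_pb _) (polyb_pb _).
- move=> b; have [f1 h1] := H1 b.+1; have [f2 h2] := H2 b.+2; split=> [|s]; first by rewrite /= f1 f2.
  set s1 := upd s b.+1 (s b).
  have [t1 [s2 [e1 v1 r1 b1]]] := h1 s1.
  have s2b : s2 b = s b by rewrite r1 // /s1 upd_neq // ltn_eqF.
  set s3 := upd s2 b.+2 (s2 b).
  have [t2 [s4 [e2 v2 r2 b2]]] := h2 s3.
  have v41 : s4 b.+1 = f (s b).
    by rewrite r2 // /s3 upd_neq ?ltn_eqF // v1 /s1 updE.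
  have v42 : s4 b.+2 = g (s b) by rewrite v2 /s3 updE s2b.
  rewrite /s1 updE in b1; rewrite /s3 updE s2b in b2.
  eexists; exists (upd s4 b (binop_sem o (f (s b)) (g (s b)))); split.
  + apply: exec_seq0; first exact: exec_assign.
    apply: exec_seq0; first exact: e1.
    apply: exec_seq0; first exact: exec_assign.
    apply: exec_seq0; first exact: e2.
    by rewrite -v41 -v42; apply: exec_assign.
  + by rewrite updE.
  + move=> r rb; rewrite upd_neq ?ltn_eqF // r2 //; last by lia.
    rewrite /s3 upd_neq; last by rewrite ltn_eqF //; lia.
    rewrite r1; last by lia.
    by rewrite /s1 upd_neq // ltn_eqF //; lia.
  + rewrite /= v41 v42 s2b /T.
    have := dsize_binop o (f (s b)) (g (s b)).
    have := S1 (s b); have := S2 (s b); lia.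
- move=> d; apply: leq_trans (dsize_binop _ _ _) _.
  by rewrite addn1 ltnS leq_add.
Qed.

Lemma polytime_pair f g : polytime f -> polytime g ->
  polytime (fun d => Pair (f d) (g d)).
Proof. exact: (@polytime_bin OpPair). Qed.

Definition dif (c a b : data) : data := if c != Int 0 then a else b.

Lemma polytime_if p f g : polytime p -> polytime f -> polytime g ->
  polytime (fun d => dif (p d) (f d) (g d)).
Proof.
rewrite /dif.
move=> [c0 [k0 [H0 S0]]] [c1 [k1 [H1 S1]]] [c2 [k2 [H2 S2]]].
pose c b := Seq (Assign b.+1 (Var b)) (Seq (c0 b.+1) (If (Var b.+1) (c1 b) (c2 b))).
pose T x := (x + poly_bound k0 x + poly_bound k0 x + poly_bound k1 x + poly_bound k2 x + 9)%N.
apply: (@polytime_intro _ c T (fun x => poly_bound k1 x + poly_bound k2 x)%N).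
- have p0 := polyb_pb k0; have p1 := polyb_pb k1; have p2 := polyb_pb k2.
  by do 5![apply: polyb_add => //; try exact: polyb_const]; exact: polyb_id.
- exact: polyb_add (polyb_pb _) (polyb_pb _).
- move=> b; have [f0 h0] := H0 b.+1; have [f1 h1] := H1 b; have [f2 h2] := H2 b.
  split=> [|s]; first by rewrite /= f0 f1 f2.
  set s1 := upd s b.+1 (s b).
  have [t1 [s2 [e1 v1 r1 b1]]] := h0 s1.
  have s2b : s2 b = s b by rewrite r1 // /s1 upd_neq // ltn_eqF.
  rewrite /s1 updE in b1 v1.
  have fr r : (r < b)%N -> s2 r = s r.
    by move=> rb; rewrite r1 ?(ltnW rb) //; [rewrite /s1 upd_neq // ltn_eqF|]; lia.
  have sz := S0 (s b).
  have [pz|pz] := boolP (p (s b) != Int 0).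
    have [t2 [s3 [e2 v2 r2 b2]]] := h1 s2; rewrite s2b in b2 v2.
    eexists; exists s3; split; [|exact: v2| |].
    + apply: exec_seq0; first exact: exec_assign.
      apply: exec_seq0; first exact: e1.
      by apply: (exec_if_true _ _ e2); rewrite /= v1.
    + by move=> r rb; rewrite r2 // fr.
    + by rewrite /= v1 /T; lia.
  have [t2 [s3 [e2 v2 r2 b2]]] := h2 s2; rewrite s2b in b2 v2.
  eexists; exists s3; split; [|exact: v2| |].
  + apply: exec_seq0; first exact: exec_assign.
    apply: exec_seq0; first exact: e1.
    by apply: (exec_if_false _ _ e2); rewrite /= v1; apply/eqP; rewrite -[_ == _]negbK.
  + by move=> r rb; rewrite r2 // fr.
  + by rewrite /= v1 /T; lia.
- move=> d; case: ifP => _; first exact: leq_trans (S1 _) (leq_addr _ _).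
  exact: leq_trans (S2 _) (leq_addl _ _).
Qed.

(** Iterating a polynomial-time body may blow values up exponentially, hence the demand that all
    iterates stay below one polynomial in the size of the initial argument. The guard is recomputed
    into register [b.+1], since [While] tests an expression. *)
Lemma polytime_while p g (n : data -> nat) T :
    polytime p -> polytime g -> polyb T ->
    (forall d, (n d <= T (dsize d))%N) ->
    (forall d i, (i <= n d)%N -> (dsize (iter i g d) <= T (dsize d))%N) ->
    (forall d i, (i < n d)%N -> p (iter i g d) != Int 0) ->
    (forall d, p (iter (n d) g d) = Int 0) ->
  polytime (fun d => iter (n d) g d).
Proof.
move=> [c0 [k0 [H0 S0]]] [c1 [k1 [H1 S1]]] pT Hn HS Hp Hz.
pose body b := Seq (c1 b) (Seq (Assign b.+1 (Var b)) (c0 b.+1)).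
pose c b := Seq (Assign b.+1 (Var b)) (Seq (c0 b.+1) (While (Var b.+1) (body b))).
pose K S := (poly_bound k0 S + poly_bound k1 S + S + poly_bound k0 S + 9)%N.
have Kp : polyb K.
  by rewrite /K; solve_polyb.
apply: (@polytime_intro _ c (fun x => x + poly_bound k0 x + 9 + (T x + 1) * K (T x))%N T) => //.
- apply: polyb_add; last first.
    by apply: polyb_mul (polyb_comp Kp pT); apply: polyb_add (polyb_const _).
  by apply: polyb_add (polyb_const _); apply: polyb_add (polyb_pb _); exact: polyb_id.
- move=> b; have [f0 h0] := H0 b.+1; have [f1 h1] := H1 b.
  split=> [|s]; first by rewrite /= f0 f1.
  have loop m S : forall s0, s0 b.+1 = p (s0 b) ->
      (forall i, (i <= m)%N -> (dsize (iter i g (s0 b)) <= S)%N) ->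
      (forall i, (i < m)%N -> p (iter i g (s0 b)) != Int 0) ->
      p (iter m g (s0 b)) = Int 0 ->
      exists t s', [/\ exec (While (Var b.+1) (body b)) s0 [::] t s',
        s' b = iter m g (s0 b), forall r, (r < b)%N -> s' r = s0 r & (t <= m.+1 * K S)%N].
    elim: m => [|m IH] s0 e0 hS hp hz.
      eexists; exists s0; split=> [||//|]; [by apply: exec_while_false; rewrite /= e0|done|].
      have := hS 0%N isT; have := S0 (s0 b) => /= a1 a2.
      have := poly_bound_mono k0 a2; rewrite e0 /K; lia.
    have [t1 [s1 [e1 v1 r1 b1]]] := h1 s0.
    set s2 := upd s1 b.+1 (s1 b).
    have [t2 [s3 [e2 v2 r2 b2]]] := h0 s2.
    have v3 : s3 b = g (s0 b) by rewrite r2 // /s2 upd_neq ?ltn_eqF.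
    have [||||t4 [s4 [e4 v4 r4 b4]]] := IH s3.
    + by rewrite v3 v2 /s2 updE v1.
    + by move=> i im; rewrite v3 -iterSr; apply: hS.
    + by move=> i im; rewrite v3 -iterSr; apply: hp.
    + by rewrite v3 -iterSr.
    eexists; exists s4; split.
    + have eb : exec (body b) s0 [::] (t1 + ((ecost s1 (Var b)).+1 + t2).+1).+1 s3.
        by apply: exec_seq0 e1 _; apply: exec_seq0 e2; apply: exec_assign.
      rewrite -[[::]]/([::] ++ [::]); apply: (exec_while_true _ eb e4).
      by rewrite /= e0; apply: (hp 0%N).
    + by rewrite v4 v3 -iterSr.
    + move=> r rb; rewrite r4 // r2 1?ltnS ?(ltnW rb) // /s2 upd_neq ?r1 // ltn_eqF //; lia.
    + have q0 := hS 0%N isT; have q1 := hS 1%N isT; rewrite /= in q0 q1.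
      have q2 := S0 (s0 b); have q3 := poly_bound_mono k0 q0.
      have q4 := poly_bound_mono k1 q0; have q5 := poly_bound_mono k0 q1.
      rewrite /s2 updE v1 in b2; rewrite /= e0 v1 /K mulSn.
      move: b4; rewrite {1}/K; set X := (m.+1 * _)%N; rewrite /=; lia.
  set s1 := upd s b.+1 (s b).
  have [t1 [s2 [e1 v1 r1 b1]]] := h0 s1.
  have s2b : s2 b = s b by rewrite r1 // /s1 upd_neq // ltn_eqF.
  rewrite /s1 updE in b1 v1.
  have [||||t3 [s3 [e3 v3 r3 b3]]] := loop (n (s b)) (T (dsize (s b))) s2.
  + by rewrite v1 s2b.
  + by move=> i; rewrite s2b; apply: HS.
  + by move=> i; rewrite s2b; apply: Hp.
  + by rewrite s2b; apply: Hz.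
  eexists; exists s3; split.
  + apply: exec_seq0; first exact: exec_assign.
    by apply: exec_seq0; [exact: e1|exact: e3].
  + by rewrite v3 s2b.
  + by move=> r rb; rewrite r3 // r1 1?ltnS ?(ltnW rb) // /s1 upd_neq // ltn_eqF //; lia.
  + have : ((n (s b)).+1 * K (T (dsize (s b))) <= (T (dsize (s b)) + 1) * K (T (dsize (s b))))%N.
      by rewrite leq_mul2r addn1 ltnS Hn orbT.
    by rewrite /=; lia.
- by move=> d; apply: HS.
Qed.

(** * Coded lists and folds over them *)

Fixpoint dlist (d : data) : seq data :=
  if d is Pair h t then h :: dlist t else [::].

Lemma code_seqK s : dlist (code_seq s) = s.
Proof. by elim: s => //= x s ->. Qed.

Lemma dsize_code_dlist d : (dsize (code_seq (dlist d)) <= dsize d)%N.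
Proof.
by elim: d => [z|h _ t IH] //=; rewrite ltnS leq_add2l.
Qed.

Lemma dsize_code_take i s : (dsize (code_seq (take i s)) <= dsize (code_seq s))%N.
Proof. by elim: s i => [|x s IH] [|i] //=; rewrite ltnS leq_add2l. Qed.

Lemma size_dlist d : (size (dlist d) <= dsize d)%N.
Proof. by elim: d => [z|h _ t IH] //=; rewrite ltnS (leq_trans IH) // leq_addl. Qed.

(** The language has no test for the shape of a datum, but a datum equals the pair of its
    projections exactly when it is a pair. *)
Definition dispair (x : data) : data := binop_sem OpEq x (Pair (dfst x) (dsnd x)).

Lemma dispair_Pair x y : dispair (Pair x y) = Int 1.
Proof. by rewrite /dispair /binop_sem eqxx. Qed.

Lemma dispair_Int z : dispair (Int z) = Int 0.
Proof. by []. Qed.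

Create HintDb ptime.

Ltac polytime_tac :=
  lazymatch goal with
  | |- polytime (fun d => d) => exact polytime_id
  | |- polytime (fun _ => ?c) => exact (polytime_const c)
  | |- polytime (fun d => Pair (@?f d) (@?g d)) =>
      apply (@polytime_pair f g); polytime_tac
  | |- polytime (fun d => dfst (@?f d)) => apply (@polytime_fst f); polytime_tac
  | |- polytime (fun d => dsnd (@?f d)) => apply (@polytime_snd f); polytime_tac
  | |- polytime (fun d => binop_sem ?o (@?f d) (@?g d)) =>
      apply (@polytime_bin o f g); polytime_tac
  | |- polytime (fun d => dif (@?p d) (@?f d) (@?g d)) =>
      apply (@polytime_if p f g); polytime_tac
  | |- polytime (fun d => ?F (@?f d)) =>
      apply (@polytime_comp f F); [polytime_tac | solve [eauto with ptime]]
  end.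

Lemma polytime_dispair : polytime dispair.
Proof. rewrite /dispair; polytime_tac. Qed.
#[local] Hint Resolve polytime_dispair : ptime.

Definition dfold (F : data -> data) (d : data) : data :=
  foldl (fun a x => F (Pair a x)) (dfst d) (dlist (dsnd d)).

Lemma dfoldE F a s : dfold F (Pair a (code_seq s)) = foldl (fun a x => F (Pair a x)) a s.
Proof. by rewrite /dfold /= code_seqK. Qed.

(** The size hypothesis ranges over all lists, hence over all prefixes of the input, and so bounds
    every intermediate accumulator as [polytime_while] requires. *)
Lemma polytime_fold F T : polytime F -> polyb T ->
    (forall a s, (dsize (foldl (fun a x => F (Pair a x)) a s) <= T (dsize a + dsize (code_seq s)))%N) ->
  polytime (dfold F).
Proof.
move=> pF [k Tk] HT.
have {T Tk}HT a s : (dsize (foldl (fun a x => F (Pair a x)) a s) <= poly_bound k (dsize a + dsize (code_seq s)))%N.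
  exact: leq_trans (HT a s) (Tk _).
pose g d := Pair (F (Pair (dfst d) (dfst (dsnd d)))) (dsnd (dsnd d)).
pose p d := dispair (dsnd d).
pose n d := size (dlist (dsnd d)).
have iter2 i l : dlist (iter i dsnd l) = drop i (dlist l).
  by elim: i l => [|i IH] l; rewrite ?drop0 // iterSr IH; case: l => [z|h t]; rewrite ?drop0.
have iterg i a l : (i <= size (dlist l))%N ->
    iter i g (Pair a l) = Pair (foldl (fun a x => F (Pair a x)) a (take i (dlist l))) (iter i dsnd l).
  elim: i a l => [|i IH] a l il; first by rewrite take0.
  by rewrite !iterSr; case: l il => [|h t] //= il; rewrite /g /= IH.
have sz2 i l : (dsize (iter i dsnd l) <= dsize l)%N.
  by elim: i => [|i IH] //=; apply: leq_trans (dsize_dsnd _) IH.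
have W : polytime (fun d => iter (n d) g d).
  apply: (@polytime_while p g n (fun x => poly_bound k (2 * x) + x + 1)%N).
  - by rewrite /p; polytime_tac.
  - rewrite /g; apply: polytime_pair; last by polytime_tac.
    by apply: (@polytime_comp _ F) => //; polytime_tac.
  - apply: polyb_add; last exact: polyb_const.
    apply: polyb_add; last exact: polyb_id.
    apply: (polyb_comp (T1 := poly_bound k)); first exact: polyb_pb.
    by solve_polyb.
  - move=> d; have := size_dlist (dsnd d); have := dsize_dsnd d; rewrite /n; lia.
  - move=> [z|a l] i ile; first by move: ile; rewrite leqn0 => /eqP ->; rewrite -addnA addnCA leq_addr.
    rewrite iterg //.
    have h1 := HT a (take i (dlist l)).
    have h2 : (dsize a + dsize (code_seq (take i (dlist l))) <= 2 * dsize (Pair a l))%N.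
      have := dsize_code_take i (dlist l); have := dsize_code_dlist l => /=; lia.
    have h3 := poly_bound_mono k h2; have h4 := sz2 i l.
    by move: h1 h2 h3 h4 => /=; lia.
  - move=> [z|a l] i //= il; rewrite iterg ?(ltnW il) // /p /=.
    by case E: (iter i dsnd l) (iter2 i l) => [z|h t]; rewrite ?dispair_Pair //= => /esym/(congr1 size);
      rewrite size_drop => /eqP; rewrite subn_eq0 leqNgt [(_ < _)%N]il.
  - move=> [z|a l] //=; rewrite iterg // /p /=.
    by case E: (iter _ dsnd l) (iter2 (n (Pair a l)) l) => [z|h t] //=; rewrite drop_size.
(* Rebuilding the argument from its projections makes the initial loop state a pair even when the
   argument is an integer leaf. *)
apply: (@eq_polytime (fun d => dfst (iter (n (Pair (dfst d) (dsnd d))) g (Pair (dfst d) (dsnd d))))).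
  by move=> d; rewrite iterg //= /dfold /n /= take_size.
apply: polytime_fst; apply: (@polytime_comp (fun d => Pair (dfst d) (dsnd d)) _ _ W).
by polytime_tac.
Qed.

(** * The data manipulated by the online algorithm *)

(** Cross-multiplication of two coded fractions, faithful for positive denominators. *)
Definition dle (d : data) : data :=
  binop_sem OpLeq (binop_sem OpMul (dfst (dfst d)) (dsnd (dsnd d)))
                  (binop_sem OpMul (dfst (dsnd d)) (dsnd (dfst d))).

Lemma polytime_dle : polytime dle.
Proof. rewrite /dle; polytime_tac. Qed.
#[local] Hint Resolve polytime_dle : ptime.

(** A pending request is laid out as [(deadline, (level, request))]. *)
Definition dlev (x : data) : data := dfst (dsnd x).
Definition dreq (x : data) : data := dsnd (dsnd x).

Lemma polytime_dlev : polytime dlev.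
Proof. rewrite /dlev; polytime_tac. Qed.
Lemma polytime_dreq : polytime dreq.
Proof. rewrite /dreq; polytime_tac. Qed.
#[local] Hint Resolve polytime_dlev polytime_dreq : ptime.

(** Argument [(list, x)]. The list is not sorted: [x] goes first or second so that the head keeps
    the earliest deadline, which is all that the algorithm looks at. *)
Definition dins (d : data) : data :=
  dif (dispair (dfst d))
    (dif (dle (Pair (dfst (dsnd d)) (dfst (dfst (dfst d)))))
      (Pair (dsnd d) (dfst d))
      (Pair (dfst (dfst d)) (Pair (dsnd d) (dsnd (dfst d)))))
    (Pair (dsnd d) (Int 0)).

Lemma polytime_dins : polytime dins.
Proof. rewrite /dins; polytime_tac. Qed.
#[local] Hint Resolve polytime_dins : ptime.

Lemma dsize_dins a x : (dsize (dins (Pair a x)) <= dsize a + dsize x + 1)%N.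
Proof.
rewrite /dins /dif /=; case: a => [z|h t].
  by rewrite dispair_Int eqxx /= trunc_log0; lia.
by rewrite dispair_Pair /=; case: ifP => _ /=; lia.
Qed.

Lemma polytime_dinsall : polytime (dfold dins).
Proof.
apply: (@polytime_fold _ id polytime_dins polyb_id) => a s; elim: s a => [|x s IH] a /=; first by lia.
have := IH (dins (Pair a x)); have := dsize_dins a x; lia.
Qed.
#[local] Hint Resolve polytime_dinsall : ptime.

(* Argument [((B, (e, k)), x)]. *)
Definition dpartF (d : data) : data :=
  Pair (dfst (dfst d))
    (dif (dle (Pair (dlev (dsnd d)) (dfst (dfst d))))
      (Pair (dins (Pair (dfst (dsnd (dfst d)))
                        (Pair (dfst (dsnd d)) (Pair (dfst (dfst d)) (dreq (dsnd d))))))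
            (dsnd (dsnd (dfst d))))
      (Pair (dfst (dsnd (dfst d))) (dins (Pair (dsnd (dsnd (dfst d))) (dsnd d))))).

Lemma polytime_dpartF : polytime dpartF.
Proof. rewrite /dpartF; polytime_tac. Qed.

(** The increment includes the size of the budget, stored in [dfst a], because each eligible request
    receives a copy of it as its level; over the whole list the growth is at most quadratic. *)
Lemma dsize_dpartF a x : (dsize (dpartF (Pair a x)) <= dsize a + dsize x + dsize (dfst a) + 11)%N.
Proof.
rewrite /dpartF /dlev /dreq /=.
have h : (dsize (dfst a) + dsize (dfst (dsnd a)) + dsize (dsnd (dsnd a)) <= dsize a + 2)%N.
  by case: a => [z|b [z|e k]]; rewrite /= ?trunc_log0; lia.
have hx : (dsize (dfst x) + dsize (dsnd (dsnd x)) <= dsize x + 1)%N.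
  by case: x => [z|b [z|e k]]; rewrite /= ?trunc_log0; lia.
move: (dfst a) (dfst (dsnd a)) (dsnd (dsnd a)) h => B e k h; rewrite /dif.
case: ifP => _ /=.
  have := dsize_dins e (Pair (dfst x) (Pair B (dsnd (dsnd x)))) => /=; lia.
have := dsize_dins k x; lia.
Qed.

Lemma polytime_dfold_dpartF : polytime (dfold dpartF).
Proof.
apply: (@polytime_fold _ (fun x => x + x * (x + 12))%N polytime_dpartF).
  by solve_polyb.
move=> a s.
have : (dsize (foldl (fun a x => dpartF (Pair a x)) a s) <=
        dsize a + dsize (code_seq s) * (dsize (dfst a) + 12))%N.
  elim: s a => [|x s IH] a /=; first by lia.
  have := IH (dpartF (Pair a x)); have := dsize_dpartF a x => /=; nia.
have := dsize_dfst a; nia.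
Qed.
#[local] Hint Resolve polytime_dfold_dpartF : ptime.

(* Argument [((bits, (p, q)), x)]: [p/q] accumulates the costs [x] of the
   elements whose bit is set. *)
Definition dcostF (d : data) : data :=
  Pair (dsnd (dfst (dfst d)))
    (dif (dfst (dfst (dfst d)))
      (Pair (binop_sem OpAdd
              (binop_sem OpMul (dfst (dsnd (dfst d))) (dsnd (dsnd d)))
              (binop_sem OpMul (dfst (dsnd d)) (dsnd (dsnd (dfst d)))))
            (binop_sem OpMul (dsnd (dsnd (dfst d))) (dsnd (dsnd d))))
      (Pair (dfst (dsnd (dfst d))) (dsnd (dsnd (dfst d))))).

Lemma polytime_dcostF : polytime dcostF.
Proof. rewrite /dcostF; polytime_tac. Qed.

(** Fractions are added without reduction. Denominators multiply, so their sizes add up to at most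
    [dsize q] plus the size of the list, and each step may add one denominator to the size of the
    numerator: hence the product term. *)
Lemma dsize_dcost_fold b p q s :
  (dsize (foldl (fun a x => dcostF (Pair a x)) (Pair b (Pair p q)) s) <=
   dsize b + dsize p + dsize q + 2 + 4 * dsize (code_seq s) +
   size s * (dsize q + dsize (code_seq s)))%N.
Proof.
elim: s b p q => [|x s IH] b p q /=; first by lia.
have hx : (dsize (dfst x) <= dsize x)%N := dsize_dfst x.
have hy : (dsize (dsnd x) <= dsize x)%N := dsize_dsnd x.
have hb := dsize_dsnd b; rewrite [dcostF (Pair _ x)]/dcostF /dif [dfst (Pair _ x)]/=.
rewrite [dfst (Pair b _)]/= [dsnd (Pair b _)]/= [dfst (Pair p _)]/= [dsnd (Pair p _)]/= [dsnd (Pair _ x)]/=.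
case: ifP => _; apply: leq_trans (IH _ _ _) _; last by nia.
set p' := binop_sem OpAdd _ _; set q' := binop_sem OpMul _ (dsnd x).
have hp : (dsize p' <= dsize p + dsize q + 2 * dsize x + 3)%N.
  rewrite /p'; apply: leq_trans (dsize_binop _ _ _) _.
  have := dsize_binop OpMul p (dsnd x); have := dsize_binop OpMul (dfst x) q; lia.
have hq : (dsize q' <= dsize q + dsize x)%N.
  rewrite /q' /binop_sem; apply: leq_trans (dsize_mul _ _) _.
  have := dsize_dint q; have := dsize_dint (dsnd x); lia.
have : (size s * (dsize q' + dsize (code_seq s)) <=
  size s * (dsize q + (dsize x + dsize (code_seq s)).+1))%N.
  by rewrite leq_mul2l; apply/orP; right; lia.
rewrite mulSn; set X := (size s * _)%N; set Y := (size s * _)%N; lia.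
Qed.

Lemma size_le_code s : (size s <= dsize (code_seq s))%N.
Proof. by have := size_dlist (code_seq s); rewrite code_seqK. Qed.

(* Argument [(bits, costs)]. *)
Definition dcost (d : data) : data :=
  dsnd (dfold dcostF (Pair (Pair (dfst d) (Pair (Int 0) (Int 1))) (dsnd d))).

Lemma polytime_dcost : polytime dcost.
Proof.
have H : polytime (dfold dcostF).
  apply: (@polytime_fold _ (fun x => 3 * x + 5 + 4 * x + x * (x + x + 1))%N polytime_dcostF).
    by solve_polyb.
  move=> a [|x s]; first by rewrite /=; lia.
  have -> : foldl (fun a x => dcostF (Pair a x)) a (x :: s) =
    foldl (fun a x => dcostF (Pair a x)) (Pair (dfst a) (Pair (dfst (dsnd a)) (dsnd (dsnd a)))) (x :: s) by [].
  apply: leq_trans (dsize_dcost_fold _ _ _ _) _.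
  have := dsize_dfst a; have := dsize_dsnd a; have := dsize_dfst (dsnd a); have := dsize_dsnd (dsnd a).
  have := size_le_code (x :: s); set N := dsize (code_seq _); set n := size _; nia.
rewrite /dcost; apply: polytime_snd.
by apply: (@polytime_comp _ _ _ H); polytime_tac.
Qed.
#[local] Hint Resolve polytime_dcost : ptime.

(* Argument [(p, x)] with [x > 0]: double [x] until [p <= x]. *)
Definition dbl_test (d : data) : data :=
  dif (binop_sem OpLeq (Int 1) (dsnd d))
    (binop_sem OpEq (binop_sem OpLeq (dfst d) (dsnd d)) (Int 0)) (Int 0).
Definition dbl_step (d : data) : data :=
  Pair (dfst d) (binop_sem OpAdd (dsnd d) (dsnd d)).
(** A [polytime] loop must stop on every datum: [dbl_test] also stops when the second component is
    not positive, and otherwise [dsize d] doublings pass the first one, which bounds the search. *)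
Definition dbl_count (d : data) : nat :=
  find (fun i => dbl_test (iter i dbl_step d) == Int 0) (iota 0 (dsize d).+1).

Lemma dbl_iter i p x : iter i dbl_step (Pair p (Int x)) = Pair p (Int (x * 2 ^+ i)).
Proof.
elim: i => [|i IH] /=; first by rewrite expr0 mulr1.
by rewrite IH /dbl_step /= exprS mulrCA mulr_natl mulr2n.
Qed.

Lemma dbl_iter_junk d i : dfst (iter i dbl_step d) = dfst d /\ dint (dsnd (iter i dbl_step d)) = dint (dsnd d) * 2 ^+ i.
Proof.
elim: i => [|i [IH1 IH2]] /=; first by rewrite expr0 mulr1.
by rewrite IH1 IH2 exprS mulrCA mulr_natl mulr2n.
Qed.

Lemma dbl_testE d : (dbl_test d == Int 0) =
  (dint (dsnd d) <= 0) || (dint (dfst d) <= dint (dsnd d)).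
Proof.
rewrite /dbl_test /dif /binop_sem /=; case: (leP 1 (dint (dsnd d))) => h1 /=.
  have -> : (dint (dsnd d) <= 0) = false by lia.
  by case: (_ <= _).
by have -> : (dint (dsnd d) <= 0) by lia.
Qed.

Lemma dbl_has d : has (fun i => dbl_test (iter i dbl_step d) == Int 0) (iota 0 (dsize d).+1).
Proof.
apply/hasP; exists (dsize d); first by rewrite mem_iota /= add0n.
rewrite dbl_testE; have [-> ->] := dbl_iter_junk d (dsize d).
case: (leP (dint (dsnd d)) 0) => h.
  by rewrite mulr_le0_ge0 // exprn_ge0.
apply/orP; right.
have h1 : (absz (dint (dfst d)) < 2 ^ dsize d)%N.
  apply: leq_trans (dsize_IntP _) _; rewrite leq_exp2l //.
  exact: leq_trans (dsize_dint _) (dsize_dfst _).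
have h2 : (dint (dfst d) <= 2 ^+ dsize d :> int).
  apply: le_trans (_ : (absz (dint (dfst d)))%:Z <= _); first by lia.
  by rewrite -(natrX _ 2) pmulrn intz lez_nat ltnW.
by apply: le_trans h2 _; rewrite ler_peMl ?exprn_ge0 //; lia.
Qed.

Lemma polytime_dbl : polytime (fun d => iter (dbl_count d) dbl_step d).
Proof.
apply: (@polytime_while dbl_test dbl_step dbl_count (fun x => 3 * x + 5)%N).
- by rewrite /dbl_test; polytime_tac.
- by rewrite /dbl_step; polytime_tac.
- by solve_polyb.
- move=> d; rewrite /dbl_count; have := find_size (fun i => dbl_test (iter i dbl_step d) == Int 0) (iota 0 (dsize d).+1).
  by rewrite size_iota; lia.
- move=> d i; rewrite /dbl_count => hi.
  have {}hi : (i <= dsize d)%N.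
    have := dbl_has d; rewrite has_find size_iota; lia.
  have : (dsize (iter i dbl_step d) <= 2 * dsize d + i + 3)%N.
    case: i hi => [|i] hi; first by rewrite [iter _ _ _]/=; lia.
    have : (dsize (iter i.+1 dbl_step d) <= (dsize d + dsize (Int (dint (dsnd d) * 2 ^+ i.+1))).+1)%N.
      have [e1 e2] := dbl_iter_junk d i; rewrite iterS {1}/dbl_step e1 /binop_sem e2.
      have -> : dint (dsnd d) * 2 ^+ i + dint (dsnd d) * 2 ^+ i = dint (dsnd d) * 2 ^+ i.+1.
        by rewrite exprS mulrCA mulr_natl -mulr2n.
      by rewrite dsize_Pair; have := dsize_dfst d; lia.
    have := dsize_mul (dint (dsnd d)) (2 ^+ i.+1).
    have : (dsize (Int (2 ^+ i.+1)) <= i.+2)%N.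
      by apply: dsize_Int_le; rewrite -(natrX _ 2) pmulrn intz absz_nat ltn_exp2l.
    have := dsize_dint (dsnd d); have := dsize_dsnd d; lia.
  by lia.
- move=> d i hi; have := before_find 0%N hi.
  have h : (i < (dsize d).+1)%N.
    apply: leq_trans hi _; rewrite /dbl_count.
    by apply: leq_trans (find_size _ _) _; rewrite size_iota.
  by rewrite nth_iota // => ->.
- move=> d; have h := dbl_has d; have := nth_find 0%N h.
  by rewrite has_find size_iota in h; rewrite nth_iota // => /eqP.
Qed.

Definition dpow2 (p : data) : data :=
  dsnd (iter (dbl_count (Pair p (Int 1))) dbl_step (Pair p (Int 1))).

Lemma polytime_dpow2 : polytime dpow2.
Proof.
rewrite /dpow2; apply: polytime_snd.
by apply: (@polytime_comp (fun p => Pair p (Int 1)) _ _ polytime_dbl); polytime_tac.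
Qed.
#[local] Hint Resolve polytime_dpow2 : ptime.

Lemma dpow2P (p : nat) : (0 < p)%N ->
  exists i, dpow2 (Int p) = Int (2 ^ i)%N /\ (p <= 2 ^ i < 2 * p)%N.
Proof.
move=> p0; set d := Pair (Int p) (Int 1).
have tE i : (dbl_test (iter i dbl_step d) == Int 0) = (p <= 2 ^ i)%N.
  rewrite dbl_iter dbl_testE /= mul1r -(natrX _ 2) pmulrn intz !lez_nat leqNgt.
  by rewrite expn_gt0.
exists (dbl_count d); split.
  by rewrite /dpow2 -/d dbl_iter /= mul1r -(natrX _ 2) pmulrn intz.
have h := dbl_has d; have := nth_find 0%N h.
rewrite has_find size_iota in h; rewrite nth_iota // add0n tE => -> /=.
case E: (dbl_count d) => [|i]; first by rewrite expn0; lia.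
have hi : (i < dbl_count d)%N by rewrite E.
have := before_find 0%N hi; rewrite nth_iota; last by move: h; rewrite -/(dbl_count d); lia.
by rewrite add0n tE expnS => /negbT; rewrite -ltnNge ltn_mul2l.
Qed.

(** Numerator and denominator each grow by a factor in [[1, 2)]; doubling the numerator afterwards
    puts the quotient between 1 and 4 times its old value, at a power of two. *)
Definition dround (a : data) : data :=
  Pair (binop_sem OpAdd (dpow2 (dfst a)) (dpow2 (dfst a))) (dpow2 (dsnd a)).

Lemma polytime_dround : polytime dround.
Proof. rewrite /dround; polytime_tac. Qed.
#[local] Hint Resolve polytime_dround : ptime.

(* Argument [(level, rounded cost)]. *)
Definition dbudget (d : data) : data :=
  dif (dle (Pair (Pair (binop_sem OpAdd (dfst (dfst d)) (dfst (dfst d))) (dsnd (dfst d)))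
                 (dsnd d)))
    (dsnd d) (Pair (binop_sem OpAdd (dfst (dfst d)) (dfst (dfst d))) (dsnd (dfst d))).

Lemma polytime_dbudget : polytime dbudget.
Proof. rewrite /dbudget; polytime_tac. Qed.
#[local] Hint Resolve polytime_dbudget : ptime.

(** * The event handler as a state machine *)

(** Mode 0 halts the loop; mode 1 awaits the solution for the expired request alone, with all
    pending requests still in [elig]; mode 2 awaits a solution for the chosen requests [ch] and the
    head of [elig]. The sets to transmit are in [sols], the requests that are not eligible in
    [keep]. *)
Definition mkW (mode inst B ch sols elig keep : data) : data :=
  Pair mode (Pair inst (Pair (Pair B ch) (Pair sols (Pair elig keep)))).
Definition winst (W : data) : data := dfst (dsnd W).
Definition wB (W : data) : data := dfst (dfst (dsnd (dsnd W))).
Definition wch (W : data) : data := dsnd (dfst (dsnd (dsnd W))).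
Definition wsols (W : data) : data := dfst (dsnd (dsnd (dsnd W))).
Definition welig (W : data) : data := dfst (dsnd (dsnd (dsnd (dsnd W)))).
Definition wkeep (W : data) : data := dsnd (dsnd (dsnd (dsnd (dsnd W)))).

Lemma polytime_winst : polytime winst. Proof. rewrite /winst; polytime_tac. Qed.
Lemma polytime_wB : polytime wB. Proof. rewrite /wB; polytime_tac. Qed.
Lemma polytime_wch : polytime wch. Proof. rewrite /wch; polytime_tac. Qed.
Lemma polytime_wsols : polytime wsols. Proof. rewrite /wsols; polytime_tac. Qed.
Lemma polytime_welig : polytime welig. Proof. rewrite /welig; polytime_tac. Qed.
Lemma polytime_wkeep : polytime wkeep. Proof. rewrite /wkeep; polytime_tac. Qed.
#[local] Hint Resolve polytime_winst polytime_wB polytime_wch polytime_wsols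
  polytime_welig polytime_wkeep : ptime.

Definition dmode (elig : data) : data :=
  binop_sem OpAdd (dispair elig) (dispair elig).

Lemma polytime_dmode : polytime dmode.
Proof. rewrite /dmode; polytime_tac. Qed.
#[local] Hint Resolve polytime_dmode : ptime.

(* Argument [(W, (B, (elig, keep))), S]. *)
Definition dstep_first2 (d : data) : data :=
  mkW (dmode (dfst (dsnd (dsnd (dfst d))))) (winst (dfst (dfst d)))
    (dfst (dsnd (dfst d)))
    (Pair (dreq (dfst (welig (dfst (dfst d))))) (Int 0)) (Pair (dsnd d) (Int 0))
    (dfst (dsnd (dsnd (dfst d)))) (dsnd (dsnd (dsnd (dfst d)))).

Lemma polytime_dstep_first2 : polytime dstep_first2.
Proof. rewrite /dstep_first2 /mkW; polytime_tac. Qed.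
#[local] Hint Resolve polytime_dstep_first2 : ptime.

(* Argument [(B, pending)]. *)
Definition dpart (d : data) : data :=
  Pair (dfst d)
    (dsnd (dfold dpartF (Pair (Pair (dfst d) (Pair (Int 0) (Int 0))) (dsnd d)))).

Lemma polytime_dpart : polytime dpart.
Proof. rewrite /dpart; polytime_tac. Qed.
#[local] Hint Resolve polytime_dpart : ptime.

(* Argument [(W, S), a] where [a] is the cost of [S]. *)
Definition dstep_first (d : data) : data :=
  dif (binop_sem OpLeq (dfst (dsnd d)) (Int 0))
    (mkW (Int 0) (winst (dfst (dfst d))) (Int 0) (Int 0)
       (Pair (dsnd (dfst d)) (Int 0))
       (dsnd (welig (dfst (dfst d)))) (wkeep (dfst (dfst d))))
    (dstep_first2
       (Pair (Pair (dfst (dfst d))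
           (dpart (Pair (dbudget (Pair (dlev (dfst (welig (dfst (dfst d))))) (dround (dsnd d))))
                        (dsnd (welig (dfst (dfst d)))))))
         (dsnd (dfst d)))).

Lemma polytime_dstep_first : polytime dstep_first.
Proof. rewrite /dstep_first /mkW; polytime_tac. Qed.
#[local] Hint Resolve polytime_dstep_first : ptime.

(* Argument [(W, S), elig'] where [elig'] is the rest of the eligible requests. *)
Definition dstep_accept (d : data) : data :=
  mkW (dmode (dsnd d)) (winst (dfst (dfst d))) (wB (dfst (dfst d)))
    (Pair (dreq (dfst (welig (dfst (dfst d))))) (wch (dfst (dfst d))))
    (Pair (dsnd (dfst d)) (Int 0)) (dsnd d) (wkeep (dfst (dfst d))).

Lemma polytime_dstep_accept : polytime dstep_accept.
Proof. rewrite /dstep_accept /mkW; polytime_tac. Qed.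
#[local] Hint Resolve polytime_dstep_accept : ptime.

(* Argument [(W, S), a] where [a] is the cost of [S]. *)
Definition dstep_next (d : data) : data :=
  dif (dle (Pair (dsnd d) (wB (dfst (dfst d)))))
    (dstep_accept (Pair (dfst d)
       (dfold dins (Pair (Int 0) (dsnd (welig (dfst (dfst d))))))))
    (Pair (Int 0) (dsnd (dfst (dfst d)))).

Lemma polytime_dstep_next : polytime dstep_next.
Proof. rewrite /dstep_next; polytime_tac. Qed.
#[local] Hint Resolve polytime_dstep_next : ptime.

Definition dstep2 (d : data) : data :=
  dif (binop_sem OpEq (dfst (dfst (dfst d))) (Int 1)) (dstep_first d) (dstep_next d).

Lemma polytime_dstep2 : polytime dstep2.
Proof. rewrite /dstep2; polytime_tac. Qed.
#[local] Hint Resolve polytime_dstep2 : ptime.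

(* Argument [(W, S)]: [S] is the solution computed for [dquery W]. *)
Definition dstep (d : data) : data :=
  dstep2 (Pair d (dcost (Pair (dsnd d) (dsnd (winst (dfst d)))))).

Lemma polytime_dstep : polytime dstep.
Proof. rewrite /dstep; polytime_tac. Qed.

Definition dquery (W : data) : data :=
  Pair (winst W) (Pair (dreq (dfst (welig W))) (wch W)).

Lemma polytime_dquery : polytime dquery.
Proof. rewrite /dquery; polytime_tac. Qed.

(* Argument [((inst, pending), event)]. *)
Definition dinit (d : data) : data :=
  dif (binop_sem OpEq (dfst (dsnd d)) (Int 1))
    (mkW (Int 0) (dfst (dfst d)) (Int 0) (Int 0) (Int 0)
      (Pair (Pair (dsnd (dsnd (dsnd (dsnd d))))
                  (Pair (Pair (Int 0) (Int 1)) (dfst (dsnd (dsnd (dsnd d))))))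
            (Int 0))
      (dsnd (dfst d)))
    (mkW (Int 1) (dfst (dfst d)) (Int 0) (Int 0) (Int 0) (dsnd (dfst d)) (Int 0)).

Lemma polytime_dinit : polytime dinit.
Proof. rewrite /dinit /mkW; polytime_tac. Qed.

(* Argument [(W, pending)]; the alarm is the deadline of the first pending request. *)
Definition dfin2 (d : data) : data :=
  Pair (Pair (wsols (dfst d)) (dfst (dfst (dsnd d)))) (Pair (winst (dfst d)) (dsnd d)).

Lemma polytime_dfin2 : polytime dfin2.
Proof. rewrite /dfin2; polytime_tac. Qed.
#[local] Hint Resolve polytime_dfin2 : ptime.

Definition dfin (W : data) : data :=
  dfin2 (Pair W (dfold dins (Pair (wkeep W) (welig W)))).

Lemma polytime_dfin : polytime dfin.
Proof. rewrite /dfin; polytime_tac. Qed.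

HB.instance Definition _ := gen_eqMixin store.
HB.instance Definition _ := gen_choiceMixin store.

(** * Randomized runs *)

Section RandomizedRuns.
Context {R : realType}.
Local Open Scope classical_set_scope.

(** One inequality comes from finite subsums; the other is the same inequality for the inverse
    factor. *)
Lemma esumZl (T : choiceType) (D : set T) (r : R) (a : T -> \bar R) :
  (0 < r)%R -> (forall i, 0 <= a i)%E ->
  (\esum_(i in D) (r%:E * a i) = r%:E * \esum_(i in D) a i)%E.
Proof.
have le (s : R) (b : T -> \bar R) : (0 < s)%R -> (forall i, 0 <= b i)%E ->
    (\esum_(i in D) (s%:E * b i) <= s%:E * \esum_(i in D) b i)%E.
  move=> s0 b0; apply: ge_ereal_sup => _ [X XD <-].
  rewrite -ge0_mule_fsumr // lee_pmul2l ?lte_fin //.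
  by apply: esum_ge; exists X.
move=> r0 a0; apply/eqP; rewrite eq_le le //=.
have := le r^-1%R (fun i => r%:E * a i)%E.
rewrite invr_gt0 => /(_ r0) h.
rewrite -[X in (_ <= X)%E]mul1e -(divff (lt0r_neq0 r0)) EFinM -muleA lee_pmul2l ?lte_fin //.
apply: le_trans _ (h _); last by move=> i; rewrite mule_ge0 // lee_fin ltW.
rewrite le_eqVlt; apply/orP; left; apply/eqP; apply: eq_esum => i _.
by rewrite muleA -EFinM mulVf ?mul1e // lt0r_neq0.
Qed.

Definition prefix_free (T : Type) (run : seq bool -> nat -> T -> Prop) : Prop :=
  forall w t x w' t' x' u u', run w t x -> run w' t' x' -> w ++ u = w' ++ u' ->
    [/\ w = w', t = t' & x = x'].

(** In a prefix-free family the coins determine the outcome, so sums over runs become sums over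
    traces; there, computations with different types of outcomes can be compared. *)
Definition trace (T : Type) (run : seq bool -> nat -> T -> Prop) :
  set (seq bool * nat) := [set p | exists x, run p.1 p.2 x].

Definition wsum (A : set (seq bool * nat)) (f : nat -> R) : \bar R :=
  \esum_(p in A) (2 ^- size p.1 * f p.2)%:E.

Lemma expectation_trace (T : choiceType) (run : seq bool -> nat -> T -> Prop) f :
  prefix_free run -> Defs.expectation run (fun t _ => f t) = wsum (trace run) f.
Proof.
move=> pf; rewrite /Defs.expectation /wsum.
have -> : trace run = [set o.1 | o in [set o : seq bool * nat * T | run o.1.1 o.1.2 o.2]].
  apply/seteqP; split=> [[w t] [x /= rx]|_ [[[w t] x] /= rx <-]].
    by exists (w, t, x).
  by exists x.
rewrite esum_image // => -[[w t] x] [[w' t'] x']; rewrite !inE /= => r1 r2 [ew et].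
have e : w ++ [::] = w' ++ [::] by rewrite ew.
by have [-> -> ->] := pf _ _ _ _ _ _ _ _ r1 r2 e.
Qed.

(** Induction on the maximal length: the words starting with each bit, once stripped of it, have
    total weight at most 1 and enter with factor 1/2. If the empty word occurs, it is a prefix of
    all the others and hence alone. *)
Lemma kraft n (s : seq (seq bool)) : uniq s -> (forall w, w \in s -> size w <= n)%N ->
  (forall w w' u u', w \in s -> w' \in s -> w ++ u = w' ++ u' -> w = w') ->
  \sum_(w <- s) 2 ^- size w <= 1 :> R.
Proof.
elim: n s => [|n IH] s us sz pf.
  case: s us sz pf => [|w [|w' s]]; first by rewrite big_nil.
    by move=> _ _ _; rewrite big_seq1 invf_le1 ?exprn_gt0 // exprn_ege1 // ler1n.
  move=> /= /andP[+ _] sz _; rewrite inE negb_or => /andP[+ _].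
  have := sz w; have := sz w'; rewrite !inE !eqxx !orbT => /(_ isT) + /(_ isT).
  by rewrite !leqn0 !size_eq0 => /eqP -> /eqP ->.
have [nils|nils] := boolP ([::] \in s).
  have al w : w \in s -> w = [::] by move=> ws; apply: (pf w [::] [::] w) => //; rewrite cats0.
  suff -> : s = [:: [::]] by rewrite big_seq1 expr0 invr1.
  case: s us {sz pf IH} nils al => [|w s] //= /andP[ws us] _ al.
  have w0 : w = [::] by apply: al; rewrite mem_head.
  case: s us ws al => [|w' s] /= us ws al; first by rewrite w0.
  have w'0 : w' = [::] by apply: al; rewrite !inE eqxx orbT.
  by rewrite w0 w'0 mem_head in ws.
pose sub b := [seq behead w | w <- s & ohead w == Some b].
have subP b w : w \in sub b -> b :: w \in s.
  case/mapP => -[|b' w']; rewrite mem_filter => /andP[] //= /eqP[->] ? ->.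
  by [].
have sumb b : \sum_(w <- sub b) 2 ^- size w <= 1 :> R.
  apply: IH.
  - rewrite map_inj_in_uniq ?filter_uniq // => -[|b1 w1] [|b2 w2]; rewrite !mem_filter /=.
    + by [].
    + by [].
    + by move=> _.
    + by move=> /andP[/eqP[->] _] /andP[/eqP[->] _] ->.
  - by move=> w /subP/sz.
  - move=> w w' u u' /subP w1 /subP w2 e.
    by have [] : b :: w = b :: w' by apply: (pf _ _ u u') => //=; rewrite e.
have -> : \sum_(w <- s) 2 ^- size w =
   \sum_(b <- [:: true; false]) \sum_(w <- sub b) 2^-1 * 2 ^- size w :> R.
  rewrite !big_cons big_nil addr0 !big_map !big_filter.
  rewrite (bigID (fun w => ohead w == Some true)) /=; congr (_ + _).
    by apply: eq_bigr => -[|b w] //= _; rewrite exprS invfM mulrC.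
  rewrite [LHS]big_seq_cond [RHS]big_seq_cond; apply: eq_big => [[|[] w]|[|b w]] //=.
  - by rewrite (negbTE nils).
  - by rewrite (negbTE nils).
  - by move=> _; rewrite exprS invfM mulrC.
rewrite !big_cons big_nil addr0 -!mulr_sumr.
have := sumb true; have := sumb false.
set x := \sum_(w <- _) _; set y := \sum_(w <- _) _ => hx hy.
by rewrite -mulrDr mulrC ler_pdivrMr // mul1r; apply: lerD.
Qed.

Lemma wsum1_le1 (T : Type) (run : seq bool -> nat -> T -> Prop) :
  prefix_free run -> (wsum (trace run) (fun=> 1%R) <= 1)%E.
Proof.
move=> pf; apply: ge_ereal_sup => _ [X [finX XA] <-].
rewrite fsbig_finite //= sumEFin lee_fin.
pose n := \max_(p <- fset_set X) size p.1.
have inX p : p \in fset_set X -> exists x, run p.1 p.2 x.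
  by rewrite in_fset_set // inE => /XA.
under eq_bigr do rewrite mulr1.
rewrite -(big_map fst predT (fun w => 2 ^- size w)).
apply: (@kraft n).
- rewrite map_inj_in_uniq ?fset_uniq // => -[w t] [w' t'] /inX[x r] /inX[x' r'] /= e.
  have e' : w ++ [::] = w' ++ [::] by rewrite e.
  have [a b _] := pf _ _ _ _ _ _ _ _ r r' e'; by move: a b => /= -> ->.
- by move=> w /mapP[p pX ->]; rewrite /n (big_rem p) //= leq_maxl.
- move=> w w' u u' /mapP[p /inX[x r] ->] /mapP[p' /inX[x' r'] ->] e.
  by have [-> _ _] := pf _ _ _ _ _ _ _ _ r r' e.
Qed.

(* The remaining runs of [run1] would have positive probability, against
   Kraft's inequality. *)
Lemma trace_full (T1 T2 : Type) (run1 : seq bool -> nat -> T1 -> Prop)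
    (run2 : seq bool -> nat -> T2 -> Prop) :
  prefix_free run1 -> trace run2 `<=` trace run1 ->
  wsum (trace run2) (fun=> 1%R) = 1%E -> trace run1 `<=` trace run2.
Proof.
move=> pf sub m2 p p1; apply: contrapT => p2.
have := wsum1_le1 pf; rewrite /wsum (esumID (trace run2)); last first.
  by move=> i _; rewrite lee_fin mulr1 invr_ge0 exprn_ge0.
have -> : trace run1 `&` trace run2 = trace run2 by apply/setIidPr.
rewrite [X in (X + _)%E](_ : _ = 1%E); last exact: m2.
have : ((2 ^- size p.1 : R)%:E <= \esum_(i in trace run1 `&` ~` trace run2) (2 ^- size i.1 * 1 : R)%:E)%E.
  apply: esum_ge; exists [set p].
    by split; [exact: finite_set1|move=> _ ->].
  by rewrite fsbig_set1 mulr1.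
move=> h1 h2; have : (1 + (2 ^- size p.1)%:E <= 1 :> \bar R)%E.
  by apply: le_trans h2; apply: leeD2l.
by rewrite -EFinD lee_fin gerDl leNgt invr_gt0 exprn_gt0.
Qed.

(** A Hoare-style specification. The postcondition is required on every halting run, not just almost
    surely, so that it can serve as precondition of the next call. *)
Definition rspec (T : choiceType) (run : seq bool -> nat -> T -> Prop)
    (Q : T -> Prop) (B : nat) : Prop :=
  [/\ prefix_free run, halts_almost_surely R run,
      (forall w t x, run w t x -> Q x) & (expected_time R run <= B%:R%:E)%E].

Lemma rspec_weaken (T : choiceType) (run : seq bool -> nat -> T -> Prop) Q Q' B B' :
  rspec run Q B -> (forall x, Q x -> Q' x) -> (B <= B')%N -> rspec run Q' B'.
Proof.
move=> [pf m q e] QQ BB; split=> //; first by move=> w t x /q/QQ.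
by apply: le_trans e _; rewrite lee_fin ler_nat.
Qed.

Lemma rspec_transfer (T1 T2 : choiceType) (run1 : seq bool -> nat -> T1 -> Prop)
    (run2 : seq bool -> nat -> T2 -> Prop) Q1 Q2 B :
  rspec run1 Q1 B -> prefix_free run2 ->
  (forall w t x, run2 w t x -> exists2 y, run1 w t y & (Q1 y -> Q2 x)) ->
  (forall w t y, run1 w t y -> exists x, run2 w t x) ->
  rspec run2 Q2 B.
Proof.
move=> [pf m q e] pf2 h21 h12.
have tE : trace run2 = trace run1.
  apply/seteqP; split=> -[w t] /= [x r].
    by have [y ry _] := h21 _ _ _ r; exists y.
  exact: h12 r.
split=> //.
- rewrite /halts_almost_surely (expectation_trace (fun=> 1)) // tE.
  by rewrite -(expectation_trace (fun=> 1)).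
- by move=> w t x r; have [y ry] := h21 _ _ _ r; apply; apply: q ry.
- rewrite /expected_time (expectation_trace (fun t => t%:R)) // tE.
  by rewrite -(expectation_trace (fun t => t%:R)).
Qed.

(** The sequencing rule behind all the later ones: expected times add because the bound on the
    second stage is uniform over the outcomes of the first. The constant [k] is the overhead of the
    construct. *)
Lemma rspec_bind (T1 T2 T : choiceType) (run1 : seq bool -> nat -> T1 -> Prop)
    (run2 : T1 -> seq bool -> nat -> T2 -> Prop) (run : seq bool -> nat -> T -> Prop)
    k (g : T1 -> T2 -> T) Q1 Q B1 B2 :
  rspec run1 Q1 B1 ->
  (forall x, Q1 x -> rspec (run2 x) (fun y => Q (g x y)) B2) ->
  (forall w t z, run w t z <-> exists w1 t1 x w2 t2 y,
     [/\ run1 w1 t1 x, run2 x w2 t2 y & (w, t, z) = (w1 ++ w2, (t1 + t2 + k)%N, g x y)]) ->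
  rspec run Q (B1 + B2 + k).
Proof.
move=> [pf1 m1 q1 e1] H2 runE.
have pf : prefix_free run.
  move=> w t z w' t' z' u u' /runE[w1 [t1 [x [w2 [t2 [y [r1 r2 [-> -> ->]]]]]]]].
  move=> /runE[w1' [t1' [x' [w2' [t2' [y' [r1' r2' [-> -> ->]]]]]]]].
  rewrite -!catA => E.
  have [a1 a2 a3] := pf1 _ _ _ _ _ _ _ _ r1 r1' E; subst.
  move/eqP: E; rewrite eqseq_cat // eqxx /= => /eqP E.
  have [pf2 _ _ _] := H2 _ (q1 _ _ _ r1).
  by have [-> -> ->] := pf2 _ _ _ _ _ _ _ _ r2 r2' E.
pose I := [set o : seq bool * nat * T1 | run1 o.1.1 o.1.2 o.2].
pose J (o : seq bool * nat * T1) := [set o' : seq bool * nat * T2 | run2 o.2 o'.1.1 o'.1.2 o'.2].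
pose h (p : (seq bool * nat * T1) * (seq bool * nat * T2)) :=
  (p.1.1.1 ++ p.2.1.1, (p.1.1.2 + p.2.1.2 + k)%N, g p.1.2 p.2.2).
have setE : [set o : seq bool * nat * T | run o.1.1 o.1.2 o.2] = h @` (I `*`` J).
  apply/seteqP; split=> [[[w t] z] /= /runE|_ [[[[w1 t1] x] [[w2 t2] y]] /= [r1 r2] <-]].
    move=> [w1 [t1 [x [w2 [t2 [y [r1 r2 [-> -> ->]]]]]]]].
    by exists ((w1, t1, x), (w2, t2, y)).
  by apply/runE; exists w1, t1, x, w2, t2, y.
(* A concatenated coin word splits in one way only: prefix-freeness of [run1] fixes the first part,
   then that of [run2] the second. *)
have hinj : set_inj (I `*`` J) h.
  move=> [[[w1 t1] x] [[w2 t2] y]] [[[w1' t1'] x'] [[w2' t2'] y']].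
  rewrite !inE /h /= => -[r1 r2] [r1' r2'] [E _ _].
  rewrite /I /J /= in r1 r2 r1' r2'.
  have E' : w1 ++ w2 = w1' ++ w2' by [].
  have [a1 a2 a3] := pf1 _ _ _ _ _ _ _ _ r1 r1' E'; subst.
  move: E' => /eqP; rewrite eqseq_cat // => /andP[_ /eqP E2].
  have [pf2 _ _ _] := H2 _ (q1 _ _ _ r1).
  have E3 : w2 ++ [::] = w2' ++ [::] by rewrite E2.
  by have [-> -> ->] := pf2 _ _ _ _ _ _ _ _ r2 r2' E3.
have expE (f : nat -> R) : (forall n, 0 <= f n) -> Defs.expectation run (fun t _ => f t) =
    (\esum_(o in I) ((2 ^- size o.1.1)%:E *
      Defs.expectation (run2 o.2) (fun t _ => f (o.1.2 + t + k)%N)))%E.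
  move=> f0; rewrite /Defs.expectation setE esum_image //.
  rewrite -(@esum_esum _ _ _ I J (fun i j => (2 ^- size (h (i, j)).1.1 * f (h (i, j)).1.2)%:E)); last first.
    by move=> i j _ _; rewrite lee_fin mulr_ge0 // invr_ge0 exprn_ge0.
  apply: eq_esum => -[[w1 t1] x] /= r1.
  rewrite -esumZl ?invr_gt0 ?exprn_gt0 //; last first.
    by move=> i; rewrite lee_fin mulr_ge0 // invr_ge0 exprn_ge0.
  apply: eq_esum => -[[w2 t2] y] /= r2.
  by rewrite size_cat exprD invfM -EFinM mulrA.
split=> //.
- rewrite /halts_almost_surely (expE (fun=> 1)) // -[RHS]m1; apply: eq_esum => -[[w1 t1] x] /= r1.
  by have [_ -> _ _] := H2 _ (q1 _ _ _ r1); rewrite mule1 mulr1.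
- move=> w t z /runE[w1 [t1 [x [w2 [t2 [y [r1 r2 [_ _ ->]]]]]]]].
  by have [_ _ q2 _] := H2 _ (q1 _ _ _ r1); apply: q2 r2.
- rewrite /expected_time (expE (fun t => t%:R)) //.
  have -> : ((B1 + B2 + k)%:R%:E = B1%:R%:E + (B2 + k)%:R%:E :> \bar R)%E.
    by rewrite -EFinD -natrD addnA.
  apply: le_trans (_ : (\esum_(o in I) ((2 ^- size o.1.1 * o.1.2%:R)%:E +
     (B2 + k)%:R%:E * (2 ^- size o.1.1 * 1)%:E) <= _)%E).
    apply: le_esum => -[[w1 t1] x] /= r1.
    have [pf2 m2 _ e2] := H2 x (q1 _ _ _ r1).
    (* Almost sure halting of the second stage gives its runs total weight 1, so that the constant
       [t1 + k] comes out of the expectation. *)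
    have -> : Defs.expectation (run2 x) (fun t _ => (t1 + t + k)%:R : R) =
      ((t1 + k)%:R%:E * 1 + expected_time R (run2 x))%E.
      rewrite -m2 /expected_time /Defs.expectation.
      case: (posnP (t1 + k)) => [tk|tk].
        rewrite tk mul0e add0e; apply: eq_esum => i _; congr (_ * _)%:E.
        by congr (_%:R); lia.
      rewrite -esumZl ?ltr0n //.
      rewrite -esumD; last 2 first.
      - by move=> i _; rewrite mule_ge0 // lee_fin ?ler0n // mulr1 invr_ge0 exprn_ge0.
      - by move=> i _; rewrite lee_fin mulr_ge0 // invr_ge0 exprn_ge0.
      apply: eq_esum => i _; rewrite -EFinM -EFinD; congr (_%:E).
      by rewrite mulr1 [X in _ = X + _]mulrC -mulrDr -natrD; congr (_ * _%:R); lia.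
    rewrite mule1; apply: le_trans (_ : ((2 ^- size w1)%:E * ((t1 + k)%:R%:E + B2%:R%:E) <= _)%E).
      by rewrite lee_pmul2l ?lte_fin ?invr_gt0 ?exprn_gt0 // leeD2l.
    rewrite -!EFinD -!EFinM lee_fin mulr1 [X in _ <= _ + X]mulrC -mulrDr -!natrD.
    by rewrite ler_pM2l ?invr_gt0 ?exprn_gt0 // ler_nat; lia.
  rewrite esumD; last 2 first.
  - by move=> i _; rewrite lee_fin mulr_ge0 // invr_ge0 exprn_ge0.
  - by move=> i _; rewrite mule_ge0 // lee_fin ?ler0n // mulr1 invr_ge0 exprn_ge0.
  apply: leeD => //; case: (posnP (B2 + k)) => [->|tk].
    by rewrite esum1 // => i _; rewrite mul0e.
  rewrite esumZl ?ltr0n //.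
  by rewrite [X in (_ * X <= _)%E](_ : _ = 1%E) ?mule1 //; exact: m1.
Qed.

End RandomizedRuns.

(** * Charging the services to an offline schedule *)

Lemma seq_int_max (z0 : int) (s : seq int) :
  exists2 m, m \in z0 :: s & {in z0 :: s, forall z, z <= m}.
Proof.
elim: s z0 => [|z s IH] z0; first by exists z0; rewrite ?mem_head // => z; rewrite inE => /eqP ->.
have [m ms Hm] := IH z; case: (leP z0 m) => h.
  exists m; first by rewrite inE ms orbT.
  by move=> x; rewrite inE => /orP[/eqP ->|/Hm].
exists z0; first exact: mem_head.
by move=> x; rewrite inE => /orP[/eqP ->|/Hm /le_trans ->] //; exact: ltW.
Qed.

Section Charging.
Context {R : realType}.

(** The exponents other than the maximum [M] are at most [M - 1], so by induction their powers add
    at most another [2 ^ M]. *)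
Lemma sum_pow2_le (s : seq int) (m : int) : uniq s -> {in s, forall z, z <= m} ->
  \sum_(z <- s) (2 : R) ^ z <= 2 ^ (m + 1).
Proof.
have [k] := ubnP (size s); elim: k s m => // k IH [|z0 s] m sz us le_m.
  by rewrite big_nil exprz_ge0.
have [M Ms HM] := seq_int_max z0 s.
have le_M : (2 : R) ^ (M + 1) <= 2 ^ (m + 1).
  by rewrite ler_weXz2l ?ler1n // lerD2r le_m.
apply: le_trans le_M; rewrite (big_rem M Ms).
rewrite expfzDr ?pnatr_eq0 // expr1z mulr_natr mulr2n lerD2l.
rewrite -[X in _ <= 2 ^ X](subrK 1); apply: IH.
- by rewrite size_rem.
- exact: rem_uniq.
- move=> z; rewrite mem_rem_uniq // inE => /andP[zM zs].
  by have := HM z zs; lia.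
Qed.

Lemma sum_pow2_lt (s : seq int) (k c : R) : uniq s -> 0 < k -> 0 <= c ->
  \sum_(z <- s | k * 2 ^ z < c) k * 2 ^ z <= 2 * c.
Proof.
move=> us k0 c0; rewrite -big_filter.
set s' := seq.filter _ s; have us' : uniq s' by rewrite filter_uniq.
have Hs' : {in s', forall z, k * 2 ^ z < c} by move=> z; rewrite mem_filter => /andP[].
case: s' us' Hs' => [|z0 s'] us' Hs'; first by rewrite big_nil mulr_ge0.
have [M Ms HM] := seq_int_max z0 s'.
rewrite -mulr_sumr; apply: le_trans (_ : k * 2 ^ (M + 1) <= _).
  by rewrite ler_pM2l // sum_pow2_le.
rewrite expfzDr ?pnatr_eq0 // expr1z mulrA mulrC ler_pM2l //.
exact/ltW/Hs'.
Qed.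

(* Contribution of an element of cost [x] at a level with threshold [y]: tiny
   costs are ignored, large ones are truncated. *)
Definition clip (n : nat) (y x : R) : R := if y <= n%:R * x then Num.min x y else 0.

Lemma clip_ge0 n y x : 0 <= y -> 0 <= x -> 0 <= clip n y x.
Proof. by move=> y0 x0; rewrite /clip; case: ifP => // _; rewrite le_min x0 y0. Qed.

(** Take the largest scale [y / 2 ^ k] below [x]: twice it is at least [y] if [k = 0], and at least
    [x] otherwise. The form of the terms makes the later sum over levels geometric at each scale. *)
Lemma min_le_sum_scaled (K : nat) (y x : R) : 0 < y -> 0 <= x -> y < 2 ^+ K * x ->
  Num.min x y <= \sum_(k < K.+1) if y / 2 ^+ k < x then 2 * (y / 2 ^+ k) else 0.
Proof.
move=> y0 x0; have nn k : 0 <= (if y / 2 ^+ k < x then 2 * (y / 2 ^+ k) else 0).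
  by case: ifP => // _; rewrite mulr_ge0 // divr_ge0 ?exprn_ge0 // ltW.
elim: K => [|K IH] h.
  move: h; rewrite mul1r => h; rewrite big_ord_recr big_ord0 /= add0r divr1 h.
  by rewrite ge_min; apply/orP; right; lra.
rewrite big_ord_recr /=; case: (ltP y (2 ^+ K * x)) => h'.
  by apply: le_trans (IH h') _; rewrite lerDl.
apply: le_trans (_ : x <= _); first by rewrite ge_min lexx.
have -> : y / 2 ^+ K.+1 < x by rewrite ltr_pdivrMr ?exprn_gt0 // mulrC.
apply: le_trans (_ : 2 * (y / 2 ^+ K.+1) <= _); last first.
  by rewrite lerDr sumr_ge0.
have -> : 2 * (y / 2 ^+ K.+1) = y / 2 ^+ K.
  by rewrite exprS; field; rewrite lt0r_neq0 // exprn_gt0.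
by rewrite ler_pdivlMr ?exprn_gt0 // mulrC.
Qed.

(** The origin of the logarithm. A cost that is not ignored exceeds the threshold divided by
    [2 ^ K], so [K + 1] scales suffice, and at each of them distinct levels contribute a geometric
    sum of at most [4 * c]. *)
Lemma sum_clip_le (K n : nat) (s : seq int) (k c : R) : (n < 2 ^ K)%N -> uniq s ->
  0 < k -> 0 <= c -> \sum_(z <- s) clip n (k * 2 ^ z) c <= 4 * (K%:R + 1) * c.
Proof.
move=> nK us k0 c0; have p0 z : 0 < k * 2 ^ z by rewrite mulr_gt0 // exprz_gt0.
apply: le_trans (_ : \sum_(z <- s) \sum_(j < K.+1)
   (if k * 2 ^ z / 2 ^+ j < c then 2 * (k * 2 ^ z / 2 ^+ j) else 0) <= _).
  apply: ler_sum => z _; rewrite /clip; case: ifP => [h|_]; last first.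
    apply: sumr_ge0 => j _; case: ifP => // _.
    by rewrite mulr_ge0 // divr_ge0 ?exprn_ge0 // ltW.
  apply: min_le_sum_scaled => //; apply: (le_lt_trans h).
  have cpos : 0 < c.
    rewrite lt_neqAle c0 andbT; apply/eqP => ce; move: h.
    by rewrite -ce mulr0 leNgt p0.
  by rewrite ltr_pM2r // -natrX ltr_nat.
rewrite exchange_big /=.
apply: le_trans (_ : \sum_(j < K.+1) 4 * c <= _); last first.
  by rewrite sumr_const card_ord -mulr_natr -natr1; lra.
apply: ler_sum => j _; rewrite -big_mkcond /= -mulr_sumr.
have -> : 4 * c = 2 * (2 * c) by lra.
rewrite ler_pM2l //.
have kj : 0 < k / 2 ^+ j by rewrite divr_gt0 // exprn_gt0.
have := sum_pow2_lt us kj c0; rewrite (eq_bigl (fun z => k * 2 ^ z / 2 ^+ j < c)); last first.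
  by move=> z; rewrite mulrAC.
by under eq_bigr do rewrite mulrAC.
Qed.

(** * The potential of a log of services *)

Section Potential.
Context {n : nat} (c : 'I_n -> R) (O : schedule n) (k : R).
Hypotheses (c0 : forall e, 0 <= c e) (k0 : 0 < k).

Definition weight (z : int) (E : {set 'I_n}) : R := \sum_(e in E) clip n (k * 2 ^ z) (c e).

Definition levels_after (tau : rat) (L : seq (int * rat)) : seq int :=
  undup [seq l.1 | l <- L & tau <= l.2].

(** [L] lists the services as pairs of level exponent and time. An offline transmission pays for a
    level once some service of that level takes place at or after it, and only once; a charge is
    thus the increase caused by a new entry, and charges telescope. *)
Definition potential (L : seq (int * rat)) : R :=
  \sum_(x <- O) \sum_(z <- levels_after x.1 L) weight z x.2.

Lemma potential_nil : potential [::] = 0.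
Proof. by apply: big1 => x _; rewrite /levels_after big_nil. Qed.

Lemma potential_le K L : (n < 2 ^ K)%N ->
  potential L <= 4 * (K%:R + 1) * \sum_(x <- O) \sum_(e in x.2) c e.
Proof.
move=> nK; rewrite mulr_sumr; apply: ler_sum => x _.
rewrite /weight exchange_big /= mulr_sumr; apply: ler_sum => e _.
by apply: sum_clip_le => //; exact: undup_uniq.
Qed.

Lemma potential_cons z a L : potential ((z, a) :: L) = potential L +
  \sum_(x <- O | (x.1 <= a) && (z \notin levels_after x.1 L)) weight z x.2.
Proof.
rewrite /potential [X in _ + X]big_mkcond -big_split /=; apply: eq_bigr => x _.
rewrite {1}/levels_after /=; case: ifP => [_|_] /=; last by rewrite addr0.
rewrite -mem_undup -/(levels_after _ _); case: ifP => h /=; first by rewrite addr0.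
by rewrite big_cons addrC.
Qed.

(** With [y = k * 2 ^ z], an element of cost at least [y] suffices by itself. Otherwise nothing is
    truncated, and the ignored elements, each cheaper than [y / n], cost at most [y] together: half
    of the assumed total remains. *)
Lemma weight_covers z (E : {set 'I_n}) : 2 * (k * 2 ^ z) <= \sum_(e in E) c e ->
  k * 2 ^ z <= weight z E.
Proof.
have y0 : 0 < k * 2 ^ z by rewrite mulr_gt0 // exprz_gt0.
rewrite /weight; move: (k * 2 ^ z) y0 => y y0 h.
have cl e : 0 <= clip n y (c e) by rewrite clip_ge0 // ltW.
have [/existsP[e /andP[eE ye]]|/existsPn small] := boolP [exists e, (e \in E) && (y <= c e)].
  rewrite (bigD1 e) //=; apply: le_trans (_ : clip n y (c e) <= _); last first.
    by rewrite lerDl sumr_ge0.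
  rewrite /clip; case: ifP => [_|/negP[]]; first by rewrite le_min ye lexx.
  apply: le_trans ye _; rewrite ler_peMl // ler1n.
  by case: (n) e {eE} => // -[].
have tiny : \sum_(e in E | n%:R * c e < y) c e <= y.
  case: (posnP n) => [n00|n00].
    by rewrite big1 ?ltW // => e _; move: (ltn_ord e); rewrite {2}n00.
  have nR : 0 < n%:R :> R by rewrite ltr0n.
  apply: le_trans (_ : \sum_(e : 'I_n) y / n%:R <= _).
    rewrite big_mkcond; apply: ler_sum => e _; case: ifP => [/andP[_ h1]|_].
      by rewrite ler_pdivlMr // mulrC ltW.
    by rewrite divr_ge0 ?ltW.
  by rewrite sumr_const card_ord -(mulr_natr (y / n%:R)) divfK // lt0r_neq0.
have split_sum : \sum_(e in E) c e = \sum_(e in E | n%:R * c e < y) c e + \sum_(e in E) clip n y (c e).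
  rewrite (bigID (fun e => n%:R * c e < y)) /=; congr (_ + _).
  rewrite [RHS](bigID (fun e => n%:R * c e < y)) /= [X in _ = X + _]big1 ?add0r.
    apply: eq_bigr => e /andP[eE]; rewrite -leNgt => h1; rewrite /clip h1.
    by have := small e; rewrite eE /= -ltNge => /ltW/min_idPl ->.
  by move=> e /andP[_]; rewrite ltNge /clip => /negbTE ->.
lra.
Qed.

(** The offline schedule may serve a charged set of requests through several transmissions, of which
    only the union is feasible for the whole set. *)
Lemma weight_bigcup z (P : pred (rat * {set 'I_n})) :
  weight z (\bigcup_(x <- O | P x) x.2) <= \sum_(x <- O | P x) weight z x.2.
Proof.
have cl e : 0 <= clip n (k * 2 ^ z) (c e).
  by rewrite clip_ge0 // mulr_ge0 ?exprz_ge0 // ltW.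
elim: O => [|x s IH]; first by rewrite !big_nil /weight big_set0.
rewrite !big_cons; case: ifP => // _; apply: le_trans (lerD (lexx _) IH).
rewrite /weight; set A := x.2; set B := \bigcup_(_ <- _ | _) _.
rewrite big_mkcond [X in _ <= X + _]big_mkcond [X in _ <= _ + X]big_mkcond -big_split /=.
apply: ler_sum => e _; rewrite inE; case: (e \in A); case: (e \in B) => /=;
  rewrite ?addr0 ?add0r ?lerDl //.
Qed.

Lemma potential_service z a L (P := fun x : rat * {set 'I_n} => (x.1 <= a) && (z \notin levels_after x.1 L)) :
  2 * (k * 2 ^ z) <= \sum_(e in \bigcup_(x <- O | P x) x.2) c e ->
  k * 2 ^ z <= potential ((z, a) :: L) - potential L.
Proof.
move=> h; rewrite potential_cons addrAC subrr add0r.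
exact: le_trans (weight_covers h) (weight_bigcup _ _).
Qed.

End Potential.

(** Rests on [ln 2 >= 1 / 2], which is the tangent bound [1 + x <= expR x] at [x = - 1 / 2]. The
    summand 1 covers [n <= 1], where the logarithm vanishes ([ln 0] being 0). *)
Lemma trunc_log_le_ln (n : nat) : (trunc_log 2 n)%:R + 2 <= 2 * (1 + ln n%:R) :> R.
Proof.
have ln2 : 1 / 2 <= ln 2 :> R.
  have h : expR (- (1 / 2)) >= 1 / 2 :> R by have := expR_ge1Dx (- (1 / 2) : R); lra.
  rewrite -ler_expR lnK ?posrE // -[X in X <= _]invrK -expRN.
  by rewrite -[X in _ <= X]invrK lef_pV2 ?posrE ?expR_gt0 ?invr_gt0 //; move: h; rewrite mul1r.
case: (posnP n) => [->|n0]; first by rewrite trunc_log0 ln0 //; lra.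
have h : (2 ^+ trunc_log 2 n <= n%:R :> R) by rewrite -natrX ler_nat trunc_logP.
have : ln (2 ^+ trunc_log 2 n) <= ln n%:R :> R by rewrite ler_ln ?posrE ?exprn_gt0 ?ltr0n.
rewrite lnXn // -(mulr_natl (ln 2)) => h1.
have : (trunc_log 2 n)%:R * (1 / 2) <= (trunc_log 2 n)%:R * ln 2 :> R by rewrite ler_wpM2l.
lra.
Qed.

End Charging.

(** * Feasible sets and offline optima *)

Lemma feasible_sub (ND : nd_class) (G : net ND) (Q : seq (req G))
  (E1 E2 : {set 'I_(nelem G)}) : E1 \subset E2 -> feasible Q E1 -> feasible Q E2.
Proof. by move=> E12; apply: sub_all => q; apply: sat_upward E12. Qed.

Lemma opt_le (ND : nd_class) (G : net ND) (c : 'I_(nelem G) -> rat) (Q : seq (req G))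
  (E : {set 'I_(nelem G)}) : feasible Q E -> opt c Q <= cost c E.
Proof.
move=> fE; rewrite /opt; case: arg_minP => [|E0 _]; last exact.
exact: feasible_sub (finset.subsetT E) fE.
Qed.

HB.instance Definition _ (ND : nd_class) (G : net ND) := gen_eqMixin (job G).

Lemma dif_dbool b x y : dif (dbool b) x y = if b then x else y.
Proof. by case: b. Qed.

(** * Fractions *)

(** Unlike the rationals of the input these fractions are unreduced, so the program is specified
    through [fval] rather than through equality of codes. *)
Definition code_frac (f : nat * nat) : data := Pair (Int f.1) (Int f.2).
Definition fval (f : nat * nat) : rat := f.1%:R / f.2%:R.
Definition fle (f g : nat * nat) : bool := (f.1 * g.2 <= g.1 * f.2)%N.
Definition fdouble (f : nat * nat) : nat * nat := ((f.1 + f.1)%N, f.2).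

Lemma fleE f g : (0 < f.2)%N -> (0 < g.2)%N -> fle f g = (fval f <= fval g).
Proof.
move=> f0 g0; rewrite /fle /fval ler_pdivrMr ?ltr0n // mulrAC ler_pdivlMr ?ltr0n //.
by rewrite -!natrM ler_nat.
Qed.

Lemma fval_ge0 f : 0 <= fval f. Proof. by rewrite divr_ge0. Qed.

Lemma fval_double f : fval (fdouble f) = 2 * fval f.
Proof. by rewrite /fval /fdouble /= natrD; ring. Qed.

Lemma dle_frac f g : dle (Pair (code_frac f) (code_frac g)) = dbool (fle f g).
Proof. by rewrite /dle /= -!PoszM lez_nat. Qed.

Lemma dle_rat x y : dle (Pair (code_rat x) (code_rat y)) = dbool (x <= y).
Proof.
rewrite /dle /=; congr dbool.
rewrite -[x in RHS]divq_num_den -[y in RHS]divq_num_den.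
rewrite ler_pdivrMr ?ltr0z ?denq_gt0 // mulrAC ler_pdivlMr ?ltr0z ?denq_gt0 //.
by rewrite -!intrM ler_int.
Qed.

Lemma dround_frac f : (0 < f.1)%N -> (0 < f.2)%N -> exists g,
  [/\ dround (code_frac f) = code_frac g, (0 < g.2)%N,
      fval f <= fval g <= 4 * fval f & exists z : int, fval g = 2 ^ z].
Proof.
move=> p0 q0; have [i [ei /andP[i1 i2]]] := dpow2P p0; have [j [ej /andP[j1 j2]]] := dpow2P q0.
exists (2 ^ i + 2 ^ i, 2 ^ j)%N; split.
- by rewrite /dround /= ei ej /= -PoszD.
- by rewrite /= expn_gt0.
- have a1 : f.1%:R <= (2 ^ i)%:R :> rat by rewrite ler_nat.
  have a2 : (2 ^ i)%:R <= 2 * f.1%:R :> rat by rewrite -natrM ler_nat ltnW.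
  have b1 : f.2%:R <= (2 ^ j)%:R :> rat by rewrite ler_nat.
  have b2 : (2 ^ j)%:R <= 2 * f.2%:R :> rat by rewrite -natrM ler_nat ltnW.
  have c1 : 0 < (2 ^ j)%:R :> rat by rewrite ltr0n expn_gt0.
  have c2 : 0 < f.2%:R :> rat by rewrite ltr0n.
  have c0 : 0 <= f.1%:R :> rat by [].
  rewrite /fval /= natrD; apply/andP; split.
    rewrite ler_pdivrMr // mulrAC ler_pdivlMr //; nra.
  rewrite ler_pdivrMr // mulrA mulrAC ler_pdivlMr //; nra.
- exists (1 + i%:Z - j%:Z); rewrite /fval /= !natrD !natrX.
  by rewrite !expfzDr ?pnatr_eq0 // expr1z -invr_expz -!exprnP; ring.
Qed.

Definition budget (l r : nat * nat) : nat * nat :=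
  if fle (fdouble l) r then r else fdouble l.

Lemma dbudget_frac l r :
  dbudget (Pair (code_frac l) (code_frac r)) = code_frac (budget l r).
Proof.
rewrite /dbudget /budget /= -!PoszD.
rewrite -/(code_frac r) -[Pair (Int (l.1 + l.1)%N) _]/(code_frac (fdouble l)).
by rewrite dle_frac dif_dbool; case: ifP.
Qed.

(** * Pending requests *)

Section Model.
Context {ND : nd_class} {G : net ND} (c : 'I_(nelem G) -> rat).

(* A pending job with its level; level [(0, 1)] means that no service has
   considered it yet. *)
Definition pending : Type := (job G * (nat * nat))%type.
Implicit Types (x h : pending) (l t : seq pending).

Definition code_pending x : data :=
  Pair (code_rat (deadline x.1)) (Pair (code_frac x.2) (req_code (jreq x.1))).
Definition code_pend l : data := code_seq [seq code_pending x | x <- l].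

Definition ins x l : seq pending :=
  if l is h :: t then
    if deadline x.1 <= deadline h.1 then x :: l else h :: x :: t
  else [:: x].

Definition insall (a l : seq pending) : seq pending := foldl (fun a x => ins x a) a l.

(** The only order kept on pending requests. Removing the head destroys it; [insall [::] t] restores
    it. *)
Definition head_min l : Prop :=
  forall h t, l = h :: t -> {in l, forall x, deadline h.1 <= deadline x.1}.

Lemma dispair_pend l : dispair (code_pend l) = dbool (l != [::]).
Proof. by case: l => // x l; rewrite dispair_Pair. Qed.

Lemma dins_pend x l : dins (Pair (code_pend l) (code_pending x)) = code_pend (ins x l).
Proof.
rewrite /dins; case: l => [|h t] //.
rewrite [dfst (Pair (code_pend _) _)]/= dispair_pend /= dle_rat !dif_dbool.
by case: ifP.
Qed.

Lemma dinsall_pend a l :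
  dfold dins (Pair (code_pend a) (code_pend l)) = code_pend (insall a l).
Proof.
rewrite /code_pend dfoldE; elim: l a => //= x l IH a.
by rewrite -/(code_pend a) dins_pend IH.
Qed.

Lemma perm_ins x l : perm_eq (ins x l) (x :: l).
Proof.
case: l => //= h t; case: ifP => // _.
by rewrite -[[:: h, x & t]]/([:: h] ++ [:: x] ++ t) perm_catCA.
Qed.

Lemma head_min_ins x l : head_min l -> head_min (ins x l).
Proof.
case: l => [|h t] /= H; first by move=> h t [<- _] y; rewrite inE => /eqP ->.
have Hh := H h t erefl; case: ifP => xh h' t' [<- _] y.
  by rewrite inE => /orP[/eqP -> //|/Hh]; exact: le_trans.
rewrite !inE => /or3P[/eqP -> //|/eqP ->|yt].
  by rewrite ltW // ltNge xh.
by apply: Hh; rewrite inE yt orbT.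
Qed.

Lemma head_min_nil : head_min [::]. Proof. by []. Qed.

Lemma perm_ins_cat x l s : perm_eq (ins x l ++ s) (l ++ x :: s).
Proof.
apply: (@perm_trans _ ((x :: l) ++ s)); first by rewrite perm_cat2r perm_ins.
by rewrite -cat1s -catA perm_catCA.
Qed.

Lemma perm_insall a l : perm_eq (insall a l) (a ++ l).
Proof.
elim: l a => [|x l IH] a; first by rewrite cats0.
exact: perm_trans (IH _) (perm_ins_cat _ _ _).
Qed.

Lemma head_min_insall a l : head_min a -> head_min (insall a l).
Proof. by elim: l a => //= x l IH a ha; apply: IH; apply: head_min_ins. Qed.

(** Eligible requests receive level [B] at once, so those left over by the service already carry
    their new level. *)
Definition part (B : nat * nat) l : seq pending * seq pending :=
  foldl (fun p x => if fle x.2 B then (ins (x.1, B) p.1, p.2) else (p.1, ins x p.2))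
    ([::], [::]) l.

Lemma dpart_pend B l : dpart (Pair (code_frac B) (code_pend l)) =
  Pair (code_frac B) (Pair (code_pend (part B l).1) (code_pend (part B l).2)).
Proof.
rewrite /dpart [dsnd (Pair (code_frac B) _)]/= [dfst (Pair (code_frac B) _)]/= dfoldE /part.
set F := (fun p x => _ in RHS).
have H e k : foldl (fun a y => dpartF (Pair a y))
    (Pair (code_frac B) (Pair (code_pend e) (code_pend k))) [seq code_pending x | x <- l] =
  Pair (code_frac B) (Pair (code_pend (foldl F (e, k) l).1) (code_pend (foldl F (e, k) l).2)).
  elim: l e k => //= x l IH e k.
  rewrite {2}/dpartF [dfst (Pair _ (code_pending x))]/= [dsnd (Pair _ (code_pending x))]/=.
  rewrite [dlev _]/= [dfst (Pair (code_frac B) _)]/= [dsnd (Pair (code_frac B) _)]/= dle_frac dif_dbool.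
  rewrite -[Pair (dfst (code_pending x)) _]/(code_pending (x.1, B)) [dfst (Pair (code_pend e) _)]/=.
  rewrite [dsnd (Pair (code_pend e) _)]/= !dins_pend {2 4}/F /=.
  by case: ifP => _; rewrite IH.
by rewrite -[Int 0]/(code_pend [::]) H.
Qed.

Lemma partP B l :
  [/\ perm_eq (part B l).1 [seq (x.1, B) | x <- l & fle x.2 B],
      perm_eq (part B l).2 [seq x <- l | ~~ fle x.2 B],
      head_min (part B l).1 & head_min (part B l).2].
Proof.
rewrite /part; set F := (fun p x => _).
have H e k : head_min e -> head_min k ->
  [/\ perm_eq (foldl F (e, k) l).1 (e ++ [seq (x.1, B) | x <- l & fle x.2 B]),
      perm_eq (foldl F (e, k) l).2 (k ++ [seq x <- l | ~~ fle x.2 B]),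
      head_min (foldl F (e, k) l).1 & head_min (foldl F (e, k) l).2].
  elim: l e k => [|x l IH] e k he hk; first by rewrite /= !cats0.
  rewrite /= {2 4 6 8}/F /=; case: ifP => _ /=.
    have [H1 H2 H3 H4] := IH (ins (x.1, B) e) k (head_min_ins he) hk; split=> //.
    exact: perm_trans H1 (perm_ins_cat _ _ _).
  have [H1 H2 H3 H4] := IH e (ins x k) he (head_min_ins hk); split=> //.
  exact: perm_trans H2 (perm_ins_cat _ _ _).
exact: (H [::] [::] head_min_nil head_min_nil).
Qed.

(** * Costs *)

Hypothesis c0 : nonneg_costs c.

Lemma dcost_fold (E : {set 'I_(nelem G)}) (f : nat * nat) (s : seq 'I_(nelem G)) :
  (0 < f.2)%N -> exists g,
  [/\ foldl (fun a y => dcostF (Pair a y))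
        (Pair (code_seq [seq dbool (i \in E) | i <- s]) (code_frac f))
        [seq code_rat (c i) | i <- s] = Pair (Int 0) (code_frac g),
      (0 < g.2)%N & fval g = fval f + \sum_(i <- s | i \in E) c i].
Proof.
elim: s f => [|i s IH] f f0; first by exists f; rewrite big_nil addr0.
have nE : numq (c i) = `|numq (c i)|%N%:Z by rewrite gez0_abs // numq_ge0 c0.
have dE : denq (c i) = `|denq (c i)|%N%:Z by rewrite gez0_abs // denq_ge0.
pose f' := if i \in E then
   (f.1 * `|denq (c i)| + `|numq (c i)| * f.2, f.2 * `|denq (c i)|)%N else f.
have d0 : (0 < `|denq (c i)|)%N by rewrite absz_gt0 denq_neq0.
have f'0 : (0 < f'.2)%N by rewrite /f'; case: ifP => //= _; rewrite muln_gt0 f0.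
have [g [e1 g0 e2]] := IH f' f'0; exists g; split=> //.
  rewrite -e1 /=; congr (foldl _ _ _).
  rewrite {1}/dcostF [dfst (Pair _ (code_rat _))]/= [dfst (Pair _ (code_frac f))]/=.
  rewrite [dfst (Pair (dbool _) _)]/= dif_dbool; congr Pair.
  rewrite /f'; case: ifP => //= _.
  by rewrite /code_frac /= !PoszD !PoszM -nE -dE.
rewrite e2 big_cons /f'; case: ifP => // _; rewrite addrA; congr (_ + _).
have ci : c i = `|numq (c i)|%N%:R / `|denq (c i)|%N%:R.
  by rewrite -[LHS]divq_num_den {1}nE {1}dE.
rewrite [in RHS]ci /fval /= natrD !natrM.
have h1 : f.2%:R != 0 :> rat by rewrite pnatr_eq0 -lt0n.
have h2 : `|denq (c i)|%N%:R != 0 :> rat by rewrite pnatr_eq0 -lt0n.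
by field; rewrite h1 h2.
Qed.

Definition code_costs : data := code_seq [seq code_rat (c i) | i <- enum 'I_(nelem G)].

Lemma dcost_set (E : {set 'I_(nelem G)}) : exists f,
  [/\ dcost (Pair (code_set E) code_costs) = code_frac f, (0 < f.2)%N & fval f = cost c E].
Proof.
have [f [e1 f0 e2]] := dcost_fold E (f := (0, 1)%N) (enum 'I_(nelem G)) isT.
exists f; split=> //.
  by rewrite /dcost dfoldE -[Pair (Int 0) (Int 1)]/(code_frac (0, 1)%N) e1.
by rewrite e2 /fval mul0r add0r /cost big_enum_cond; apply: eq_bigl => i.
Qed.

(** * The steps of the event handler *)

Definition code_jobs (s : seq (job G)) : data := code_seq [seq req_code (jreq j) | j <- s].
Definition code_sets (s : seq {set 'I_(nelem G)}) : data := code_seq [seq code_set E | E <- s].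

Definition codeW (mode : nat) (B : data) (ch : seq (job G))
    (sols : seq {set 'I_(nelem G)}) (elig keep : seq pending) : data :=
  mkW (Int mode) (code_instance c) B (code_jobs ch) (code_sets sols)
      (code_pend elig) (code_pend keep).

Definition mode_of (elig : seq pending) : nat := if elig is [::] then 0 else 2.

Lemma dmode_pend l : dmode (code_pend l) = Int (mode_of l).
Proof. by rewrite /dmode dispair_pend; case: l. Qed.

Lemma dquery_code mode B ch sols h t keep :
  dquery (codeW mode B ch sols (h :: t) keep) = code_offline c [seq jreq j | j <- h.1 :: ch].
Proof.
rewrite /dquery /code_offline /code_jobs /= /code_jobs; congr (Pair _ (Pair _ _)).
by rewrite -map_comp.
Qed.

Lemma dinit_arrival l j :
  dinit (Pair (Pair (code_instance c) (code_pend l)) (code_arrival j)) =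
  codeW 0 (Int 0) [::] [::] [:: (j, (0, 1)%N)] l.
Proof. by []. Qed.

Lemma dfin_code mode B ch sols elig keep :
  dfin (codeW mode B ch sols elig keep) =
  Pair (code_response sols (omap (fun x => deadline x.1) (ohead (insall keep elig))))
       (Pair (code_instance c) (code_pend (insall keep elig))).
Proof.
rewrite /dfin [wkeep _]/= [welig _]/= dinsall_pend /dfin2 /=.
by congr (Pair (Pair _ _) _); case: (insall keep elig).
Qed.

(** A zero cost is set apart because no power of two is within a constant factor of it: the solution
    is transmitted for free and no level is involved. *)
Lemma dstep_first_code E B0 ch sols h t keep :
  let d := Pair (codeW 1 B0 ch sols (h :: t) keep) (code_set E) in
  (cost c E = 0 /\ dstep d = codeW 0 (Int 0) [::] [:: E] t keep) \/
  exists g, let B := budget h.2 g in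
    [/\ (0 < g.2)%N /\ code_frac g = dround (dcost (Pair (code_set E) code_costs)),
        exists z : int, fval g = 2 ^ z, 0 < cost c E,
        cost c E <= fval g <= 4 * cost c E &
        dstep d = codeW (mode_of (part B t).1) (code_frac B) [:: h.1] [:: E]
                        (part B t).1 (part B t).2].
Proof.
move=> d; have [f [e1 f0 e2]] := dcost_set E.
have -> : dstep d = dstep_first (Pair d (code_frac f)) by rewrite /dstep /d -e1.
rewrite /dstep_first [dfst (dsnd (Pair d _))]/= -[binop_sem _ _ _]/(dbool (f.1%:Z <= 0)) dif_dbool.
case: (posnP f.1) => f10.
  by left; rewrite f10 lexx -e2 /fval f10 mul0r.
right; have [g [e3 g0 e4 ez]] := dround_frac f10 f0; exists g; split=> //.
- by rewrite e1.
- by rewrite -e2 /fval divr_gt0 // ltr0n.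
- by rewrite -e2.
have -> : (f.1%:Z <= 0) = false by rewrite lez_nat leqNgt f10.
rewrite [dsnd (Pair d _)]/= e3 [dlev _]/= dbudget_frac [dsnd (welig _)]/= dpart_pend.
by rewrite /dstep_first2 [dfst (dsnd (dsnd _))]/= dmode_pend.
Qed.

Lemma dstep_next_code E B ch sols h t keep : (0 < B.2)%N ->
  dstep (Pair (codeW 2 (code_frac B) ch sols (h :: t) keep) (code_set E)) =
  if cost c E <= fval B then
    codeW (mode_of (insall [::] t)) (code_frac B) (h.1 :: ch) [:: E] (insall [::] t) keep
  else codeW 0 (code_frac B) ch sols (h :: t) keep.
Proof.
move=> B0; set d := Pair _ _; have [f [e1 f0 e2]] := dcost_set E.
have -> : dstep d = dstep_next (Pair d (code_frac f)) by rewrite /dstep /d -e1.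
rewrite /dstep_next [wB _]/= [dsnd (Pair d _)]/= dle_frac dif_dbool fleE // e2.
case: ifP => // _; rewrite [dsnd (welig _)]/= -[Int 0]/(code_pend [::]) dinsall_pend.
by rewrite /dstep_accept [dsnd (Pair _ (code_pend _))]/= dmode_pend.
Qed.

End Model.

(** * Invariants of the online algorithm *)

Section Invariants.
Context {R : realType} {ND : nd_class} {G : net ND} (c : 'I_(nelem G) -> rat).
Context (O : schedule (nelem G)) (g : R).
Hypothesis c0 : nonneg_costs c.
Implicit Types (x h q : @pending ND G) (pend elig keep t : seq (@pending ND G)).
Implicit Types (j f : job G) (ch F : seq (job G)) (L : seq (int * rat)).

Local Notation costs := (fun e => ratr (c e) : R).
Local Notation pot := (potential costs O (8 * g)^-1).

Definition good j : bool :=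
  [&& served O j, satisfiable (jreq j) & release j <= deadline j].

Lemma cost_ge0 E : 0 <= cost c E.
Proof. by apply: sumr_ge0 => e _. Qed.

Lemma opt_ge0 (Q : seq (req G)) : 0 <= opt c Q.
Proof. exact: cost_ge0. Qed.

Lemma ratr_cost E : ratr (cost c E) = \sum_(e in E) costs e :> R.
Proof. by rewrite /cost rmorph_sum. Qed.

Lemma pow2_gt0 (z : int) : 0 < (2 : rat) ^ z. Proof. by rewrite exprz_gt0. Qed.

Lemma ratr_pow2 (z : int) : ratr (2 ^ z) = (2 : R) ^ z.
Proof. by rewrite fmorphXz /= rmorph_nat. Qed.

(* The last hypothesis but one puts the releases of [F] after the previous service
   of level [z], so that [O] serves [F] between that service and time [a]. *)
Lemma service_charge L z a F :
  all good F -> {in F, forall f, deadline f <= a} ->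
  {in F, forall f, {in L, forall l, l.1 = z -> l.2 < release f}} ->
  ratr (2 ^ z) <= 4 * g * ratr (opt c [seq jreq f | f <- F]) ->
  0 < g /\ ratr (2 ^ z) <= 8 * g * (pot ((z, a) :: L) - pot L).
Proof.
move=> gF dF LF hz.
have o0 : 0 <= ratr (opt c [seq jreq f | f <- F]) :> R by rewrite ler0q opt_ge0.
have z0 : 0 < (2 : R) ^ z by rewrite exprz_gt0.
have g0 : 0 < g.
  rewrite ltNge; apply/negP => gle; move: hz; rewrite ratr_pow2 leNgt => /negP; apply.
  by apply: le_lt_trans z0; rewrite mulr_le0_ge0 // mulr_ge0_le0.
split=> //.
pose P (x : rat * {set 'I_(nelem G)}) := (x.1 <= a) && (z \notin levels_after x.1 L).
pose E := (\bigcup_(x <- O | P x) x.2)%SET.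
have fE : feasible [seq jreq f | f <- F] E.
  rewrite /feasible all_map; apply/allP => f fF.
  have /and3P[/hasP[x xO /andP[/andP[rx xd] xs]] _ _] := allP gF f fF.
  apply: sat_upward xs; rewrite /E (big_rem x xO) ifT; first exact: finset.subsetUl.
  rewrite /P (le_trans xd) ?dF // /levels_after mem_undup; apply/negP => /mapP[l].
  rewrite mem_filter => /andP[xl lL] zl.
  by have := LF f fF l lL (esym zl); rewrite ltNge (le_trans rx xl).
have k0 : 0 < (8 * g)^-1 by rewrite invr_gt0 mulr_gt0.
have cR e : 0 <= costs e by rewrite ler0q c0.
have := potential_service cR k0 (O := O) (z := z) (a := a) (L := L).
rewrite -/P -/E => /(_ _) H.
rewrite ratr_pow2 in hz *.
have {}H : (8 * g)^-1 * 2 ^ z <= pot ((z, a) :: L) - pot L.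
  apply: H; rewrite -ratr_cost.
  apply: le_trans (_ : ratr (opt c [seq jreq f | f <- F]) <= _); last by rewrite ler_rat opt_le.
  (* The factor 8 is the 4 of the hypothesis on [F] times the 2 lost in [weight_covers]. *)
  have -> : 2 * ((8 * g)^-1 * 2 ^ z) = 2 ^ z / (4 * g) by field; rewrite lt0r_neq0.
  by rewrite ler_pdivrMr ?mulr_gt0 // mulrC.
apply: le_trans (_ : 8 * g * ((8 * g)^-1 * 2 ^ z) <= _).
  by rewrite mulrA divff ?mul1r // lt0r_neq0 // mulr_gt0.
by rewrite ler_pM2l // mulr_gt0.
Qed.

(** A service of a level above that of [x] would have found [x] eligible, and either served it or
    raised it to its own level. *)
Definition unseen L x : Prop := {in L, forall l, fval x.2 < 2 ^ l.1 -> l.2 < release x.1}.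

(* A request at level [2 ^ z] carries the jobs which made a service fail. *)
Definition witnessed L x : Prop := forall z : int, fval x.2 = 2 ^ z -> exists F,
  [/\ all good F, {in F, forall f, deadline f <= deadline x.1},
      {in F, forall f, {in L, forall l, l.1 = z + 1 -> l.2 < release f}} &
      ratr (2 ^ z) <= g * ratr (opt c [seq jreq f | f <- F])].

Definition pending_inv L x : Prop :=
  [/\ good x.1, (0 < x.2.2)%N, x.2.1 = 0%N \/ exists z : int, fval x.2 = 2 ^ z,
      unseen L x & witnessed L x].

(** The successor counts the list cell, so that [jsize s + 1] is the size of the coded list of
    arrivals. It also serves as a termination measure. *)
Definition jsize (s : seq (job G)) : nat := (\sum_(j <- s) (dsize (code_arrival j)).+1)%N.
Definition psize (l : seq (@pending ND G)) : nat := jsize [seq x.1 | x <- l].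

Definition level_size (f : nat * nat) : nat := dsize (code_frac f).

Lemma perm_jsize s s' : perm_eq s s' -> jsize s = jsize s'.
Proof. by move=> h; apply: perm_big. Qed.

Lemma perm_psize s s' : perm_eq s s' -> psize s = psize s'.
Proof. by move=> h; apply/perm_jsize/perm_map. Qed.

Lemma jsize_cons j s : jsize (j :: s) = ((dsize (code_arrival j)).+1 + jsize s)%N.
Proof. by rewrite /jsize big_cons. Qed.

Lemma psize_cat s s' : psize (s ++ s') = (psize s + psize s')%N.
Proof. by rewrite /psize map_cat /jsize big_cat. Qed.

Lemma psize_cons x s : psize (x :: s) = ((dsize (code_arrival x.1)).+1 + psize s)%N.
Proof. exact: jsize_cons. Qed.

Lemma psize_part B l : (psize (part B l).1 + psize (part B l).2 = psize l)%N.
Proof.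
have [H1 H2 _ _] := partP B l; rewrite (perm_psize H1) (perm_psize H2).
elim: l {H1 H2} => [|x l IH] /=; first by rewrite /psize /jsize big_nil.
rewrite [RHS]psize_cons -IH.
by case: ifP => _; rewrite /= psize_cons /=; lia.
Qed.

(** * A single service *)

Section Service.
(* [jr] is the size of the jobs still to arrive. *)
Context (pend : seq (@pending ND G)) (a : rat) (L : seq (int * rat)) (jr M : nat).

(** [E] is the last accepted solution, for the chosen jobs [ch], and the current service is already
    logged as [(z, a)]. The conditions on higher levels in [li_ch] and [li_elig] and the order of
    deadlines in [li_dl] prepare for failure: they make the chosen jobs a witness for a later
    service of level [z + 1]. In the size fields, [M] bounds a level together with all jobs not yet
    served. *)
Record loop_inv (z : int) (B : nat * nat) ch (E : {set 'I_(nelem G)}) elig keep : Prop := LoopInv {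
  li_lvl : fval B = 2 ^ z;
  li_den : (0 < B.2)%N;
  li_feas : feasible [seq jreq j | j <- ch] E;
  li_cost : cost c E <= fval B;
  li_ch : {in ch, forall j, [/\ good j, release j <= a <= deadline j &
             {in (z, a) :: L, forall l, z < l.1 -> l.2 < release j}]};
  li_elig : {in elig, forall x, [/\ x.2 = B, good x.1, release x.1 <= a <= deadline x.1 &
             {in (z, a) :: L, forall l, z < l.1 -> l.2 < release x.1}]};
  li_dl : {in ch & elig, forall j x, deadline j <= deadline x.1};
  li_keep : {in keep, forall x, pending_inv ((z, a) :: L) x /\ release x.1 <= a <= deadline x.1};
  li_mine : head_min elig;
  li_mink : head_min keep;
  li_cover : {in pend, forall x, [\/ x.1 \in ch, x.1 \in [seq y.1 | y <- elig] |
                                   x.1 \in [seq y.1 | y <- keep]]};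
  li_gpos : 0 < g;
  li_charge : ratr (2 ^ z) <= 8 * g * (pot ((z, a) :: L) - pot L);
  li_ch0 : (0 < jsize ch)%N;
  li_size : (jsize ch + psize elig + psize keep <= psize pend)%N;
  li_lsize : (level_size B + psize elig + psize keep + jr <= M)%N;
  li_ksize : {in keep, forall x, level_size x.2 + psize elig + psize keep + jr <= M}%N }.

(** The strict decrease in [sr_size] gives termination and makes room for the extra bit of a doubled
    level. The log is unchanged exactly in the case of a free service; [sr_zero] handles a
    nonpositive ratio. *)
Record service_result (E : {set 'I_(nelem G)}) (pend' : seq (@pending ND G)) (L' : seq (int * rat)) : Prop :=
  ServiceResult {
  sr_inv : {in pend', forall x, pending_inv L' x /\ release x.1 <= a <= deadline x.1};
  sr_min : head_min pend';
  sr_cover : {in pend, forall x, x.1 \in [seq y.1 | y <- pend'] \/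
                (E \in sat (jreq x.1) /\ release x.1 <= a <= deadline x.1)};
  sr_size : (psize pend' < psize pend)%N;
  sr_lsize : {in pend', forall x, level_size x.2 + psize pend' + jr <= M}%N;
  sr_log : L' = L \/ exists z, L' = (z, a) :: L;
  sr_charge : ratr (cost c E) <= 8 * g * (pot L' - pot L);
  sr_zero : g <= 0 -> cost c E = 0 }.

Definition approximates (Q : seq (job G)) E : Prop :=
  feasible [seq jreq j | j <- Q] E /\ ratr (cost c E) <= g * ratr (opt c [seq jreq j | j <- Q]).

Lemma loop_finish z B ch E keep : loop_inv z B ch E [::] keep ->
  service_result E keep ((z, a) :: L).
Proof.
case=> lvl den feas cst hch helig dl hkeep mine mink cover gpos charge ch0 size lsize ksize.
have size0 : psize [::] = 0%N by rewrite /psize /jsize big_nil.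
rewrite size0 addn0 in size; split=> //.
- move=> x /cover[xch|//|]; last by left.
  have [_ -> _] := hch _ xch; right; split=> //.
  by move: feas; rewrite /feasible all_map => /allP/(_ _ xch).
- by lia.
- by move=> x /ksize; rewrite size0 addn0.
- by right; exists z.
- by apply: le_trans charge; rewrite ler_rat -lvl.
- by rewrite leNgt gpos.
Qed.

(** The rejected set [h.1 :: ch] becomes the witness of every leftover request: its solution costs
    more than [B], hence [B] is below [g] times its optimum, and its deadlines are no later than
    theirs because [h] was the earliest eligible one. *)
Lemma loop_reject z B ch E h t keep E' : loop_inv z B ch E (h :: t) keep ->
  approximates (h.1 :: ch) E' -> fval B < cost c E' ->
  service_result E (insall keep (h :: t)) ((z, a) :: L).
Proof.
case=> lvl den feas cst hch helig dl hkeep mine mink cover gpos charge ch0 size lsize ksize.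
move=> [feas' cst'] big.
have pm := perm_insall keep (h :: t).
have psz := perm_psize pm; rewrite psize_cat in psz.
have hi := mine _ _ erefl.
split=> //.
- move=> x; rewrite (perm_mem pm) mem_cat => /orP[/hkeep //|xe].
  have [xB xg xra xL] := helig _ xe; split=> //.
  split=> //; rewrite ?xB //.
  + by right; exists z.
  + move=> l lL; rewrite xB lvl ltr_eXz2l //; exact: xL.
  + move=> z'; rewrite xB lvl => /(ieexprIz (ltr0n _ 2 : (0 < 2 :> rat)) (_ : 2 != 1)) zz'.
    have {}zz' : z = z' by apply: zz'.
    exists (h.1 :: ch); rewrite -zz'; split.
    * apply/allP => f; rewrite inE => /orP[/eqP ->|/hch[]//].
      by have [] := helig h (mem_head _ _).
    * move=> f; rewrite inE => /orP[/eqP ->|fch]; first exact: hi.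
      exact: dl.
    * move=> f; rewrite inE => /orP[/eqP ->|fch] l lL lz.
        have [_ _ _ H] := helig h (mem_head _ _); by apply: H => //; rewrite lz ltrDl.
      have [_ _ H] := hch _ fch; by apply: H => //; rewrite lz ltrDl.
    * by apply: le_trans cst'; rewrite ler_rat -lvl ltW.
- exact: head_min_insall.
- move=> x /cover[xch|xe|xk].
  + have [_ -> _] := hch _ xch; right; split=> //.
    by move: feas; rewrite /feasible all_map => /allP/(_ _ xch).
  + by left; rewrite (perm_mem (perm_map _ pm)) map_cat mem_cat xe orbT.
  + by left; rewrite (perm_mem (perm_map _ pm)) map_cat mem_cat xk.
- by rewrite psz; lia.
- move=> x; rewrite (perm_mem pm) mem_cat psz => /orP[/ksize|xe]; first by lia.
  by have [-> _ _ _] := helig _ xe; move: lsize; clear; lia.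
- by right; exists z.
- by apply: le_trans charge; rewrite ler_rat -lvl.
- by rewrite leNgt gpos.
Qed.

Lemma loop_accept z B ch E h t keep E' : loop_inv z B ch E (h :: t) keep ->
  feasible [seq jreq j | j <- h.1 :: ch] E' -> cost c E' <= fval B ->
  loop_inv z B (h.1 :: ch) E' (insall [::] t) keep.
Proof.
case=> lvl den feas cst hch helig dl hkeep mine mink cover gpos charge ch0 size lsize ksize.
move=> feas' cst'; have pm := perm_insall [::] t; have psz := perm_psize pm; rewrite /= in psz.
have hi := mine _ _ erefl; rewrite psize_cons in size lsize.
split=> //.
- move=> j; rewrite inE => /orP[/eqP ->|/hch //].
  by have [] := helig h (mem_head _ _).
- by move=> x; rewrite (perm_mem pm) => xt; apply: helig; rewrite inE xt orbT.
- move=> j x; rewrite (perm_mem pm) => + xt.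
  have xh : x \in h :: t by rewrite inE xt orbT.
  by rewrite inE => /orP[/eqP ->|jch]; [apply: hi|apply: dl].
- exact/head_min_insall/head_min_nil.
- move=> x /cover[xch|/=|xk]; [by constructor 1; rewrite inE xch orbT| |by constructor 3].
  rewrite inE => /orP[/eqP ->|xt]; first by constructor 1; rewrite mem_head.
  by constructor 2; rewrite (perm_mem (perm_map _ pm)).
- by rewrite jsize_cons.
- by rewrite jsize_cons psz; lia.
- by rewrite psz; lia.
- by move=> x /ksize; rewrite psz psize_cons; lia.
Qed.

Hypotheses (pend_min : head_min pend)
  (pend_inv : {in pend, forall x, pending_inv L x /\ release x.1 <= a <= deadline x.1})
  (pend_lsize : {in pend, forall x, level_size x.2 + psize pend + jr <= M}%N).

Lemma service_free q t E : pend = q :: t -> approximates [:: q.1] E -> cost c E = 0 ->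
  service_result E (insall [::] t) L.
Proof.
move=> pe [feas _] cst; have pm := perm_insall [::] t.
have psz := perm_psize pm; rewrite /= in psz.
have sub x : x \in t -> x \in pend by rewrite pe inE orbC => ->.
split.
- by move=> x; rewrite (perm_mem pm) => /sub/pend_inv.
- exact/head_min_insall/head_min_nil.
- move=> x xp; move: (xp); rewrite pe inE => /orP[/eqP xq|xt].
    right; have [_ ->] := pend_inv xp; split=> //.
    by move: feas; rewrite /feasible /= andbT xq.
  by left; rewrite (perm_mem (perm_map _ pm)) map_f.
- by rewrite psz pe psize_cons /=; lia.
- move=> x; rewrite (perm_mem pm) => /sub/pend_lsize.
  by rewrite psz pe psize_cons /=; lia.
- by left.
- by rewrite cst rmorph0 subrr mulr0.
- by [].
Qed.

Lemma level_size_double v : (level_size (fdouble v) <= level_size v + 1)%N.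
Proof.
rewrite /level_size /code_frac !dsize_Pair /=.
have := dsize_add v.1 v.1; rewrite maxnn -PoszD /=; lia.
Qed.

Lemma service_start q t E r zr : pend = q :: t -> a = deadline q.1 ->
  approximates [:: q.1] E -> (0 < r.2)%N -> fval r = 2 ^ zr -> 0 < cost c E ->
  cost c E <= fval r <= 4 * cost c E -> (level_size r + psize pend + jr <= M)%N ->
  let B := budget q.2 r in
  exists z, loop_inv z B [:: q.1] E (part B t).1 (part B t).2.
Proof.
move=> pe aq [feas cst] r0 er cpos /andP[cr rc] rsz B.
have sub x : x \in t -> x \in pend by rewrite pe inE orbC => ->.
have qp : q \in pend by rewrite pe mem_head.
have [[gq qd0 ql qu qw] qa] := pend_inv qp.
have qmin := pend_min pe.
have [z [eB B0 [Bq cB] lB [gpos charge]]] : exists z : int, [/\ fval B = 2 ^ z, (0 < B.2)%N,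
    fval q.2 <= fval B /\ cost c E <= fval B,
    (level_size B + psize t + jr <= M)%N
    & 0 < g /\ ratr (2 ^ z) <= 8 * g * (pot ((z, a) :: L) - pot L)].
  rewrite /B /budget; case: ifP => [|/negbT].
    (* The budget is the rounded cost: charge [q] alone. Its level is below the budget, so by
       [unseen] no service of this level has occurred since its release, and rounding gives [4 * g]
       times its optimum. *)
    rewrite fleE // fval_double => hq; exists zr; split=> //.
    - by split=> //; have := fval_ge0 q.2; lra.
    - by move: rsz; rewrite pe psize_cons; clear; lia.
    apply: (@service_charge L zr a [:: q.1]).
    - by rewrite /= gq.
    - by move=> f; rewrite inE aq => /eqP ->.
    - move=> f; rewrite inE => /eqP -> l lL lz; apply: qu => //; rewrite lz -er.
      have : 0 < fval r by rewrite er pow2_gt0.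
      have := fval_ge0 q.2; lra.
    rewrite -er; apply: le_trans (_ : ratr (4 * cost c E) <= _); first by rewrite ler_rat.
    by rewrite rmorphM /= ratr_nat -mulrA ler_pM2l.
  (* The budget is twice the level of [q]: charge the witness stored for that level. The level is
     defined, since doubling 0 cannot exceed the rounded cost. *)
  rewrite fleE // fval_double -ltNge => hq.
  have [z1 ez] : exists z : int, fval q.2 = 2 ^ z.
    case: ql => // q20; move: hq; rewrite /fval q20 mul0r mulr0.
    by rewrite ltNge fval_ge0.
  have [F [gF dF LF hF]] := qw z1 ez.
  exists (z1 + 1); split=> //.
  - by rewrite ez expfzDr // expr1z mulrC.
  - by split; have := fval_ge0 q.2; lra.
  - have := pend_lsize qp; have := level_size_double q.2; rewrite pe psize_cons; clear; lia.
  apply: (@service_charge L (z1 + 1) a F) => //.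
    by move=> f /dF; rewrite aq.
  have h0 : 0 < ratr (2 ^ z1) :> R by rewrite ltr0q pow2_gt0.
  rewrite expfzDr // expr1z rmorphM /= ratr_nat; lra.
exists z; have [p1 p2 m1 m2] := partP B t.
have inL l : l \in (z, a) :: L -> z < l.1 -> l \in L.
  by rewrite inE => /orP[/eqP ->|//]; rewrite ltxx.
have p1E x : x \in (part B t).1 -> exists2 y, y \in t & x = (y.1, B) /\ fval y.2 <= fval B.
  rewrite (perm_mem p1) => /mapP[y]; rewrite mem_filter => /andP[yB yt] ->.
  have [[_ y0 _ _ _] _] := pend_inv (sub _ yt).
  by exists y => //; split=> //; rewrite -fleE.
have p2E x : x \in (part B t).2 -> x \in t /\ fval B < fval x.2.
  rewrite (perm_mem p2) mem_filter => /andP[xB xt]; split=> //.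
  have [[_ x0 _ _ _] _] := pend_inv (sub _ xt).
  by rewrite ltNge -fleE.
have psz := psize_part B t.
split=> //.
- move=> j; rewrite inE => /eqP ->; split=> // l lL zl; apply: qu; first exact: inL.
  by apply: le_lt_trans Bq _; rewrite eB ltr_eXz2l.
- move=> x /p1E[y yt [-> yB]] /=; have [[gy _ _ yu _] ya] := pend_inv (sub _ yt).
  split=> // l lL zl; apply: yu; first exact: inL.
  by apply: le_lt_trans yB _; rewrite eB ltr_eXz2l.
- move=> j x; rewrite inE => /eqP -> /p1E[y yt [-> _]] /=.
  exact/qmin/sub.
- move=> x /p2E[xt xB]; have [[gx x0 xl xu xw] xa] := pend_inv (sub _ xt); split=> //.
  split=> //.
  + move=> l; rewrite inE => /orP[/eqP ->|lL]; last exact: xu.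
    by rewrite /= -eB ltNge ltW.
  (* The witness concerns services of level [z' + 1], while [z < z'] because [x] was not eligible:
     the new log entry cannot have that level. *)
  + move=> z' ez'; have [F [gF dF LF hF]] := xw z' ez'; exists F; split=> // f fF l.
    rewrite inE => /orP[/eqP -> /= zz'|]; last exact: LF.
    by move: xB; rewrite ez' eB zz' ltr_eXz2l ?ltr1n // gtrDl ltr10.
- move=> x; rewrite pe inE => /orP[/eqP ->|xt]; first by constructor 1; rewrite mem_head.
  case xB: (fle x.2 B).
    constructor 2; rewrite (perm_mem (perm_map _ p1)) -map_comp.
    by apply: (map_f (fun y => y.1)); rewrite mem_filter xB.
  by constructor 3; rewrite (perm_mem (perm_map _ p2)) map_f // mem_filter xB.
- by rewrite jsize_cons.
- by rewrite pe psize_cons jsize_cons {1}/jsize big_nil addn0 -addnA psz leqnn.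
- by rewrite -(addnA (level_size B)) psz.
- move=> x /p2E[xt _]; apply: leq_trans (pend_lsize (sub _ xt)).
  by rewrite leq_add2r -addnA psz leq_add2l pe psize_cons leq_addl.
Qed.

End Service.
End Invariants.

(** * Randomized execution of commands *)

Section RandomizedExec.
Context {R : realType}.
Local Notation rspec := (@rspec R _).

Lemma prefix_free_exec c s : prefix_free (exec c s).
Proof.
by move=> w t x w' t' x' u u' r1 r2; apply: (exec_prefix_free r1 r2).
Qed.

(** The empty coin word is a prefix of every word, so in a prefix-free family a run without coins is
    the only run. *)
Lemma rspec_single (T : choiceType) (run : seq bool -> nat -> T -> Prop) t y :
  prefix_free run -> run [::] t y -> rspec run (fun x => x = y) t.
Proof.
move=> pf r0.
have uniq w t' x : run w t' x -> [/\ w = [::], t' = t & x = y].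
  move=> r; have e : [::] ++ w = w ++ [::] by rewrite cats0.
  by have [<- <- <-] := pf _ _ _ _ _ _ _ _ r0 r e.
have setE : ([set o : seq bool * nat * T | run o.1.1 o.1.2 o.2] = [set ([::], t, y)])%classic.
  apply/seteqP; split=> [[[w t'] x] /= /uniq[-> -> ->] //|_ -> /=].
  exact: r0.
split=> //.
- rewrite /halts_almost_surely /Defs.expectation setE esum_set1 /= ?expr0 ?invr1 ?mul1r //.
- by move=> w t' x /uniq[].
- by rewrite /expected_time /Defs.expectation setE esum_set1 /= ?expr0 ?invr1 ?mul1r // lee_fin.
Qed.

Lemma rspec_det c s t s' (Q : store -> Prop) B :
  exec c s [::] t s' -> Q s' -> (t <= B)%N -> rspec (exec c s) Q B.
Proof.
move=> e q tB; apply: rspec_weaken (rspec_single (@prefix_free_exec c s) e) _ tB.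
by move=> x ->.
Qed.

Lemma rspec_seq c1 c2 s (Q1 Q : store -> Prop) B1 B2 :
  rspec (exec c1 s) Q1 B1 -> (forall s1, Q1 s1 -> rspec (exec c2 s1) Q B2) ->
  rspec (exec (Seq c1 c2) s) Q (B1 + B2 + 1).
Proof.
move=> h1 h2; apply: (rspec_bind (g := fun _ y => y) h1 h2) => w t z; split.
  move=> H; inversion H as [| | |? ? ? w1 t1 s1 w2 t2 s2 E1 E2| | | |]; subst.
  by exists w1, t1, s1, w2, t2, z; split=> //; rewrite addn1.
move=> [w1 [t1 [x [w2 [t2 [y [e1 e2 [-> -> ->]]]]]]]].
by rewrite addn1; apply: exec_seq e1 e2.
Qed.

Lemma rspec_while_true e c s (Q1 Q : store -> Prop) B1 B2 :
  Defs.eval s e != Int 0 -> rspec (exec c s) Q1 B1 ->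
  (forall s1, Q1 s1 -> rspec (exec (While e c) s1) Q B2) ->
  rspec (exec (While e c) s) Q (B1 + B2 + (ecost s e).+1).
Proof.
move=> ne h1 h2; apply: (rspec_bind (g := fun _ y => y) h1 h2) => w t z; split.
  move=> H; inversion H as [| | | | | |? ? ? w1 t1 s1 w2 t2 s2 ? E1 E2|? ? ? E]; subst.
    exists w1, t1, s1, w2, t2, z; split=> //; congr (_, _, _); lia.
  by rewrite E eqxx in ne.
move=> [w1 [t1 [x [w2 [t2 [y [e1 e2 [-> -> ->]]]]]]]].
have -> : (t1 + t2 + (ecost s e).+1 = (ecost s e + t1 + t2).+1)%N by lia.
exact: exec_while_true ne e1 e2.
Qed.

Lemma rspec_while_false e c s (Q : store -> Prop) :
  Defs.eval s e = Int 0 -> Q s -> rspec (exec (While e c) s) Q (ecost s e).+1.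
Proof. by move=> ee q; apply: (rspec_det (exec_while_false c ee)). Qed.

Lemma rspec_assign x e s (Q : store -> Prop) :
  Q (upd s x (Defs.eval s e)) -> rspec (exec (Assign x e) s) Q (ecost s e).+1.
Proof. by move=> q; apply: (rspec_det (exec_assign s x e)). Qed.

Lemma rspec_computes c f T b s (Q : store -> Prop) : computes c f T ->
  (forall s', s' b = f (s b) -> (forall r, (r < b)%N -> s' r = s r) -> Q s') ->
  rspec (exec (c b) s) Q (T (dsize (s b))).
Proof.
move=> H q; have [_ /(_ s)[t [s' [e v r tT]]]] := H b.
by apply: (rspec_det e) => //; apply: q.
Qed.

Fixpoint clear_below (m : nat) : cmd :=
  if m is n.+1 then Seq (clear_below n) (Assign n (Const (Int 0))) else Skip.

Lemma exec_clear_below m s : exists t s',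
  [/\ exec (clear_below m) s [::] t s', forall x, (x < m)%N -> s' x = Int 0,
      forall x, (m <= x)%N -> s' x = s x & (t <= 5 * m + 1)%N].
Proof.
elim: m => [|m [t [s' [e h1 h2 h3]]]].
  by exists 1%N, s; split=> //; constructor.
exists (t + (ecost s' (Const (Int 0%R))).+1).+1, (upd s' m (Int 0)); split.
- by apply: exec_seq0 e _; apply: exec_assign.
- move=> x; rewrite ltnS leq_eqVlt => /orP[/eqP ->|xm]; first by rewrite updE.
  by rewrite upd_neq ?h1 // ltn_eqF.
- by move=> x mx; rewrite upd_neq ?h2 ?gtn_eqF // ltnW.
- by rewrite /= trunc_log0; lia.
Qed.

Section Offline.
Context {ND : nd_class} {G : net ND} (c : 'I_(nelem G) -> rat) (P : cmd) (m : nat).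
Hypotheses (Pm : cmd_below m P) (m2 : (2 < m)%N).

Lemma code_seq_inj : injective code_seq.
Proof. exact: can_inj code_seqK. Qed.

Lemma code_set_inj : injective (@code_set (nelem G)).
Proof.
move=> E1 E2 /code_seq_inj /eq_in_map H; apply/setP => i.
by have := H i (mem_enum _ i); case: (i \in E1); case: (i \in E2).
Qed.

Lemma prefix_free_offline Q : prefix_free (offline_run P c Q).
Proof.
move=> w t x w' t' x' u u' [s1 e1 v1] [s2 e2 v2] e.
have [-> -> ss] := exec_prefix_free e1 e2 e; split=> //.
by apply: code_set_inj; rewrite -v1 -v2 ss.
Qed.

(** [offline_run] only counts executions whose result codes a set. Since these already have
    probability 1, [trace_full] shows that every halting execution of [P] is of this kind, so the
    caller never sees a malformed answer. *)
Lemma rspec_offline (Q : seq (req G)) s (A : {set 'I_(nelem G)} -> Prop) k :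
  rspec (offline_run P c Q) A k ->
  (forall x, (x < m)%N -> s x = init_store (code_offline c Q) x) ->
  rspec (exec P s) (fun s' => exists E, [/\ A E, s' 1%N = code_set E &
     forall x, (m <= x)%N -> s' x = s x]) k.
Proof.
move=> HP ag.
have [pf h _ _] := HP.
have full : (trace (exec P (init_store (code_offline c Q))) `<=` trace (offline_run P c Q))%classic.
  apply: (@trace_full R); first exact: prefix_free_exec.
    by move=> -[w t] [E [s' e _]]; exists s'.
  by have <- := expectation_trace (fun=> 1 : R) pf.
apply: (rspec_transfer HP (@prefix_free_exec _ _)).
- move=> w t s' e; have [s2 [e2 a2 f2]] := exec_frame e Pm ag.
  have [E [s3 e3 v3]] : trace (offline_run P c Q) (w, t) by apply: full; exists s2.
  exists E; first by exists s3.
  move=> AE; exists E; split=> //.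
    rewrite a2; last exact: ltn_trans m2.
    by have [_ _ ->] := exec_prefix_free e2 e3 (erefl (w ++ [::])).
  have [s4 [e4 a4 f4]] := exec_frame e2 Pm (fun x xm => esym (ag x xm)).
  by have [_ _ ->] := exec_prefix_free e e4 (erefl (w ++ [::])).
- move=> w t E [s3 e3 v3].
  by have [s4 [e4 a4 f4]] := exec_frame e3 Pm (fun x xm => esym (ag x xm)); exists s4.
Qed.

End Offline.
End RandomizedExec.

(** * The online program *)

Section Program.
Context (P : cmd) (m : nat) (ci cq cs cf : nat -> cmd).

(** Registers below [m] belong to [P] and are cleared before each call; [m] holds the persistent
    state, [m.+1] the loop state, and [m.+2] the query while the input of [P] is prepared. *)
Definition loop_body : cmd :=
  Seq (Assign m.+2 (Var m.+1)) (Seq (cq m.+2) (Seq (clear_below m)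
  (Seq (Assign 0 (Var m.+2)) (Seq P
  (Seq (Assign m.+1 (Bin OpPair (Var m.+1) (Var 1))) (cs m.+1)))))).

Definition main_loop : cmd := While (Fst (Var m.+1)) loop_body.

(** Register [m] is zero only before the first event; the instance is then saved there from register
    0, which the calls of [P] overwrite. *)
Definition event_handler : cmd :=
  Seq (If (Bin OpEq (Var m) (Const (Int 0)))
          (Assign m (Bin OpPair (Var 0) (Const (Int 0)))) Skip)
  (Seq (Assign m.+1 (Bin OpPair (Var m) (Var 1)))
  (Seq (ci m.+1) (Seq main_loop
  (Seq (cf m.+1) (Seq (Assign 2 (Fst (Var m.+1))) (Assign m (Snd (Var m.+1)))))))).

End Program.

Section Handler.
Context {R : realType} {ND : nd_class} {G : net ND} (c : 'I_(nelem G) -> rat).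
Context (O : schedule (nelem G)) (g : R) (P : cmd) (m : nat) (ci cq cs cf : nat -> cmd).
Context (ki kq ks kf kd kP : nat).
Hypothesis c0 : nonneg_costs c.
Hypotheses (Pm : cmd_below m P) (m2 : (2 < m)%N).
Hypotheses (Hi : computes ci dinit (poly_bound ki)) (Hq : computes cq dquery (poly_bound kq))
  (Hs : computes cs dstep (poly_bound ks)) (Hf : computes cf dfin (poly_bound kf)).
Hypotheses (Sq : forall d, (dsize (dquery d) <= poly_bound kq (dsize d))%N)
  (Sf : forall d, (dsize (dfin d) <= poly_bound kf (dsize d))%N)
  (Sd : forall d, (dsize (dround (dcost d)) <= poly_bound kd (dsize d))%N).
Local Notation rspec := (@rspec R _).
Hypothesis HP : forall Q : seq (req G), all (@satisfiable ND G) Q ->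
  rspec (offline_run P c Q) (approx_solution g c Q) (poly_bound kP (dsize (code_offline c Q))).

Implicit Types (pend elig keep l : seq (@pending ND G)).

Local Notation body := (loop_body P m cq cs).
Local Notation loop := (main_loop P m cq cs).
Local Notation handler := (event_handler P m ci cq cs cf).
Local Notation I := (dsize (code_instance c)).

Lemma dsize_code_set (E : {set 'I_(nelem G)}) : (dsize (code_set E) <= I)%N.
Proof.
rewrite /code_instance dsize_Pair -/(code_costs c) -addSn.
apply: leq_trans (leq_addl _ _).
rewrite /code_set /code_costs; elim: (enum _) => //= i s IH; rewrite ltnS.
by apply: leq_add IH; apply: leq_trans (leqnSn _); case: (i \in E).
Qed.

Lemma dsize_costs : (dsize (code_costs c) <= I)%N.
Proof. by rewrite /code_instance dsize_Pair -addSn leq_addl. Qed.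

Lemma dsize_code_jobs (s : seq (job G)) : (dsize (code_jobs s) <= jsize s + 1)%N.
Proof.
rewrite /code_jobs /jsize; elim: s => [|j s IH]; first by rewrite /= trunc_log0 big_nil.
have h : (dsize (req_code (jreq j)) <= dsize (code_arrival j))%N.
  by rewrite /code_arrival !dsize_Pair; clear; lia.
rewrite map_cons dsize_code_cons big_cons; move: h IH; clear; lia.
Qed.

Lemma dsize_code_pend l M : {in l, forall x, level_size x.2 <= M}%N ->
  (dsize (code_pend l) <= psize l * (M + 1) + 1)%N.
Proof.
rewrite /code_pend; elim: l => [|x l IH] H; first by rewrite /= trunc_log0; lia.
have {}IH := IH (fun y yl => H y (mem_behead (s := x :: l) yl)).
have hx : (level_size x.2 <= M)%N := H x (mem_head _ _).
rewrite psize_cons map_cons.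
have h : (dsize (code_pending x) <= dsize (code_arrival x.1) + level_size x.2)%N.
  by rewrite /code_pending /code_arrival /level_size !dsize_Pair; lia.
rewrite dsize_code_cons.
have k : (dsize (code_arrival x.1) + M + 1 <= (dsize (code_arrival x.1)).+1 * (M + 1))%N.
  by rewrite mulnDr muln1 mulSn; set k := (_ * M)%N; clearbody k; clear; lia.
rewrite mulnDl; move: h hx IH k; set A := (_.+1 * _)%N; set B := (psize l * _)%N; clear; lia.
Qed.

(** Bounds the loop state for an instance of size [i]; the product arises because each pending
    request carries a level of size up to [M]. *)
Definition wbound (i M : nat) : nat := (2 * i + 6 * M + M * (M + 1) + 40)%N.

Lemma dsize_codeW mode B ch (sols : seq {set 'I_(nelem G)}) elig keep M :
  (mode <= 2)%N -> (dsize B <= M)%N -> (size sols <= 1)%N ->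
  (jsize ch + psize elig + psize keep <= M)%N ->
  {in elig, forall x, level_size x.2 <= M}%N -> {in keep, forall x, level_size x.2 <= M}%N ->
  (dsize (codeW c mode B ch sols elig keep) <= wbound I M)%N.
Proof.
move=> hmode hB hsols hsz he hk.
have -> : dsize (codeW c mode B ch sols elig keep) = (dsize (Int mode) + (I +
    ((dsize B + dsize (code_jobs ch)).+1 + (dsize (code_sets sols) +
     (dsize (code_pend elig) + dsize (code_pend keep)).+1).+1).+1).+1).+1%N by [].
have h1 := dsize_code_jobs ch; have h2 := dsize_code_pend he; have h3 := dsize_code_pend hk.
have h4 : (dsize (Int mode) <= 2)%N by move: mode hmode => [|[|[|]]].
have d1 : dsize (code_seq [::]) = 1%N by rewrite /= trunc_log0.
have h5 : (dsize (code_sets sols) <= I + 2)%N.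
  move: sols hsols => [|E [|]] // _.
  rewrite -[code_sets _]/(code_seq [:: code_set E]) dsize_code_cons d1.
  by have := dsize_code_set E; clear; lia.
have h6 : (psize elig * (M + 1) + psize keep * (M + 1) <= M * (M + 1))%N.
  by rewrite -mulnDl leq_mul2r; apply/orP; right; move: hsz; clear; lia.
rewrite /wbound; move: hB hsz h1 h2 h3 h4 h5 h6.
set x := (psize elig * _)%N; set y := (psize keep * _)%N; set z := (M * _)%N.
clearbody x y z; clear; lia.
Qed.

Definition body_time (x : nat) : nat :=
  (x + 1 + poly_bound kq x + (5 * m + 1) + (poly_bound kq x + 1) +
   poly_bound kP (poly_bound kq x) + (4 * x + 2) + poly_bound ks (2 * x + 1) + 6)%N.

Lemma body_spec s mode B ch sols h t keep X :
  s m.+1 = codeW c mode B ch sols (h :: t) keep ->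
  all (fun j => satisfiable (jreq j)) (h.1 :: ch) -> (dsize (s m.+1) <= X)%N ->
  rspec (exec body s) (fun s' => exists E, approximates c g (h.1 :: ch) E /\
     s' m.+1 = dstep (Pair (codeW c mode B ch sols (h :: t) keep) (code_set E))) (body_time X).
Proof.
set W := codeW _ _ _ _ _ _ _ => sW sat szX.
have qW : dquery W = code_offline c [seq jreq j | j <- h.1 :: ch] by apply: dquery_code.
have satQ : all (@satisfiable ND G) [seq jreq j | j <- h.1 :: ch] by rewrite all_map.
have szW : (dsize W <= X)%N by rewrite -sW.
have szq : (dsize (dquery W) <= poly_bound kq X)%N.
  by apply: leq_trans (Sq W) _; apply: poly_bound_mono.
have szE (E : {set 'I_(nelem G)}) : (dsize (code_set E) <= X)%N.
  apply: leq_trans (dsize_code_set E) _; apply: leq_trans _ szW.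
  by rewrite /W /codeW /mkW !dsize_Pair; clear; lia.
apply: (@rspec_weaken _ _ _ _ _
  (X.+1 + (poly_bound kq X + ((5 * m + 1) + ((poly_bound kq X).+1 +
   (poly_bound kP (poly_bound kq X) + ((4 * X + 2) + poly_bound ks (2 * X + 1) + 1) + 1) + 1) + 1) + 1) + 1)%N _ _ (fun _ H => H));
  last by rewrite /body_time; lia.
apply: (@rspec_seq _ _ _ _ (fun s1 => s1 m.+1 = W /\ s1 m.+2 = W)).
  apply: rspec_weaken (rspec_assign (Q := fun s1 => s1 m.+1 = W /\ s1 m.+2 = W) _) (fun _ H => H) _.
    by rewrite updE upd_neq //= ?sW // ltn_eqF.
  by rewrite /= addn0 ltnS.
move=> s1 [a1 b1].
apply: (@rspec_seq _ _ _ _ (fun s2 => s2 m.+1 = W /\ s2 m.+2 = dquery W)).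
  apply: rspec_weaken (rspec_computes (Q := fun s2 => s2 m.+1 = W /\ s2 m.+2 = dquery W) Hq _) (fun _ H => H) _.
    by move=> s2 -> fr; rewrite fr // a1 b1.
  by rewrite b1; apply: poly_bound_mono.
move=> s2 [a2 b2].
apply: (@rspec_seq _ _ _ _ (fun s3 => [/\ s3 m.+1 = W, s3 m.+2 = dquery W & forall x, (x < m)%N -> s3 x = Int 0])).
  have [tc [s3 [e3 z3 f3 t3]]] := exec_clear_below m s2.
  by apply: (rspec_det e3) => //; rewrite !f3 // ltnW.
move=> s3 [a3 b3 z3].
apply: (@rspec_seq _ _ _ _ (fun s4 => s4 m.+1 = W /\
   forall x, (x < m)%N -> s4 x = init_store (code_offline c [seq jreq j | j <- h.1 :: ch]) x)).
  apply: rspec_weaken (rspec_assign (Q := fun s4 => s4 m.+1 = W /\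
   forall x, (x < m)%N -> s4 x = init_store (code_offline c [seq jreq j | j <- h.1 :: ch]) x) _) (fun _ H => H) _.
    rewrite upd_neq // a3; split=> // x xm; rewrite /= b3 qW /init_store /upd.
    by case: eqP => // _; rewrite z3.
  by rewrite /= addn0 ltnS b3.
move=> s4 [a4 b4].
apply: (@rspec_seq _ _ _ _ (fun s5 => s5 m.+1 = W /\ exists E, approximates c g (h.1 :: ch) E /\ s5 1%N = code_set E)).
  apply: rspec_weaken (rspec_offline Pm m2 (HP satQ) b4) _ _.
    move=> s5 [E [AE v5 f5]]; rewrite f5 //; split=> //; by exists E.
  by apply: poly_bound_mono; rewrite -qW.
move=> s5 [a5 [E [AE v5]]].
apply: (@rspec_seq _ _ _ _ (fun s6 => s6 m.+1 = Pair W (code_set E))).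
  apply: rspec_weaken (rspec_assign (Q := fun s6 => s6 m.+1 = Pair W (code_set E)) _) (fun _ H => H) _.
    by rewrite updE /= a5 v5.
  by rewrite /= a5 v5; have := szE E; lia.
move=> s6 a6.
apply: rspec_weaken (rspec_computes (Q := fun s2 => s2 m.+1 = dstep (Pair W (code_set E))) Hs _) _ _.
- by move=> s7 -> _; rewrite a6.
- by move=> s7 v7; exists E.
- rewrite a6; apply: poly_bound_mono; rewrite dsize_Pair; have := szE E; lia.
Qed.

Section Alarm.
Context (pend : seq (@pending ND G)) (a : rat) (L : seq (int * rat)) (jr M : nat).

Definition loop_result (W : data) : Prop := exists E pend' L',
  [/\ service_result c O g pend a L jr M E pend' L',
      dfin W = Pair (code_response [:: E] (omap (fun x => deadline x.1) (ohead pend')))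
                    (Pair (code_instance c) (code_pend pend'))
    & (dsize W <= wbound I M)%N].

Definition iter_time (x : nat) : nat := (body_time x + 2 * x + 2)%N.

Hypothesis pend_le : (psize pend <= M)%N.

Lemma loop_stop s (Q : store -> Prop) : dfst (s m.+1) = Int 0 -> (dsize (s m.+1) <= wbound I M)%N -> Q s ->
  rspec (exec loop s) Q (iter_time (wbound I M)).
Proof.
move=> h0 hX q; apply: rspec_weaken (rspec_while_false (Q := Q) _ _ _) (fun _ H => H) _ => //.
rewrite /= h0 /iter_time addn0; move: hX; clear; rewrite /= trunc_log0; lia.
Qed.

(** Induction on the number of eligible requests: an accepted solution removes one of them, a
    rejection ends the loop at the next test. *)
Lemma loop_spec n z B ch E elig keep s : (size elig <= n)%N ->
  loop_inv c O g pend a L jr M z B ch E elig keep ->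
  s m.+1 = codeW c (mode_of elig) (code_frac B) ch [:: E] elig keep ->
  rspec (exec loop s) (fun s' => loop_result (s' m.+1)) (n.+1 * iter_time (wbound I M)).
Proof.
have size_ok z' B' ch' E' elig' keep' mode : (mode <= 2)%N ->
    loop_inv c O g pend a L jr M z' B' ch' E' elig' keep' ->
    (dsize (codeW c mode (code_frac B') ch' [:: E'] elig' keep') <= wbound I M)%N.
  move=> hmode [] _ _ _ _ _ he _ _ _ _ _ _ _ _ hs hl hk; apply: dsize_codeW => //.
  - by move: hl; rewrite /level_size; clear; lia.
  - by move: hs pend_le; clear; lia.
  - by move=> x /he[-> _ _ _]; move: hl; clear; lia.
  - by move=> x /hk; apply: leq_trans; rewrite -!addnA leq_addr.
elim: n z B ch E elig keep s => [|n IH] z B ch E [|h t] keep s // szn inv sW.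
- rewrite mul1n; apply: loop_stop; rewrite sW //; first exact: (size_ok z).
  exists E, keep, ((z, a) :: L); split; [exact: loop_finish inv| |exact: (size_ok z)].
  by rewrite dfin_code.
- apply: rspec_weaken (loop_stop (Q := fun s' => loop_result (s' m.+1)) _ _ _) (fun _ H => H) _.
  + by rewrite sW.
  + by rewrite sW; apply: (size_ok z).
  + rewrite sW; exists E, keep, ((z, a) :: L); split; [exact: loop_finish inv| |exact: (size_ok z)].
    by rewrite dfin_code.
  + by rewrite leq_pmull.
have szW : (dsize (s m.+1) <= wbound I M)%N by rewrite sW; apply: (size_ok z).
have sat : all (fun j => satisfiable (jreq j)) (h.1 :: ch).
  case: inv => _ _ _ _ hch helig _ _ _ _ _ _ _ _ _ _ _ /=; apply/andP; split.
    by have [_ /and3P[]] := helig h (mem_head _ _).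
  by apply/allP => j /hch[/and3P[]].
rewrite [mode_of _]/= in sW.
apply: rspec_weaken (rspec_while_true (Q := fun s' => loop_result (s' m.+1)) _ (body_spec sW sat szW)
  (B2 := n.+1 * iter_time (wbound I M)) _) (fun _ H => H) _.
- by rewrite /= sW.
- move=> s' [E' [[feas' cst'] s'W]].
  have [lvl den] : fval B = 2 ^ z /\ (0 < B.2)%N by case: inv.
  rewrite dstep_next_code // in s'W; move: s'W; case: ifP => [le s'W|/negbT].
    apply: (IH _ _ _ _ _ _ _ _ (loop_accept inv feas' le) s'W).
    by rewrite (perm_size (perm_insall [::] t)).
  rewrite -ltNge => lt s'W.
  apply: rspec_weaken (loop_stop (Q := fun s' => loop_result (s' m.+1)) _ _ _) (fun _ H => H) _.
  + by rewrite s'W.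
  + by rewrite s'W; apply: (size_ok z).
  + rewrite s'W; exists E, (insall keep (h :: t)), ((z, a) :: L).
    split; [exact: (loop_reject inv _ lt)| by rewrite dfin_code|exact: (size_ok z)].
  + by rewrite leq_pmull.
- have h1 : (dsize (dfst (s m.+1)) <= dsize (s m.+1))%N := dsize_dfst _.
  rewrite [X in (_ <= X)%N]mulSn; set Y := (n.+1 * _)%N.
  rewrite /iter_time [ecost _ _]/= addn0; move: h1 szW; clear; lia.
Qed.

Hypotheses (pend_min : head_min pend)
  (pend_inv : {in pend, forall x, pending_inv c O g L x /\ release x.1 <= a <= deadline x.1})
  (pend_lsize : {in pend, forall x, level_size x.2 + psize pend + jr <= M}%N)
  (M_large : (poly_bound kd (2 * I + 1) + psize pend + jr <= M)%N).

Lemma alarm_loop q t s : pend = q :: t -> a = deadline q.1 ->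
  s m.+1 = codeW c 1 (Int 0) [::] [::] pend [::] ->
  rspec (exec loop s) (fun s' => loop_result (s' m.+1)) ((M + 2) * iter_time (wbound I M)).
Proof.
move=> pe aq sW; have M0 : (0 < M)%N by move: pend_le; rewrite pe psize_cons; clear; lia.
have inM x : x \in pend -> (level_size x.2 <= M)%N.
  by move/pend_lsize; apply: leq_trans; rewrite -addnA leq_addr.
have one : (dsize (Int 0) <= M)%N by [].
have j0 : jsize (ND := ND) (G := G) [::] = 0%N by rewrite /jsize big_nil.
have p0 : psize (ND := ND) (G := G) [::] = 0%N by [].
have szW : (dsize (s m.+1) <= wbound I M)%N.
  by rewrite sW; apply: dsize_codeW => //; rewrite j0 p0 add0n addn0.
have gq : good O q.1 by have [|[]] := pend_inv (x := q); rewrite ?pe ?mem_head.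
rewrite pe in sW.
have sat : all (fun j => satisfiable (jreq j)) [:: q.1] by rewrite /= andbT; case/and3P: gq.
apply: rspec_weaken (rspec_while_true (Q := fun s' => loop_result (s' m.+1)) _ (body_spec sW sat szW)
  (B2 := M.+1 * iter_time (wbound I M)) _) (fun _ H => H) _.
- by rewrite /= sW.
- move=> s' [E [AE s'W]].
  case: (dstep_first_code c0 E (Int 0) [::] [::] q t [::]) => [[cE e]|[r [[r0 er] [zr ezr] cpos rc e]]].
    rewrite e in s'W.
    have sz' : (dsize (s' m.+1) <= wbound I M)%N.
      rewrite s'W; apply: dsize_codeW => //.
        by rewrite j0 p0 add0n addn0; move: pend_le; rewrite pe psize_cons; clear; lia.
      by move=> x xt; apply: inM; rewrite pe inE xt orbT.
    apply: rspec_weaken (loop_stop (Q := fun s' => loop_result (s' m.+1)) _ sz' _) (fun _ H => H) _.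
    + by rewrite s'W.
    + exists E, (insall [::] t), L; split=> //; last by rewrite s'W dfin_code.
      exact: (service_free pend_inv pend_lsize pe AE cE).
    + by rewrite leq_pmull.
  rewrite e in s'W.
  (* A level obtained by rounding has size polynomial in the instance alone, whatever happened
     before; only doubling depends on the history. *)
  have lr : (level_size r + psize pend + jr <= M)%N.
    apply: leq_trans M_large; rewrite !leq_add2r /level_size er.
    apply: leq_trans (Sd _) _; apply: poly_bound_mono; rewrite dsize_Pair.
    have := dsize_code_set E; have := dsize_costs; clear; lia.
  have [z inv] := service_start c0 pend_min pend_inv pend_lsize pe aq AE r0 ezr cpos rc lr.
  apply: (loop_spec _ inv s'W).
  case: inv => _ _ _ _ _ _ _ _ _ _ _ _ _ _ hs _ _.
  have h : (size (part (budget q.2 r) t).1 <= psize (part (budget q.2 r) t).1)%N.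
    elim: (_.1) => // x l IH; rewrite psize_cons /=; move: IH; clear; lia.
  move: h hs pend_le; clear; lia.
- have h1 : (dsize (dfst (s m.+1)) <= dsize (s m.+1))%N := dsize_dfst _.
  rewrite addn2 [X in (_ <= X)%N]mulSn; set Y := (M.+1 * _)%N.
  rewrite /iter_time [ecost _ _]/= addn0; move: h1 szW; clear; lia.
Qed.

End Alarm.

Definition state_at (s : store) l : Prop :=
  s m = Pair (code_instance c) (code_pend l) \/
  [/\ s m = Int 0, s 0%N = code_instance c & l = [::]].

Definition handler_time (x b : nat) : nat :=
  (5 * x + 20 + poly_bound ki x + b + 5 * poly_bound kf x)%N.

(** Kept abstract in the behaviour [Q1] of the loop, since arrivals and alarms share everything
    else. *)
Lemma handler_spec s l ev X (Q1 : data -> Prop) (Q : store -> Prop) b :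
  state_at s l ->
  (dsize (Pair (code_instance c) (code_pend l)) + dsize ev + 4 <= X)%N ->
  (forall s1, s1 m.+1 = dinit (Pair (Pair (code_instance c) (code_pend l)) ev) ->
     rspec (exec loop s1) (fun s' => Q1 (s' m.+1)) b) ->
  (forall W, Q1 W -> (dsize W <= X)%N) ->
  (forall W s', Q1 W -> s' 2%N = dfst (dfin W) -> s' m = dsnd (dfin W) -> Q s') ->
  rspec (exec handler (upd s 1 ev)) Q (handler_time X b).
Proof.
set st := Pair _ _ => sl hX hloop szQ1 Q1Q.
have m0 : (0 < m)%N by apply: ltn_trans m2.
have m1 : (1 < m)%N by apply: ltn_trans m2.
have d1 : dsize (Int 0) = 1%N by rewrite /= trunc_log0.
apply: (@rspec_weaken _ _ _ _ _
  ((3 * X + 8) + ((2 * X + 1) + (poly_bound ki X + (b + (poly_bound kf X +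
   ((2 * poly_bound kf X + 1) + (2 * poly_bound kf X + 1) + 1) + 1) + 1) + 1) + 1) + 1)%N _ _ (fun _ H => H));
  last by rewrite /handler_time; clear; lia.
have sti : (dsize (code_instance c) < dsize st)%N by rewrite /st dsize_Pair; clear; lia.
apply: (@rspec_seq _ _ _ _ (fun s1 => s1 m = st /\ s1 1%N = ev)).
  set e := Bin OpEq (Var m) (Const (Int 0)).
  have e_m : upd s 1 ev m = s m by rewrite upd_neq // gtn_eqF.
  have costE : (ecost (upd s 1 ev) e <= dsize (s m) + 2)%N.
    have -> : ecost (upd s 1 ev) e = (dsize (dbool (upd s 1 ev m == Int 0)) +
      ((dsize (upd s 1 ev m) + 0) + (dsize (Int 0) + 0)))%N by [].
    by rewrite dsize_dbool e_m d1; clear; lia.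
  case: sl => [sm|[sm s0 l0]].
    have h : exec (If e (Assign m (Bin OpPair (Var 0) (Const (Int 0)))) Skip) (upd s 1 ev) [::]
        (ecost (upd s 1 ev) e + 1).+1 (upd s 1 ev).
      by apply: exec_if_false; [rewrite /e /= e_m sm|constructor].
    apply: (rspec_det h); first by rewrite e_m sm updE.
    move: costE; rewrite sm -/st; move: hX; clear; lia.
  have h : exec (If e (Assign m (Bin OpPair (Var 0) (Const (Int 0)))) Skip) (upd s 1 ev) [::]
      (ecost (upd s 1 ev) e + (ecost (upd s 1 ev) (Bin OpPair (Var 0) (Const (Int 0)))).+1).+1
      (upd (upd s 1 ev) m st).
    apply: exec_if_true; first by rewrite /e /= e_m sm.
    have -> : st = Defs.eval (upd s 1 ev) (Bin OpPair (Var 0) (Const (Int 0))).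
      by rewrite /= upd_neq // s0 /st l0.
    exact: exec_assign.
  apply: (rspec_det h); first by rewrite updE upd_neq ?updE // ltn_eqF.
  move: costE; rewrite sm d1.
  have -> : ecost (upd s 1 ev) (Bin OpPair (Var 0) (Const (Int 0))) =
    ((dsize (code_instance c) + 1).+1 + (dsize (code_instance c) + 1))%N.
    have -> : ecost (upd s 1 ev) (Bin OpPair (Var 0) (Const (Int 0))) =
      (dsize (Pair (upd s 1 ev 0%N) (Int 0)) +
       ((dsize (upd s 1 ev 0%N) + 0) + (dsize (Int 0) + 0)))%N by [].
    by rewrite upd_neq // s0 !addn0 dsize_Pair d1.
  move: hX sti; clear; lia.
move=> s1 [a1 b1].
apply: (@rspec_seq _ _ _ _ (fun s2 => s2 m.+1 = Pair st ev)).
  apply: rspec_weaken (rspec_assign (Q := fun s2 => s2 m.+1 = Pair st ev) _) (fun _ H => H) _.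
    by rewrite updE /= a1 b1.
  rewrite [ecost _ _]/= a1 b1 !addn0 -/(dsize st); move: hX; clear; lia.
move=> s2 a2.
apply: (@rspec_seq _ _ _ _ (fun s3 => s3 m.+1 = dinit (Pair st ev))).
  apply: rspec_weaken (rspec_computes (Q := fun s3 => s3 m.+1 = dinit (Pair st ev)) Hi _) (fun _ H => H) _.
    by move=> s3 -> _; rewrite a2.
  by rewrite a2; apply: poly_bound_mono; rewrite dsize_Pair; move: hX; clear; lia.
move=> s3 a3.
apply: (@rspec_seq _ _ _ _ (fun s4 => Q1 (s4 m.+1))); first exact: hloop.
move=> s4 q4.
have fX : (dsize (dfin (s4 m.+1)) <= poly_bound kf X)%N.
  by apply: leq_trans (Sf _) _; apply/poly_bound_mono/szQ1.
apply: (@rspec_seq _ _ _ _ (fun s5 => s5 m.+1 = dfin (s4 m.+1))).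
  apply: rspec_weaken (rspec_computes (Q := fun s5 => s5 m.+1 = dfin (s4 m.+1)) Hf _) (fun _ H => H) _ => //.
  by apply/poly_bound_mono/szQ1.
move=> s5 a5.
apply: (@rspec_seq _ _ _ _ (fun s6 => s6 m.+1 = dfin (s4 m.+1) /\ s6 2%N = dfst (dfin (s4 m.+1)))).
  apply: rspec_weaken (rspec_assign (Q := fun s6 => s6 m.+1 = dfin (s4 m.+1) /\
    s6 2%N = dfst (dfin (s4 m.+1))) _) (fun _ H => H) _.
    by rewrite updE /= a5 upd_neq // gtn_eqF // ltnW.
  rewrite [ecost _ _]/= a5 addn0; have := dsize_dfst (dfin (s4 m.+1)); move: fX; clear; lia.
move=> s6 [a6 b6].
apply: rspec_weaken (rspec_assign (Q := Q) _) (fun _ H => H) _.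
  by apply: (Q1Q _ _ q4); rewrite /= ?updE ?a6 // upd_neq // ltn_eqF.
rewrite [ecost _ _]/= a6 addn0; have := dsize_dsnd (dfin (s4 m.+1)); move: fX; clear; lia.
Qed.

Definition event_time (x M : nat) : nat := handler_time x ((M + 2) * iter_time x).

Lemma alarm_event pend a L jr M q t s : pend = q :: t -> a = deadline q.1 ->
  (psize pend <= M)%N -> head_min pend ->
  {in pend, forall x, pending_inv c O g L x /\ release x.1 <= a <= deadline x.1} ->
  {in pend, forall x, level_size x.2 + psize pend + jr <= M}%N ->
  (poly_bound kd (2 * I + 1) + psize pend + jr <= M)%N ->
  state_at s pend ->
  rspec (exec handler (upd s 1 (code_alarm a)))
    (fun s' => exists E pend' L', [/\ service_result c O g pend a L jr M E pend' L',
       s' 2%N = code_response [:: E] (omap (fun x => deadline x.1) (ohead pend'))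
       & s' m = Pair (code_instance c) (code_pend pend')])
    (event_time (wbound I M) M).
Proof.
move=> pe aq le hmin inv lsz large sl.
apply: (handler_spec (Q1 := loop_result pend a L jr M) sl).
- have inM x : x \in pend -> (level_size x.2 <= M)%N.
    by move/lsz; apply: leq_trans; rewrite -addnA leq_addr.
  have h := dsize_code_pend inM.
  have h2 : (psize pend * (M + 1) <= M * (M + 1))%N by rewrite leq_mul2r le orbT.
  have h3 : (dsize (code_rat a) <= psize pend)%N.
    by rewrite pe psize_cons aq /code_arrival !dsize_Pair; clear; lia.
  have d2 : dsize (Int 2) = 2%N by [].
  have -> : dsize (Pair (code_instance c) (code_pend pend)) = (I + dsize (code_pend pend)).+1%N by [].
  have -> : dsize (code_alarm a) = (dsize (Int 2) + dsize (code_rat a)).+1%N by [].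
  rewrite d2 /wbound.
  move: h h2 h3 le; set u := (psize pend * _)%N; set v := (M * _)%N; clearbody u v; clear; lia.
- move=> s1 s1W; apply: (@alarm_loop pend a L jr M le hmin inv lsz large q t) => //.
- by move=> W [E [pend' [L' []]]].
- move=> W s' [E [pend' [L' [sr e _]]]] e2 em; exists E, pend', L'; split=> //.
    by rewrite e2 e.
  by rewrite em e.
Qed.

(** An arrival only enters the request with the undefined level [(0, 1)]; the loop starts in mode 0
    and exits at once. *)
Lemma arrival_event l j M s : (psize l + (dsize (code_arrival j)).+1 <= M)%N ->
  {in l, forall x, level_size x.2 <= M}%N -> (level_size (0, 1) <= M)%N -> state_at s l ->
  rspec (exec handler (upd s 1 (code_arrival j)))
    (fun s' => s' 2%N = code_response (n := nelem G) [::] (omap (fun x => deadline x.1) (ohead (ins (j, (0, 1)%N) l)))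
       /\ s' m = Pair (code_instance c) (code_pend (ins (j, (0, 1)%N) l)))
    (event_time (wbound I M) M).
Proof.
move=> le lsz l01 sl; pose W0 := codeW c 0 (Int 0) [::] [::] [:: (j, (0, 1)%N)] l.
have j0 : jsize (ND := ND) (G := G) [::] = 0%N by rewrite /jsize big_nil.
have szW0 : (dsize W0 <= wbound I M)%N.
  apply: dsize_codeW => //.
  - by apply: leq_trans _ le; rewrite addnS.
  - by rewrite j0 psize_cons /psize j0 add0n addn0 /= -/(psize l) addnC.
  - by move=> x; rewrite inE => /eqP ->.
apply: (handler_spec (Q1 := fun W => W = W0) sl).
- have h := dsize_code_pend lsz.
  have h2 : (psize l * (M + 1) <= M * (M + 1))%N.
    by rewrite leq_mul2r; apply/orP; right; move: le; clear; lia.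
  have -> : dsize (Pair (code_instance c) (code_pend l)) = (I + dsize (code_pend l)).+1%N by [].
  rewrite /wbound; move: h h2 le; set u := (psize l * _)%N; set v := (M * _)%N; clearbody u v; clear; lia.
- move=> s1 s1W; rewrite dinit_arrival in s1W.
  apply: rspec_weaken (loop_stop (M := M) (Q := fun s' => s' m.+1 = W0) _ _ _) (fun _ H => H) _ => //.
  + by rewrite s1W.
  + by rewrite s1W.
  + by rewrite leq_pmull // addn2.
- by move=> W ->.
- by move=> W s' -> -> ->; rewrite dfin_code.
Qed.

End Handler.

(** * Online executions *)

Lemma code_rat_inj : injective code_rat.
Proof. by move=> x y [nE dE]; rewrite -[x]divq_num_den -[y]divq_num_den nE dE. Qed.

Lemma code_response_inj n (Es Es' : seq {set 'I_n}) al al' :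
  code_response Es al = code_response Es' al' -> Es = Es' /\ al = al'.
Proof.
move=> [/code_seq_inj eE ea]; split; last first.
  by move: ea; case: al => [x|]; case: al' => [y|] // [nE dE]; congr Some; apply: code_rat_inj; rewrite /code_rat nE dE.
apply: (inj_map _ eE) => E1 E2 /code_seq_inj /eq_in_map H; apply/setP => i.
by have := H i (mem_enum _ i); case: (i \in E1); case: (i \in E2).
Qed.

Section OnlineRuns.
Context {ND : nd_class} {G : net ND} (A : cmd).

(** The alarm and the next release decide which event comes next, so the coins remain the only
    nondeterminism. *)
Lemma prefix_free_online s al (J : seq (job G)) : prefix_free (online_from A s al J).
Proof.
move=> w t S w' t' S' u u' H; elim: H w' t' S' u u' => {s al J w t S}.
- by move=> s w' t' S' u u' H; inversion H; subst.
- move=> s al j J w1 t1 s1 Es al1 w2 t2 S le e1 r1 _ IH w' t' S' u u' H.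
  inversion H as [|? ? ? ? w1' t1' s1' Es' al1' w2' t2' S2 le' e1' r1' o2'|? a' ? ? ? ? ? ? ? ? ? lt' ? ? ?]; subst.
    rewrite -!catA => E.
    have [ew et es] := exec_prefix_free e1 e1' E; subst.
    move: E => /eqP; rewrite eqseq_cat // eqxx /= => /eqP E.
    have [? ?] : Es = Es' /\ al1 = al1' by apply: code_response_inj; rewrite -r1 -r1'.
    by subst; have [-> -> ->] := IH _ _ _ _ _ o2' E.
  by have := lt' _ _ erefl; rewrite ltNge le.
- move=> s a J w1 t1 s1 Es al1 w2 t2 S lt e1 r1 _ IH w' t' S' u u' H.
  inversion H as [|? ? j' J' ? ? ? ? ? ? ? ? le' ? ? ?|? ? ? w1' t1' s1' Es' al1' w2' t2' S2 lt' e1' r1' o2']; subst.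
    by have := lt _ _ erefl; rewrite ltNge le'.
  rewrite -!catA => E.
  have [ew et es] := exec_prefix_free e1 e1' E; subst.
  move: E => /eqP; rewrite eqseq_cat // eqxx /= => /eqP E.
  have [? ?] : Es = Es' /\ al1 = al1' by apply: code_response_inj; rewrite -r1 -r1'.
  by subst; have [-> -> ->] := IH _ _ _ _ _ o2' E.
Qed.

Lemma online_coin_free s al (J : seq (job G)) w t S :
  online_from A s al J w t S -> coin_free A -> w = [::].
Proof.
move=> H cf; elim: H => {s al J w t S} //.
- by move=> s al j J w1 t1 s1 Es al1 w2 t2 S _ e _ _ ->; rewrite (exec_coin_free e).
- by move=> s a J w1 t1 s1 Es al1 w2 t2 S _ e _ _ ->; rewrite (exec_coin_free e).
Qed.

End OnlineRuns.

Section RandomizedOnline.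
Context {R : realType}.
Local Notation rspec := (@rspec R _).

Lemma rspec_eq (T : choiceType) (run run' : seq bool -> nat -> T -> Prop) Q b :
  (forall w t x, run w t x <-> run' w t x) -> rspec run Q b -> rspec run' Q b.
Proof.
by move=> H; have -> // : run = run'; apply/funext => w; apply/funext => t; apply/funext => x; apply/propext.
Qed.

Lemma rspec_map (T1 T2 : choiceType) (run : seq bool -> nat -> T1 -> Prop) (f : T1 -> T2)
    (Q : T2 -> Prop) b : rspec run (fun x => Q (f x)) b ->
  rspec (fun w t y => exists2 x, run w t x & y = f x) Q b.
Proof.
move=> H; have [pf _ _ _] := H; apply: (rspec_transfer H).
- move=> w t _ w' t' _ u u' [x r ->] [x' r' ->] e.
  by have [-> -> ->] := pf _ _ _ _ _ _ _ _ r r' e.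
- by move=> w t _ [x r ->]; exists x.
- by move=> w t x r; exists (f x), x.
Qed.

Section Event.
Context {ND : nd_class} {G : net ND} (A : cmd).

Lemma rspec_online_event s ev tau J (run : seq bool -> nat -> schedule (nelem G) -> Prop)
    (Q1 : store -> Prop) (Q : schedule (nelem G) -> Prop) b1 b2 :
  (forall w t S, run w t S <-> exists w1 t1 s1 Es al1 w2 t2 S2,
     [/\ exec A (upd s 1 ev) w1 t1 s1, s1 2%N = code_response Es al1,
         online_from A s1 (omap (Num.max tau) al1) J w2 t2 S2 &
         (w, t, S) = (w1 ++ w2, (t1 + t2)%N, [seq (tau, E) | E <- Es] ++ S2)]) ->
  rspec (exec A (upd s 1 ev)) Q1 b1 ->
  (forall s1, Q1 s1 -> exists Es al1, s1 2%N = code_response Es al1 /\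
     rspec (online_from A s1 (omap (Num.max tau) al1) J)
       (fun S => Q ([seq (tau, E) | E <- Es] ++ S)) b2) ->
  rspec run Q (b1 + b2).
Proof.
move=> runE h1 h2; rewrite -[(b1 + b2)%N]addn0.
pose run2 (s1 : store) w t (S : schedule (nelem G)) := exists Es al1 S2,
  [/\ s1 2%N = code_response Es al1, online_from A s1 (omap (Num.max tau) al1) J w t S2 &
      S = [seq (tau, E) | E <- Es] ++ S2].
apply: (rspec_bind (run2 := run2) (g := fun _ y => y) h1).
  move=> s1 /h2[Es [al1 [e1 H]]].
  apply: rspec_eq (rspec_map H) => w t S; split.
    by move=> [S2 o ->]; exists Es, al1, S2.
  move=> [Es' [al1' [S2 [e1' o ->]]]].
  have [? ?] : Es = Es' /\ al1 = al1' by apply: code_response_inj; rewrite -e1 -e1'.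
  by subst; exists S2.
move=> w t S; split.
  move=> /runE[w1 [t1 [s1 [Es [al1 [w2 [t2 [S2 [e r o [-> -> ->]]]]]]]]]].
  by exists w1, t1, s1, w2, t2, ([seq (tau, E) | E <- Es] ++ S2); split; rewrite ?addn0 //; exists Es, al1, S2.
move=> [w1 [t1 [s1 [w2 [t2 [S' [e [Es [al1 [S2 [r o ->]]]] [-> -> ->]]]]]]]].
by apply/runE; exists w1, t1, s1, Es, al1, w2, t2, S2; rewrite addn0.
Qed.

Lemma online_arrivalE s al j J w t (S : schedule (nelem G)) :
  (forall a, al = Some a -> release j <= a) ->
  online_from A s al (j :: J) w t S <-> exists w1 t1 s1 Es al1 w2 t2 S2,
     [/\ exec A (upd s 1 (code_arrival j)) w1 t1 s1, s1 2%N = code_response Es al1,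
         online_from A s1 (omap (Num.max (release j)) al1) J w2 t2 S2 &
         (w, t, S) = (w1 ++ w2, (t1 + t2)%N, [seq (release j, E) | E <- Es] ++ S2)].
Proof.
move=> le; split.
  move=> H; inversion H as [|? ? ? ? w1 t1 s1 Es al1 w2 t2 S2 le' e r o|? a' ? ? ? ? ? ? ? ? ? lt' ? ? ?]; subst.
    by exists w1, t1, s1, Es, al1, w2, t2, S2.
  by have := lt' _ _ erefl; rewrite ltNge le.
move=> [w1 [t1 [s1 [Es [al1 [w2 [t2 [S2 [e r o [-> -> ->]]]]]]]]]].
exact: online_arrival le e r o.
Qed.

Lemma online_alarmE s a J w t (S : schedule (nelem G)) :
  (forall j J', J = j :: J' -> a < release j) ->
  online_from A s (Some a) J w t S <-> exists w1 t1 s1 Es al1 w2 t2 S2,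
     [/\ exec A (upd s 1 (code_alarm a)) w1 t1 s1, s1 2%N = code_response Es al1,
         online_from A s1 (omap (Num.max a) al1) J w2 t2 S2 &
         (w, t, S) = (w1 ++ w2, (t1 + t2)%N, [seq (a, E) | E <- Es] ++ S2)].
Proof.
move=> lt; split.
  move=> H; inversion H as [|? ? j' J' ? ? ? ? ? ? ? ? le' ? ? ?|? ? ? w1 t1 s1 Es al1 w2 t2 S2 lt' e r o]; subst.
    by have := lt _ _ erefl; rewrite ltNge le'.
  by exists w1, t1, s1, Es, al1, w2, t2, S2.
move=> [w1 [t1 [s1 [Es [al1 [w2 [t2 [S2 [e r o [-> -> ->]]]]]]]]]].
exact: online_alarm lt e r o.
Qed.

End Event.
End RandomizedOnline.

Section Online.
Context {R : realType} {ND : nd_class} {G : net ND} (c : 'I_(nelem G) -> rat).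
Context (O : schedule (nelem G)) (g : R) (P : cmd) (m : nat) (ci cq cs cf : nat -> cmd).
Context (ki kq ks kf kd kP M : nat).
Hypothesis c0 : nonneg_costs c.
Hypotheses (Pm : cmd_below m P) (m2 : (2 < m)%N).
Hypotheses (Hi : computes ci dinit (poly_bound ki)) (Hq : computes cq dquery (poly_bound kq))
  (Hs : computes cs dstep (poly_bound ks)) (Hf : computes cf dfin (poly_bound kf)).
Hypotheses (Sq : forall d, (dsize (dquery d) <= poly_bound kq (dsize d))%N)
  (Sf : forall d, (dsize (dfin d) <= poly_bound kf (dsize d))%N)
  (Sd : forall d, (dsize (dround (dcost d)) <= poly_bound kd (dsize d))%N).
Local Notation rspec := (@rspec R _).
Hypothesis HP : forall Q : seq (req G), all (@satisfiable ND G) Q ->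
  rspec (offline_run P c Q) (approx_solution g c Q) (poly_bound kP (dsize (code_offline c Q))).

Local Notation handler := (event_handler P m ci cq cs cf).
Local Notation I := (dsize (code_instance c)).
Local Notation pot := (potential (fun e => ratr (c e) : R) O (8 * g)^-1).
Local Notation T := (event_time m ki kq ks kf kP (wbound I M) M).

(** [oi_cross] ensures that when the earliest deadline rings, every pending request has been
    released. [oi_log] lets a new arrival enter with [unseen] satisfied. In [oi_size] the 3 is the
    size of the undefined level. *)
Record online_inv (s : store) (pend : seq (@pending ND G)) (L : seq (int * rat))
    (J : seq (job G)) : Prop := OnlineInv {
  oi_state : state_at c m s pend;
  oi_min : head_min pend;
  oi_inv : {in pend, forall x, pending_inv c O g L x};
  oi_cross : {in pend &, forall x y, release x.1 <= deadline y.1};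
  oi_next : {in pend & J, forall x j, release x.1 <= release j};
  oi_sorted : sorted (fun j1 j2 : job G => release j1 <= release j2) J;
  oi_good : {in J, forall j, good O j};
  oi_log : {in L & J, forall l j, l.2 < release j};
  oi_size : (poly_bound kd (2 * I + 1) + 3 + psize pend + jsize J <= M)%N;
  oi_level : {in pend, forall x, level_size x.2 + psize pend + jsize J <= M}%N }.

(** The cost is stated as an increase from the current log to some final one, so that the bounds of
    successive events telescope. *)
Definition online_post (pend : seq (@pending ND G)) (L : seq (int * rat)) (J : seq (job G)) (S : schedule (nelem G)) : Prop :=
  [/\ {in pend, forall x : @pending ND G, served S x.1}, serves_all J S,
      exists L', ratr (schedule_cost c S) <= 8 * g * (pot L' - pot L)
    & g <= 0 -> schedule_cost c S = 0].

Lemma schedule_cost_cons (x : rat * {set 'I_(nelem G)}) S :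
  schedule_cost c (x :: S) = cost c x.2 + schedule_cost c S.
Proof. by rewrite /schedule_cost big_cons. Qed.

Lemma served_cons x S (j : job G) : served S j -> served (x :: S) j.
Proof. by rewrite /served /= => ->; rewrite orbT. Qed.

Lemma sorted_release (j : job G) J :
  sorted (fun j1 j2 : job G => release j1 <= release j2) (j :: J) ->
  {in J, forall j', release j <= release j'}.
Proof.
move=> /order_path_min h j' jJ; have /allP := h (fun y x z => @le_trans _ _ (release y) _ _).
exact.
Qed.

(** No pending deadline lies in the past, so the model never postpones the alarm to the current
    time. *)
Lemma max_alarm tau (l : seq (@pending ND G)) :
  {in l, forall x, tau <= deadline x.1} ->
  omap (Num.max tau) (omap (fun x => deadline x.1) (ohead l)) =
  omap (fun x => deadline x.1) (ohead l).
Proof. by case: l => //= x l h; rewrite max_r // h ?mem_head. Qed.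

Lemma online_inv_arrival s s' pend L j J :
  online_inv s pend L (j :: J) ->
  {in pend, forall x, release j <= deadline x.1} ->
  s' m = Pair (code_instance c) (code_pend (ins (j, (0, 1)%N) pend)) ->
  online_inv s' (ins (j, (0, 1)%N) pend) L J.
Proof.
case=> st hmin pinv cross next srt gJ log sz lsz le st'.
have l01 : (level_size (0, 1) = 3)%N by [].
have pm := perm_ins (j, (0, 1)%N) pend; have psz := perm_psize pm.
rewrite psize_cons [(_, _).1]/= in psz.
have gj : good O j by apply: gJ; rewrite mem_head.
have dj : release j <= deadline j by case/and3P: gj.
have sub j' : j' \in J -> j' \in j :: J by rewrite inE orbC => ->.
split.
- by left.
- exact: head_min_ins.
- move=> x; rewrite (perm_mem pm) inE => /orP[/eqP ->|/pinv //]; split=> //.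
  + by left.
  + by move=> l lL _; apply: log; rewrite ?mem_head.
  + by move=> z; rewrite /fval mul0r => e; have := pow2_gt0 z; rewrite -e ltxx.
- move=> x y; rewrite !(perm_mem pm) !inE => /orP[/eqP ->|xp] /orP[/eqP ->|yp] //=.
  + exact: le.
  + by apply: le_trans dj; apply: next; rewrite ?mem_head.
  + exact: cross.
- move=> x j'; rewrite (perm_mem pm) inE => /orP[/eqP -> jJ|xp /sub]; last exact: next.
  exact: sorted_release srt _ jJ.
- exact: path_sorted srt.
- by move=> j' /sub/gJ.
- by move=> l j' lL /sub; apply: log.
- by rewrite psz; move: sz; rewrite jsize_cons; clear; lia.
- move=> x; rewrite (perm_mem pm) inE psz => /orP[/eqP ->|/lsz].
    rewrite [(_, _).2]/= l01; move: sz; rewrite jsize_cons; clear; lia.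
  rewrite jsize_cons -!addnA; apply: leq_trans; rewrite leq_add2l addnCA leqnn //.
Qed.

Lemma online_inv_service s s' pend a L J E pend' L' :
  online_inv s pend L J -> {in J, forall j, a < release j} ->
  service_result c O g pend a L (jsize J) M E pend' L' ->
  s' m = Pair (code_instance c) (code_pend pend') ->
  online_inv s' pend' L' J.
Proof.
case=> st hmin pinv cross next srt gJ log sz lsz aJ [sinv smin _ ssz slsz slog _ _] st'.
split=> //.
- by left.
- by move=> x /sinv[].
- move=> x y /sinv[_ /andP[h1 _]] /sinv[_ /andP[_ h2]]; exact: le_trans h1 h2.
- by move=> x j /sinv[_ /andP[h1 _]] /aJ h2; rewrite (le_trans h1) // ltW.
- case: slog => [->|[z ->]] // l j; rewrite inE => /orP[/eqP ->|]; [exact: aJ|exact: log].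
- by move: sz ssz; clear; lia.
Qed.

(** The measure counts future jobs twice: an arrival turns a future job into a pending one, and an
    alarm serves at least one pending job. *)
Lemma online_spec n s pend L J : (2 * jsize J + psize pend <= n)%N -> online_inv s pend L J ->
  rspec (online_from handler s (omap (fun x => deadline x.1) (ohead pend)) J)
    (online_post pend L J) (n * T).
Proof.
have j0 : jsize (ND := ND) (G := G) [::] = 0%N by rewrite /jsize big_nil.
have done_spec k s' L' : rspec (online_from handler s' None [::]) (online_post [::] L' [::]) (k * T).
  have r0 := @online_done ND G handler s'.
  apply: rspec_weaken (rspec_single (@prefix_free_online _ _ _ _ _ _) r0) _ (leq0n _).
  move=> S ->; split=> //; last by rewrite /schedule_cost big_nil.
  by exists L'; rewrite subrr mulr0 /schedule_cost big_nil rmorph0.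
elim: n s pend L J => [|n IH] s pend L J szn inv.
  case: J szn {inv} => [|j J]; last by rewrite jsize_cons; clear; lia.
  case: pend => [|q t]; last by rewrite psize_cons; clear; lia.
  by move=> _; apply: (done_spec 0%N).
have [st hmin pinv cross next srt gJ log sz lsz] := inv.
have l01 : (level_size (0, 1) = 3)%N by [].
have bnd : (psize pend + jsize J <= M)%N by move: sz; clear; lia.
have inM : {in pend, forall x, level_size x.2 <= M}%N.
  by move=> x /lsz; apply: leq_trans; rewrite -addnA leq_addr.
rewrite mulSn.
(* The next event is an arrival unless the alarm is strictly earlier, as the model breaks ties in
   favour of arrivals. *)
pose arr := if J is j :: _ then if pend is q :: _ then release j <= deadline q.1 else true else false.
have [harr|harr] := boolP arr.
  move: harr; rewrite /arr; case EJ: J => [//|j J'] harr; rewrite {}EJ in szn inv next srt gJ log sz lsz bnd *.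
  have le a : omap (fun x => deadline x.1) (ohead pend) = Some a -> release j <= a.
    by case: (pend) harr => //= q t h [<-].
  have le' : {in pend, forall x, release j <= deadline x.1}.
    move=> x xp; case: (pend) harr hmin xp => // q t h /(_ q t erefl) H xq.
    by apply: le_trans h _; apply: H.
  apply: (rspec_online_event (tau := release j) (fun w t S => online_arrivalE _ _ _ _ _ _ le)).
    apply: (arrival_event (M := M) (l := pend) cq cs kq ks kP Pm m2 Hi Hf Sf) => //.
      by move: bnd; rewrite jsize_cons; clear; lia.
    by rewrite l01; move: sz; clear; lia.
  move=> s1 [r1 st1]; eexists; eexists; split; first exact: r1.
  have pm := perm_ins (j, (0, 1)%N) pend.
  rewrite max_alarm; last first.
    move=> x; rewrite (perm_mem pm) inE => /orP[/eqP ->|/le' //].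
    by have /and3P[_ _ /=] : good O j by apply: gJ; rewrite mem_head.
  apply: rspec_weaken (IH _ _ _ _ _ (online_inv_arrival inv le' st1)) _ (leqnn _).
    by move: szn; rewrite (perm_psize pm) jsize_cons psize_cons [(_, _).1]/=; clear; lia.
  move=> S [s1' s2' s3' s4']; split=> //.
    by move=> x xp; apply: s1'; rewrite (perm_mem pm) inE xp orbT.
  apply/andP; split; last exact: s2'.
  by apply: (s1' (j, (0, 1)%N)); rewrite (perm_mem pm) mem_head.
case: pend szn inv st hmin pinv cross next sz lsz bnd inM @arr harr => [|q t] szn inv st hmin pinv cross next sz lsz bnd inM.
  case: J szn inv next srt gJ log sz lsz bnd => [|j J] //= *.
  rewrite -mulSn; exact: done_spec.
move=> /= harr; set a := deadline q.1 in harr *.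
have lt j J' : J = j :: J' -> a < release j by move=> EJ; move: harr; rewrite EJ -ltNge.
have aJ : {in J, forall j, a < release j}.
  case EJ: J => [//|j J'] j'; rewrite inE => /orP[/eqP ->|jJ]; first exact: lt EJ.
  apply: lt_le_trans (lt _ _ EJ) _; rewrite EJ in srt; exact: sorted_release srt _ jJ.
have rda x : x \in q :: t -> release x.1 <= a <= deadline x.1.
  by move=> xp; rewrite cross ?mem_head //= (hmin _ _ erefl).
apply: (rspec_online_event (tau := a) (fun w t S => online_alarmE _ _ _ _ _ lt)).
  apply: (alarm_event (M := M) (jr := jsize J) (L := L) (pend := q :: t) c0 Pm m2 Hi Hq Hs Hf Sq Sf Sd HP
    (erefl _) (erefl _)) => //.
  - by move: bnd; clear; lia.
  - by move=> x xp; split; [exact: pinv|exact: rda].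
  - by move: sz; clear; lia.
move=> s1 [E [pend' [L' [sr r1 st1]]]]; eexists; eexists; split; first exact: r1.
have [sinv smin scov ssz slsz slog scharge szero] := sr.
rewrite max_alarm; last by move=> x /sinv[_ /andP[]].
apply: rspec_weaken (IH _ _ _ _ _ (online_inv_service inv aJ sr st1)) _ (leqnn _).
  by move: szn ssz; clear; lia.
move=> S [p1 p2 [L'' p3] p4]; split.
- move=> x /scov[/mapP[y yp ->]|[xE xa]]; first by apply: served_cons; apply: p1.
  by rewrite /served /= xa xE.
- by apply: sub_all p2 => j; apply: served_cons.
- exists L''; rewrite schedule_cost_cons rmorphD /=.
  have -> : pot L'' - pot L = (pot L' - pot L) + (pot L'' - pot L') by ring.
  by rewrite mulrDr lerD.
- by move=> g0; rewrite schedule_cost_cons szero // p4 // addr0.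
Qed.

End Online.

(** * The competitive algorithm *)

Lemma body_time_mono m kq ks kP x y : (x <= y)%N ->
  (body_time m kq ks kP x <= body_time m kq ks kP y)%N.
Proof.
move=> xy; have h1 := poly_bound_mono kq xy; have h2 := poly_bound_mono kP h1.
have h3 : (poly_bound ks (2 * x + 1) <= poly_bound ks (2 * y + 1))%N.
  by apply: poly_bound_mono; move: xy; clear; lia.
by rewrite /body_time; move: xy h1 h2 h3; clear; lia.
Qed.

Lemma event_time_mono m ki kq ks kf kP M x y : (x <= y)%N ->
  (event_time m ki kq ks kf kP x M <= event_time m ki kq ks kf kP y M)%N.
Proof.
move=> xy; have h1 := poly_bound_mono ki xy; have h2 := poly_bound_mono kf xy.
have h3 : ((M + 2) * iter_time m kq ks kP x <= (M + 2) * iter_time m kq ks kP y)%N.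
  rewrite leq_mul2l; apply/orP; right; have := body_time_mono m kq ks kP xy.
  by rewrite /iter_time; move: xy; clear; lia.
by rewrite /event_time /handler_time; move: xy h1 h2 h3; clear; lia.
Qed.

(** * Expected cost, and the passage between randomized and deterministic guarantees *)

Section Expectations.
Context {R : realType} {T : choiceType} (run : seq bool -> nat -> T -> Prop).

Lemma expectation_single t y (f : nat -> T -> R) : prefix_free run -> run [::] t y ->
  0 <= f t y -> Defs.expectation run f = (f t y)%:E.
Proof.
move=> pf r0 f0.
have setE : ([set o : seq bool * nat * T | run o.1.1 o.1.2 o.2] = [set ([::], t, y)])%classic.
  apply/seteqP; split=> [[[w t'] x] /= r|_ -> /=]; last exact: r0.
  have e : [::] ++ w = w ++ [::] by rewrite cats0.
  by have [<- <- <-] := pf _ _ _ _ _ _ _ _ r0 r e.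
by rewrite /Defs.expectation setE esum_set1 /= ?expr0 ?invr1 ?mul1r // lee_fin.
Qed.

Lemma halts_ex : halts_almost_surely R run -> exists w t y, run w t y.
Proof.
rewrite /halts_almost_surely /Defs.expectation => h; apply: contrapT => H.
have : (0 = 1 :> \bar R)%E.
  rewrite -[RHS]h esum1 // => -[[w t] y] /= r; case: H; by exists w, t, y.
by move/eqP; rewrite eqe eq_sym oner_eq0.
Qed.

Lemma expectation_le (f : nat -> T -> R) V : halts_almost_surely R run ->
  (forall w t y, run w t y -> 0 <= f t y <= V) -> (Defs.expectation run f <= V%:E)%E.
Proof.
move=> h fV; have [w0 [t0 [y0 /fV/andP[a b]]]] := halts_ex h.
have V0 : 0 <= V := le_trans a b.
have -> : (V%:E = V%:E * Defs.expectation run (fun _ _ => 1%R : R))%E by rewrite h mule1.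
apply: le_trans (_ : (\esum_(o in [set o : seq bool * nat * T | run o.1.1 o.1.2 o.2]%classic)
   (V%:E * (2 ^- size o.1.1 * 1)%:E) <= _)%E).
  apply: le_esum => -[[w t] y] /= /fV/andP[_ fv].
  by rewrite -EFinM lee_fin mulr1 mulrC ler_wpM2r // invr_ge0 exprn_ge0.
rewrite le_eqVlt in V0; case/orP: V0 => [/eqP <-|V0].
  by rewrite mul0e esum1 // => i _; rewrite mul0e.
by rewrite esumZl // => i; rewrite lee_fin mulr1 invr_ge0 exprn_ge0.
Qed.

End Expectations.

Lemma deterministic_randomized_approx (R : realType) (ND : nd_class) (gamma : net ND -> R) P :
  deterministic_polytime_approx gamma P -> randomized_polytime_approx gamma P.
Proof.
move=> [cf [k H]]; exists k => G c Q inp; have [t [E [r a tk]]] := H G c Q inp.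
have pf := @prefix_free_offline ND G c P Q.
have [_ h1 h2 h3] := rspec_single (R := R) pf r; split=> //.
- by move=> w t' E' /h2 ->.
- by apply: le_trans h3 _; rewrite lee_fin ler_nat.
Qed.

(** A coin-free program that halts almost surely has a run, which draws no coins and is the only
    one; expectations are then its actual cost and time. *)
Lemma randomized_deterministic_competitive (R : realType) (ND : nd_class) (alpha : net ND -> R) A :
  coin_free A -> randomized_polytime_competitive alpha A ->
  deterministic_polytime_competitive alpha A.
Proof.
move=> cf [k H]; split=> //; exists k => G c J inp; have [h1 h2 h3 h4] := H G c J inp.
have [w [t [S r]]] := halts_ex h1.
have w0 := online_coin_free r cf; rewrite w0 in r.
have pf := @prefix_free_online ND G A (init_store (code_instance c)) None J.
have cS : 0 <= ratr (schedule_cost c S) :> R.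
  rewrite ler0q; apply: sumr_ge0 => x _; apply: sumr_ge0 => e _; by case: inp.
exists t, S; split=> //; first exact: h2 r.
- by move: h3; rewrite (expectation_single pf r cS) lee_fin.
- move: h4; rewrite /expected_time (expectation_single pf r) //= lee_fin ler_nat.
  exact.
Qed.

(** Transmitting all elements at each release gives a first feasible schedule, so that the infimum
    defining [online_opt] is over a nonempty set. *)
Lemma serves_all_ex (ND : nd_class) (G : net ND) (J : seq (job G)) :
  all (fun j => satisfiable (jreq j) && (release j <= deadline j)) J ->
  serves_all J [seq (release j, [set: 'I_(nelem G)]%SET) | j <- J].
Proof.
move=> /allP H; apply/allP => j jJ; have /andP[sj dj] := H j jJ.
apply/hasP; exists (release j, [set: 'I_(nelem G)]%SET).
  by apply/mapP; exists j.
by rewrite /= lexx dj.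
Qed.

Lemma online_opt_ge (R : realType) (ND : nd_class) (G : net ND) (c : 'I_(nelem G) -> rat)
    (J : seq (job G)) (v : R) : online_input c J ->
  (forall S, serves_all J S -> v <= ratr (schedule_cost c S)) -> v <= online_opt R c J.
Proof.
move=> [_ _ okJ] H; apply: lb_le_inf.
  by eexists; exists [seq (release j, [set: 'I_(nelem G)]%SET) | j <- J] => //; apply: serves_all_ex.
by move=> _ [S SJ <-]; apply: H.
Qed.

Lemma online_opt_le (R : realType) (ND : nd_class) (G : net ND) (c : 'I_(nelem G) -> rat)
    (J : seq (job G)) S : nonneg_costs c -> serves_all J S ->
  online_opt R c J <= ratr (schedule_cost c S).
Proof.
move=> c0 SJ; apply: ge_inf; last by exists S.
exists 0 => _ [S' _ <-]; rewrite ler0q.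
by apply: sumr_ge0 => x _; apply: cost_ge0.
Qed.

Lemma online_competitive (R : realType) (ND : nd_class) (gamma : net ND -> R) P :
  randomized_polytime_approx gamma P -> exists A, (coin_free P -> coin_free A) /\
    randomized_polytime_competitive
      (fun G : net ND => 64 * gamma G * (1 + ln (nelem G)%:R)) A.
Proof.
move=> [kP HP].
have [ci [ki [Hi _]]] := polytime_dinit; have [cq [kq [Hq Sq]]] := polytime_dquery.
have [cs [ks [Hs _]]] := polytime_dstep; have [cf [kf [Hf Sf]]] := polytime_dfin.
have [_ [kd [_ Sd]]] := polytime_comp polytime_dcost polytime_dround.
have [m0 Pm0] := cmd_below_ex P; pose m := (m0 + 3)%N.
have Pm : cmd_below m P by apply: cmd_below_mono Pm0; rewrite leq_addr.
have m2 : (2 < m)%N by rewrite /m; lia.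
exists (event_handler P m ci cq cs cf); split.
  move=> cfP; rewrite /event_handler /main_loop /loop_body /= cfP.
  rewrite (proj1 (Hi _)) (proj1 (Hq _)) (proj1 (Hs _)) (proj1 (Hf _)) /= andbT.
  by have -> : coin_free (clear_below m) by elim: m {Pm m2} => //= n ->.
pose Mb x := (poly_bound kd (2 * x + 1) + 3 + x)%N.
pose T x := (2 * x * event_time m ki kq ks kf kP (wbound x (Mb x)) (Mb x))%N.
have Mp : polyb Mb.
  by rewrite /Mb; solve_polyb.
have wp : polyb (fun x => wbound x (Mb x)) by rewrite /wbound; solve_polyb.
have pbp k (f : nat -> nat) : polyb f -> polyb (fun x => poly_bound k (f x)).
  by move=> pf; apply: (polyb_comp (T1 := poly_bound k)) pf; exact: polyb_pb.
have [k Tk] : polyb T.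
  rewrite /T /event_time /handler_time /iter_time /body_time.
  have q1 := pbp kq _ wp; have q2 := pbp kP _ q1; have q3 := pbp ki _ wp; have q4 := pbp kf _ wp.
  have q5 : polyb (fun x => poly_bound ks (2 * wbound x (Mb x) + 1)).
    by apply: pbp; solve_polyb.
  by solve_polyb.
exists k => G c J inp; have [c0 srt okJ] := inp.
have HPr (Q : seq (req G)) : all (@satisfiable ND G) Q ->
    @rspec R _ (offline_run P c Q) (approx_solution (gamma G) c Q)
      (poly_bound kP (dsize (code_offline c Q))).
  move=> satQ; have [h1 h2 h3] := HP G c Q (conj c0 satQ); split=> //.
  exact: prefix_free_offline.
pose N := dsize (code_online c J); pose M := Mb N.
have NE : N = (dsize (code_instance c) + (jsize J + 1)).+1%N.
  rewrite /N /code_online dsize_Pair; congr (_ + _).+1%N.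
  elim: (J) => [|j s IH]; first by rewrite /jsize big_nil /= trunc_log0.
  by rewrite map_cons dsize_code_cons IH jsize_cons addSn addnA.
(* The program does not mention [O]: feasibility and running time follow from any one offline
   schedule, while the cost bound is used for each of them. *)
have main (O : schedule (nelem G)) : serves_all J O ->
    @rspec R _ (online_run (event_handler P m ci cq cs cf) c J)
      (online_post c O (gamma G) [::] [::] J) (poly_bound k N).
  move=> OJ.
  have H := @online_spec R ND G c O (gamma G) P m ci cq cs cf ki kq ks kf kd kP M c0 Pm m2
    Hi Hq Hs Hf Sq Sf Sd HPr (2 * jsize J) (init_store (code_instance c)) [::] [::] J.
  apply: rspec_weaken (H _ _) (fun _ h => h) _.
  - by rewrite /psize {2}/jsize big_nil addn0.
  - split=> //.
    + right; split=> //; rewrite /init_store upd_neq // /m; lia.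
    + move=> j jJ; apply/and3P; have /andP[h1 h2] := allP okJ j jJ.
      by split=> //; exact: (allP OJ).
    + rewrite /M /Mb /psize {1}/jsize big_nil addn0 leq_add //; last by rewrite NE; lia.
      by rewrite leq_add2r; apply: poly_bound_mono; rewrite NE; lia.
  - apply: leq_trans (Tk N); rewrite /T leq_mul //; first by rewrite NE; lia.
    apply: event_time_mono; rewrite /wbound !leq_add2r leq_mul2l NE.
    by apply/orP; right; lia.
have [_ hh hs ht] := main _ (serves_all_ex okJ).
split=> //; first by move=> w t S /hs[].
apply: (expectation_le hh) => w t S r; have [_ SJ _ Sz] := hs _ _ _ r.
have S0 : 0 <= schedule_cost c S by apply: sumr_ge0 => x _; apply: cost_ge0.
rewrite ler0q S0 /=.
have l0 : 1 <= 1 + ln (nelem G)%:R :> R.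
  have := @trunc_log_le_ln R (nelem G).
  have : 0 <= (trunc_log 2 (nelem G))%:R :> R by rewrite ler0n.
  lra.
(* A nonpositive ratio forces every service to be free, so the optimum is 0 as well. *)
case: (leP (gamma G) 0) => g0.
  have -> : online_opt R c J = 0.
    apply/eqP; rewrite eq_le; apply/andP; split.
      by have := online_opt_le R c0 SJ; rewrite Sz // rmorph0.
    by apply: online_opt_ge inp _ => S' _; rewrite ler0q; apply: sumr_ge0 => x _; apply: cost_ge0.
  by rewrite Sz // rmorph0 mulr0.
set alpha := 64 * _ * _; have a0 : 0 < alpha.
  by rewrite /alpha !mulr_gt0 //; lra.
rewrite -ler_pdivrMl //; apply: online_opt_ge inp _ => O OJ; rewrite ler_pdivrMl //.
have [_ _ hO _] := main O OJ; have [_ _ [L' cL] _] := hO _ _ _ r.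
apply: le_trans cL _; rewrite potential_nil subr0.
set K := (trunc_log 2 (nelem G)).+1.
have nK : (nelem G < 2 ^ K)%N by apply: trunc_log_ltn.
have kpos : 0 < (8 * gamma G)^-1 by rewrite invr_gt0 mulr_gt0.
have cR e : 0 <= ratr (c e) :> R by rewrite ler0q c0.
have h := potential_le O cR kpos L' nK.
have -> : ratr (schedule_cost c O) = \sum_(x <- O) \sum_(e in x.2) ratr (c e) :> R.
  by rewrite /schedule_cost rmorph_sum; apply: eq_bigr => x _; rewrite /= ratr_cost.
set V := (X in _ <= _ * X) in h *.
have V0 : 0 <= V by apply: sumr_ge0 => x _; apply: sumr_ge0 => e _.
(* The constant 64 is [8 * 4 * 2]: the charge of a service, the geometric sum at each scale, and the
   bound of [K + 1] by [2 * (1 + ln n)]. *)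
apply: le_trans (_ : 8 * gamma G * (4 * (K%:R + 1) * V) <= _).
  by rewrite ler_pM2l // mulr_gt0.
have hK : K%:R + 1 <= 2 * (1 + ln (nelem G)%:R) :> R.
  by have := @trunc_log_le_ln R (nelem G); rewrite /K -natr1; lra.
have -> : alpha * V = 8 * gamma G * (4 * (2 * (1 + ln (nelem G)%:R)) * V).
  by rewrite /alpha; ring.
rewrite ler_pM2l ?mulr_gt0 // ler_wpM2r // ler_pM2l //.
Qed.

Theorem theorem2p1 (R : realType) :
  exists2 C : R, 0 < C &
    forall (ND : nd_class) (gamma : net ND -> R),
      let alpha := fun G : net ND => C * gamma G * (1 + ln (nelem G)%:R) in
      ((exists P : cmd, deterministic_polytime_approx gamma P) ->
       (exists A : cmd, deterministic_polytime_competitive alpha A)) /\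
      ((exists P : cmd, randomized_polytime_approx gamma P) ->
       (exists A : cmd, randomized_polytime_competitive alpha A)).
Proof.
exists 64 => // ND gamma alpha; split=> -[P HP].
  have [A [cfA HA]] := online_competitive (deterministic_randomized_approx HP).
  exists A; apply: randomized_deterministic_competitive HA; apply: cfA.
  by case: HP.
by have [A [_ HA]] := online_competitive HP; exists A.
Qed.
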